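(* Let $D$ be a bounded strictly convex domain with $\mathcal{C}^2$-boundary in $\mathbb{C}^n$. There exists a positive integer $s$ with the following property. For any positive integer $p$ and for any continuous map $h\colon \overline{D}\to \mathbb{B}_p$ which is an injective holomorphic immersion in $D$, there exists a holomorphic map $f\colon D\to \mathbb{C}^{2s}$ such that the map $(f,h)\colon D\to \mathbb{B}_{2s+p}$ is a complete proper holomorphic embedding.
   Context: $\mathbb{B}_m$ denotes the open unit ball in $\mathbb{C}^m$. A holomorphic embedding (or immersion) $F\colon D\to\mathbb{C}^m$ from an open set $D\subset\mathbb{C}^n$ is called complete if the Riemannian metric $F^*ds^2$ on $D$ obtained by pulling back the Euclidean metric $ds^2$ of $\mathbb{C}^m$ is a complete metric on $D$. *)

(* Defs.v *)
From Stdlib Require Import Reals.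
From Coquelicot Require Import Complex.
From mathcomp Require Import ssreflect ssrfun ssrbool eqtype ssrnat fintype bigop.

Set Implicit Arguments.
Unset Strict Implicit.
Open Scope R_scope.

Definition Cn (n : nat) := 'I_n -> C.

Definition vadd {n} (z w : Cn n) : Cn n := fun i => Cplus (z i) (w i).
Definition vsub {n} (z w : Cn n) : Cn n := fun i => Cminus (z i) (w i).
Definition vscal {n} (a : C) (z : Cn n) : Cn n := fun i => Cmult a (z i).
Definition vzero (n : nat) : Cn n := fun _ => RtoC 0.
Arguments vzero : clear implicits.

Definition vnorm {n} (z : Cn n) : R :=
  sqrt (\big[Rplus/0]_(i < n) (Cmod (z i) * Cmod (z i))).
Definition vdist {n} (z w : Cn n) : R := vnorm (vsub z w).

Definition unit_ball (m : nat) : Cn m -> Prop := fun z => vnorm z < 1.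
Arguments unit_ball : clear implicits.

Definition open_set {n} (A : Cn n -> Prop) : Prop :=
  forall z, A z -> exists e, 0 < e /\ forall w, vdist w z < e -> A w.
Definition bounded_set {n} (A : Cn n -> Prop) : Prop :=
  exists M, forall z, A z -> vnorm z <= M.
Definition connected_set {n} (A : Cn n -> Prop) : Prop :=
  forall U V : Cn n -> Prop, open_set U -> open_set V ->
    (forall z, A z -> U z \/ V z) ->
    (forall z, A z -> U z -> V z -> False) ->
    (exists z, A z /\ U z) -> (exists z, A z /\ V z) -> False.
Definition domain {n} (A : Cn n -> Prop) : Prop :=
  open_set A /\ connected_set A /\ exists z, A z.
Definition closure {n} (A : Cn n -> Prop) : Cn n -> Prop :=
  fun z => forall e, 0 < e -> exists w, A w /\ vdist w z < e.
Definition bdry {n} (A : Cn n -> Prop) : Cn n -> Prop :=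
  fun z => closure A z /\ ~ A z.
(* sequential compactness (= compactness in C^n) *)
Definition seq_compact {n} (K : Cn n -> Prop) : Prop :=
  forall x : nat -> Cn n, (forall k, K (x k)) ->
    exists (phi : nat -> nat) (y : Cn n),
      (forall k, (phi k < phi k.+1)%nat) /\ K y /\
      forall e, 0 < e -> exists N, forall k, (N <= k)%nat -> vdist (x (phi k)) y < e.

Definition cont_on {n m} (A : Cn n -> Prop) (F : Cn n -> Cn m) : Prop :=
  forall z, A z -> forall e, 0 < e -> exists d, 0 < d /\
    forall w, A w -> vdist w z < d -> vdist (F w) (F z) < e.

Definition rlinear {n m} (L : Cn n -> Cn m) : Prop :=
  (forall h k, L (vadd h k) = vadd (L h) (L k)) /\
  (forall (r : R) h, L (vscal (RtoC r) h) = vscal (RtoC r) (L h)).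
Definition clinear {n m} (L : Cn n -> Cn m) : Prop :=
  rlinear L /\ forall h, L (vscal Ci h) = vscal Ci (L h).

Definition is_rderiv {n m} (F : Cn n -> Cn m) (z : Cn n) (L : Cn n -> Cn m) : Prop :=
  rlinear L /\ forall e, 0 < e -> exists d, 0 < d /\ forall h, vnorm h < d ->
    vnorm (vsub (vsub (F (vadd z h)) (F z)) (L h)) <= e * vnorm h.
Definition is_cderiv {n m} (F : Cn n -> Cn m) (z : Cn n) (L : Cn n -> Cn m) : Prop :=
  clinear L /\ is_rderiv F z L.

Definition holomorphic_on {n m} (D : Cn n -> Prop) (F : Cn n -> Cn m) : Prop :=
  forall z, D z -> exists L, is_cderiv F z L.
Definition immersion_on {n m} (D : Cn n -> Prop) (F : Cn n -> Cn m) : Prop :=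
  forall z, D z -> exists L, is_cderiv F z L /\
    forall v, L v = vzero m -> v = vzero n.
Definition injective_on {n m} (D : Cn n -> Prop) (F : Cn n -> Cn m) : Prop :=
  forall z w, D z -> D w -> F z = F w -> z = w.

Definition holo_embedding_on {n m} (D : Cn n -> Prop) (F : Cn n -> Cn m) : Prop :=
  holomorphic_on D F /\ immersion_on D F /\ injective_on D F /\
  (forall z, D z -> forall e, 0 < e -> exists d, 0 < d /\
     forall w, D w -> vdist (F w) (F z) < d -> vdist w z < e).

Definition proper_into {n m} (D : Cn n -> Prop) (B : Cn m -> Prop) (F : Cn n -> Cn m) : Prop :=
  forall K, seq_compact K -> (forall w, K w -> B w) ->
    seq_compact (fun z => D z /\ K (F z)).

Definition rlinear_fun {n} (l : Cn n -> R) : Prop :=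
  (forall h k, l (vadd h k) = l h + l k) /\
  (forall (r : R) h, l (vscal (RtoC r) h) = r * l h).
Definition is_rderiv_fun {n} (g : Cn n -> R) (z : Cn n) (l : Cn n -> R) : Prop :=
  rlinear_fun l /\ forall e, 0 < e -> exists d, 0 < d /\ forall h, vnorm h < d ->
    Rabs (g (vadd z h) - g z - l h) <= e * vnorm h.
Definition cont_fun_on {n} (U : Cn n -> Prop) (g : Cn n -> R) : Prop :=
  forall z, U z -> forall e, 0 < e -> exists d, 0 < d /\
    forall w, U w -> vdist w z < d -> Rabs (g w - g z) < e.
Definition C2_on {n} (U : Cn n -> Prop) (rho : Cn n -> R)
    (D1 : Cn n -> Cn n -> R) (D2 : Cn n -> Cn n -> Cn n -> R) : Prop :=
  (forall z, U z -> is_rderiv_fun rho z (D1 z)) /\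
  (forall z v, U z -> is_rderiv_fun (fun x => D1 x v) z (D2 z v)) /\
  (forall v w, cont_fun_on U (fun x => D2 x v w)).

Definition strictly_convex_C2_domain {n} (D : Cn n -> Prop) : Prop :=
  domain D /\
  exists (U : Cn n -> Prop) rho D1 D2,
    open_set U /\ (forall z, closure D z -> U z) /\ C2_on U rho D1 D2 /\
    (forall z, U z -> (D z <-> rho z < 0)) /\
    forall z, bdry D z ->
      (exists v, D1 z v <> 0) /\
      (forall v, v <> vzero n -> D1 z v = 0 -> D2 z v v > 0).

(* completeness of the pull-back metric F^* ds^2 on D *)
Definition path_in {n} (D : Cn n -> Prop) (g : R -> Cn n) (x y : Cn n) : Prop :=
  g 0 = x /\ g 1 = y /\ (forall t, 0 <= t <= 1 -> D (g t)) /\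
  (forall t, 0 <= t <= 1 -> forall e, 0 < e -> exists d, 0 < d /\
     forall s, 0 <= s <= 1 -> Rabs (s - t) < d -> vdist (g s) (g t) < e).
Definition length_le {n m} (F : Cn n -> Cn m) (g : R -> Cn n) (L : R) : Prop :=
  forall (k : nat) (t : nat -> R), t 0%nat = 0 -> t k = 1 ->
    (forall i, (i < k)%nat -> t i <= t i.+1) ->
    \big[Rplus/0]_(i < k) vdist (F (g (t i.+1))) (F (g (t i))) <= L.
(* the distance of F^* ds^2 from x to y is at most L *)
Definition Fdist_le {n m} (D : Cn n -> Prop) (F : Cn n -> Cn m) (x y : Cn n) (L : R) : Prop :=
  exists g, path_in D g x y /\ length_le F g L.
Definition complete_on {n m} (D : Cn n -> Prop) (F : Cn n -> Cn m) : Prop :=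
  forall x : nat -> Cn n, (forall k, D (x k)) ->
    (forall e, 0 < e -> exists N, forall j k, (N <= j)%nat -> (N <= k)%nat ->
        Fdist_le D F (x j) (x k) e) ->
    exists y, D y /\ forall e, 0 < e -> exists N, forall k, (N <= k)%nat ->
        Fdist_le D F (x k) y e.

Definition vjoin {n a b} (f : Cn n -> Cn a) (h : Cn n -> Cn b) : Cn n -> Cn (a + b) :=
  fun z i => match split i with inl j => f z j | inr k => h z k end.

(* Main.v *)
(* The boundary condition prevents a segment in the closure of D from touching the boundary from
   inside, so D is convex, and every boundary point p carries a complex affine function l_p with
   Re l_p(z) <= - c |z-p|^2 on the closure of D and Re l_p(z) >= - Q |z-p|^2 on the boundary.
   Take a delta-net of the boundary, coloured with s colours (s independent of delta) so that points
   of the same colour are far apart on the scale delta.  Given f with gap phi = 1 - |h|^2 - |f|^2 > 0,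
   add to f the sum g of the waves kappa phi(p) exp(l_p / delta^2) e_p, p in the net, where e_p is a
   unit vector orthogonal to f(p) in the plane C^2 belonging to the colour of p.  For small delta,
   |f+g|^2 is nearly |f|^2 + |g|^2, g is small on a given compact subset of D, and on the boundary
   |g| is comparable with phi, hence the new gap lies between phi - phi^2/4 and phi - u phi^2.  On a
   path that comes from the compact set and approaches the boundary at p, the wave at p grows from a
   small to its full size over a distance of order delta, where f hardly changes and the other waves
   of that colour are negligible; so the path has length at least u min phi in the new metric.
   Iterating, the gap is of order 1/k: it tends to 0, which gives properness, and its sum diverges,
   which gives completeness.  The limit y of an intrinsic Cauchy sequence is reached in the intrinsic
   metric by concatenating infinitely many short paths. *)

From Stdlib Require Import Reals Lra Lia Classical ClassicalEpsilon FunctionalExtensionality.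
From Coquelicot Require Import Coquelicot.
From HB Require Import structures.
From mathcomp Require Import ssreflect ssrfun ssrbool eqtype ssrnat seq choice.
From mathcomp Require Import fintype finfun bigop div.
Require Import Defs.

Set Implicit Arguments.
Unset Strict Implicit.
Open Scope R_scope.

HB.instance Definition _ := Monoid.isComLaw.Build R 0 Rplus
  (fun x y z => Logic.eq_sym (Rplus_assoc x y z)) Rplus_comm Rplus_0_l.
HB.instance Definition _ := Monoid.isComLaw.Build R 1 Rmult
  (fun x y z => Logic.eq_sym (Rmult_assoc x y z)) Rmult_comm Rmult_1_l.
HB.instance Definition _ := Monoid.isMulLaw.Build R 0 Rmult Rmult_0_l Rmult_0_r.
HB.instance Definition _ := Monoid.isAddLaw.Build R Rmult Rplus
  Rmult_plus_distr_r Rmult_plus_distr_l.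
HB.instance Definition _ := Monoid.isComLaw.Build C (RtoC 0) Cplus
  Cplus_assoc Cplus_comm Cplus_0_l.

Local Notation "\sum_ ( i | P ) F" := (\big[Rplus/0]_(i | P%B) F) : R_scope.
Local Notation "\sum_ ( i : t ) F" := (\big[Rplus/0]_(i : t) F) : R_scope.
Local Notation "\sum_ ( i < n ) F" := (\big[Rplus/0]_(i < n) F) : R_scope.
Local Notation "\sum_ i F" := (\big[Rplus/0]_i F) : R_scope.

Lemma sum_le (I : finType) (P : pred I) (F G : I -> R) :
  (forall i, P i -> F i <= G i) -> \sum_(i | P i) F i <= \sum_(i | P i) G i.
Proof.
move=> H; apply: (big_ind2 (fun x y => x <= y)) => //; first lra.
by move=> x1 x2 y1 y2; lra.
Qed.

Lemma sum_ge0 (I : finType) (P : pred I) (F : I -> R) :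
  (forall i, P i -> 0 <= F i) -> 0 <= \sum_(i | P i) F i.
Proof. by move=> H; apply: (big_ind (fun x => 0 <= x)) => //; [lra | move=> x y; lra]. Qed.

Lemma sum_ge_term (I : finType) (F : I -> R) (j : I) :
  (forall i, 0 <= F i) -> F j <= \sum_i F i.
Proof.
move=> H; rewrite (bigD1 j) //=; have := @sum_ge0 _ (fun i => i != j) F (fun i _ => H i); lra.
Qed.

Lemma sum_mull (I : finType) (P : pred I) a (F : I -> R) :
  a * \sum_(i | P i) F i = \sum_(i | P i) (a * F i).
Proof. exact: big_distrr. Qed.

Lemma sum_le_pred (I : finType) (P : pred I) (F : I -> R) :
  (forall i, 0 <= F i) -> \sum_(i | P i) F i <= \sum_i F i.
Proof.
move=> H; rewrite big_mkcond; apply: sum_le => i _; case: (P i); have := H i; lra.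
Qed.

Lemma Rabs_sum (I : finType) (P : pred I) (F : I -> R) :
  Rabs (\sum_(i | P i) F i) <= \sum_(i | P i) Rabs (F i).
Proof.
apply: (big_ind2 (fun x y => Rabs x <= y)); first by rewrite Rabs_R0; lra.
- by move=> x1 x2 y1 y2 h1 h2; have := Rabs_triang x1 y1; lra.
- by move=> i _; lra.
Qed.

Lemma Cmod_sum (I : finType) (P : pred I) (F : I -> C) :
  Cmod (\big[Cplus/RtoC 0]_(i | P i) F i) <= \sum_(i | P i) Cmod (F i).
Proof.
apply: (big_ind2 (fun x y => Cmod x <= y)); first by rewrite Cmod_0; lra.
- by move=> x1 x2 y1 y2 h1 h2; have := Cmod_triangle x1 y1; lra.
- by move=> i _; lra.
Qed.

Lemma Csum_mull (I : finType) (P : pred I) (a : C) (F : I -> C) :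
  Cmult a (\big[Cplus/RtoC 0]_(i | P i) F i) = \big[Cplus/RtoC 0]_(i | P i) Cmult a (F i).
Proof. by apply: (big_morph (Cmult a)) => [x y|]; ring. Qed.

Lemma Re_sum (I : finType) (P : pred I) (F : I -> C) :
  Re (\big[Cplus/RtoC 0]_(i | P i) F i) = \sum_(i | P i) Re (F i).
Proof. by apply: (big_morph Re). Qed.

Lemma RtoC_sum (I : finType) (P : pred I) (F : I -> R) :
  RtoC (\sum_(i | P i) F i) = \big[Cplus/RtoC 0]_(i | P i) RtoC (F i).
Proof. by apply: (big_morph RtoC) => // x y; rewrite RtoC_plus. Qed.

Lemma iter_Rplus k a : iter k (Rplus a) 0 = INR k * a.
Proof. by elim: k => [|k IH]; rewrite ?iterS ?IH ?S_INR /=; ring. Qed.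

Lemma sum_const (I : finType) a : \sum_(i : I) a = INR #|I| * a.
Proof. by rewrite big_const iter_Rplus; congr (INR _ * _); apply: eq_card. Qed.

Lemma choice_fun (A B : Type) (P : A -> B -> Prop) : (forall x, exists y, P x y) ->
  exists u : A -> B, forall x, P x (u x).
Proof.
move=> H; exists (fun x => proj1_sig (constructive_indefinite_description _ (H x))) => x.
exact: proj2_sig (constructive_indefinite_description _ (H x)).
Qed.

(** * Euclidean geometry of C^n *)

Lemma RtoC_m1 : RtoC (-1) = Copp (RtoC 1).
Proof. by rewrite /RtoC /Copp /= Ropp_0; congr pair; ring. Qed.

Lemma Re_scalR r z : Re (Cmult (RtoC r) z) = r * Re z.
Proof. by rewrite /Re /=; ring. Qed.

Definition inner {n} (u v : Cn n) : C := \big[Cplus/RtoC 0]_(i < n) Cmult (u i) (Cconj (v i)).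

Lemma vnorm_sqr {n} (z : Cn n) : vnorm z * vnorm z = \sum_(i < n) (Cmod (z i) * Cmod (z i)).
Proof.
rewrite /vnorm sqrt_sqrt //; apply: sum_ge0 => i _; exact: Rle_0_sqr.
Qed.

Lemma vnorm_ge0 {n} (z : Cn n) : 0 <= vnorm z.
Proof. exact: sqrt_pos. Qed.

Lemma Cmod_le_vnorm {n} (z : Cn n) i : Cmod (z i) <= vnorm z.
Proof.
apply: Rsqr_incr_0_var; last exact: vnorm_ge0.
rewrite /Rsqr vnorm_sqr.
exact: (@sum_ge_term _ (fun i => Cmod (z i) * Cmod (z i)) i (fun i => Rle_0_sqr _)).
Qed.

Lemma vnorm_eq0 {n} (z : Cn n) : vnorm z = 0 -> z = vzero n.
Proof.
move=> H; apply: functional_extensionality => i; apply: Cmod_eq_0.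
have := Cmod_le_vnorm z i; have := Cmod_ge_0 (z i); lra.
Qed.

Lemma vnorm_sqr_inner {n} (z : Cn n) : vnorm z * vnorm z = Re (inner z z).
Proof.
rewrite vnorm_sqr /inner Re_sum; apply: eq_bigr => i _.
by rewrite -Cmod2_conj /=; ring.
Qed.

Lemma inner_addl {n} (u v w : Cn n) : inner (vadd u v) w = Cplus (inner u w) (inner v w).
Proof. by rewrite /inner -big_split; apply: eq_bigr => i _; rewrite /vadd /=; ring. Qed.

Lemma inner_subl {n} (u v w : Cn n) : inner (vsub u v) w = Cminus (inner u w) (inner v w).
Proof.
rewrite /Cminus.
have -> : Copp (inner v w) = Cmult (RtoC (-1)) (inner v w) by rewrite RtoC_m1; ring.
rewrite /inner Csum_mull -big_split; apply: eq_bigr => i _; rewrite /vsub /= RtoC_m1; ring.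
Qed.

Lemma inner_scall {n} a (u w : Cn n) : inner (vscal a u) w = Cmult a (inner u w).
Proof. by rewrite /inner Csum_mull; apply: eq_bigr => i _; rewrite /vscal /=; ring. Qed.

Lemma cauchy_schwarz {n} (u v : Cn n) : Cmod (inner u v) <= vnorm u * vnorm v.
Proof.
apply: Rle_trans (Cmod_sum _ _) _.
have -> : \sum_(i < n) Cmod (u i * Cconj (v i)) = \sum_(i < n) (Cmod (u i) * Cmod (v i)).
  by apply: eq_bigr => i _; rewrite Cmod_mult Cmod_conj.
have [u0|u0] := Req_dec (vnorm u) 0.
  rewrite big1; first by rewrite u0; lra.
  move=> i _; rewrite (vnorm_eq0 u0) /vzero Cmod_0; lra.
have [v0|v0] := Req_dec (vnorm v) 0.
  rewrite big1; first by rewrite v0; lra.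
  move=> i _; rewrite (vnorm_eq0 v0) /vzero Cmod_0; lra.
have up := vnorm_ge0 u; have vp := vnorm_ge0 v.
set a := vnorm u in u0 up *; set b := vnorm v in v0 vp *.
have E : a * b = \sum_(i < n) (/2 * (b / a) * (Cmod (u i) * Cmod (u i))
     + /2 * (a / b) * (Cmod (v i) * Cmod (v i))).
  rewrite big_split -!sum_mull -!vnorm_sqr -/a -/b /=; by field.
rewrite E; apply: sum_le => i _.
set x := Cmod _; set y := Cmod _.
have -> : / 2 * (b / a) * (x * x) + / 2 * (a / b) * (y * y)
  = x * y + /2 * ((b * x - a * y) * (b * x - a * y) * / (a * b)) by field.
have : 0 <= (b * x - a * y) * (b * x - a * y) * / (a * b); last lra.
apply: Rmult_le_pos; first exact: Rle_0_sqr.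
by apply/Rlt_le/Rinv_0_lt_compat/Rmult_lt_0_compat; lra.
Qed.

Lemma Re_inner_le {n} (u v : Cn n) : Rabs (Re (inner u v)) <= vnorm u * vnorm v.
Proof. exact: Rle_trans (re_le_Cmod _) (cauchy_schwarz _ _). Qed.

Lemma Re_inner_sym {n} (u v : Cn n) : Re (inner u v) = Re (inner v u).
Proof. by rewrite /inner !Re_sum; apply: eq_bigr => i _ /=; ring. Qed.

Lemma vnorm_sqr_add {n} (u v : Cn n) :
  vnorm (vadd u v) * vnorm (vadd u v) = vnorm u * vnorm u + vnorm v * vnorm v + 2 * Re (inner u v).
Proof.
rewrite !vnorm_sqr_inner inner_addl.
have E w : Re (inner w (vadd u v)) = Re (inner u w) + Re (inner v w).
  by rewrite Re_inner_sym inner_addl.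
rewrite /= -!/(Re _) !E [Re (inner v u)]Re_inner_sym; ring.
Qed.

Lemma vnorm_triangle {n} (u v : Cn n) : vnorm (vadd u v) <= vnorm u + vnorm v.
Proof.
have up := vnorm_ge0 u; have vp := vnorm_ge0 v.
apply: Rsqr_incr_0_var; last lra.
rewrite /Rsqr vnorm_sqr_add; have := Re_inner_le u v.
by move/Rabs_le_between; nra.
Qed.

Lemma vnorm_scal {n} a (u : Cn n) : vnorm (vscal a u) = Cmod a * vnorm u.
Proof.
apply: Rsqr_inj; [exact: vnorm_ge0|exact: Rmult_le_pos (Cmod_ge_0 _) (vnorm_ge0 _)|].
rewrite /Rsqr vnorm_sqr.
have -> : Cmod a * vnorm u * (Cmod a * vnorm u) = Cmod a * Cmod a * (vnorm u * vnorm u) by ring.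
rewrite vnorm_sqr sum_mull; apply: eq_bigr => i _; rewrite /vscal Cmod_mult; ring.
Qed.

Lemma vnorm_zero {n} : vnorm (vzero n) = 0.
Proof.
rewrite /vnorm big1 ?sqrt_0 // => i _; rewrite /vzero Cmod_0; ring.
Qed.

Ltac vext := apply: functional_extensionality => ?; rewrite /vadd /vsub /vscal /vzero ?RtoC_m1; try ring.

Lemma vnorm_scalR {n} r (u : Cn n) : vnorm (vscal (RtoC r) u) = Rabs r * vnorm u.
Proof. by rewrite vnorm_scal Cmod_R. Qed.

Lemma vscal_mul {n} a b (u : Cn n) : vscal (RtoC a) (vscal (RtoC b) u) = vscal (RtoC (a * b)) u.
Proof. by vext; rewrite RtoC_mult; ring. Qed.

Lemma vdist_sym {n} (u v : Cn n) : vdist u v = vdist v u.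
Proof.
rewrite /vdist; have -> : vsub u v = vscal (RtoC (-1)) (vsub v u) by vext.
by rewrite vnorm_scalR Rabs_Ropp Rabs_R1 Rmult_1_l.
Qed.

Lemma vdist_triangle {n} (u v w : Cn n) : vdist u w <= vdist u v + vdist v w.
Proof.
rewrite /vdist; have -> : vsub u w = vadd (vsub u v) (vsub v w) by vext.
exact: vnorm_triangle.
Qed.

Lemma vdist_refl {n} (u : Cn n) : vdist u u = 0.
Proof.
rewrite /vdist; have -> : vsub u u = vzero n; last by rewrite vnorm_zero.
by vext.
Qed.

Lemma vdist_ge0 {n} (u v : Cn n) : 0 <= vdist u v.
Proof. exact: vnorm_ge0. Qed.

Lemma vdist_eq0 {n} (u v : Cn n) : vdist u v = 0 -> u = v.
Proof.
move/vnorm_eq0 => H; apply: functional_extensionality => i.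
have := f_equal (fun w => w i) H; rewrite /vsub /vzero => E.
have -> : u i = Cplus (Cminus (u i) (v i)) (v i) by ring.
by rewrite E; ring.
Qed.

Lemma vnorm_dist {n} (u v : Cn n) : Rabs (vnorm u - vnorm v) <= vdist u v.
Proof.
have H (a b : Cn n) : vnorm a <= vnorm b + vdist a b.
  by rewrite {1}(_ : a = vadd b (vsub a b)); [exact: vnorm_triangle | vext].
have := H u v; have := H v u; rewrite (vdist_sym v u) => h1 h2.
by apply: Rabs_le; lra.
Qed.

Lemma vdist_add {n} (z v : Cn n) : vdist (vadd z v) z = vnorm v.
Proof. by rewrite /vdist; congr vnorm; vext. Qed.

Lemma vadd_sub {n} (z w : Cn n) : vadd z (vsub w z) = w.
Proof. by vext. Qed.

Definition coord {n} (z : Cn n) (k : 'I_n * bool) : R := if k.2 then Im (z k.1) else Re (z k.1).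

Lemma vnorm_sqr_coord {n} (z : Cn n) :
  vnorm z * vnorm z = \sum_(k : 'I_n * bool) (coord z k * coord z k).
Proof.
rewrite vnorm_sqr -(pair_bigA _ (fun i b => coord z (i, b) * coord z (i, b))) /=.
apply: eq_bigr => i _; rewrite big_bool /coord /=.
have := Cmod2_alt (z i); rewrite /= !Rmult_1_r => ->; rewrite Rplus_comm //.
Qed.

Lemma coord_le_vnorm {n} (z : Cn n) k : Rabs (coord z k) <= vnorm z.
Proof.
apply: Rsqr_incr_0_var; last exact: vnorm_ge0.
rewrite -Rsqr_abs /Rsqr vnorm_sqr_coord.
exact: (@sum_ge_term _ (fun k => coord z k * coord z k) k (fun k => Rle_0_sqr _)).
Qed.

Lemma vnorm_le_coord {n} (z : Cn n) : vnorm z <= \sum_(k : 'I_n * bool) Rabs (coord z k).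
Proof.
have S0 : 0 <= \sum_(k : 'I_n * bool) Rabs (coord z k) by apply: sum_ge0 => k _; exact: Rabs_pos.
apply: Rsqr_incr_0_var => //.
rewrite /Rsqr vnorm_sqr_coord {1}sum_mull; apply: sum_le => k _.
have -> : coord z k * coord z k = Rabs (coord z k) * Rabs (coord z k).
  by rewrite -Rabs_mult Rabs_right //; apply/Rle_ge/Rle_0_sqr.
apply: Rmult_le_compat_r; first exact: Rabs_pos.
by apply: (@sum_ge_term _ (fun k => Rabs (coord z k))) => i; exact: Rabs_pos.
Qed.

Lemma coord_sub {n} (z w : Cn n) k : coord (vsub z w) k = coord z k - coord w k.
Proof. by rewrite /coord; case: k.2. Qed.
Lemma coord_add {n} (z w : Cn n) k : coord (vadd z w) k = coord z k + coord w k.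
Proof. by rewrite /coord; case: k.2. Qed.
Lemma coord_scal {n} r (w : Cn n) k : coord (vscal (RtoC r) w) k = r * coord w k.
Proof. by rewrite /coord /Re /Im; case: k.2 => /=; ring. Qed.

(** * Sequential compactness *)

Definition vcvg {n} (x : nat -> Cn n) (y : Cn n) : Prop :=
  forall e, 0 < e -> exists N, forall k, (N <= k)%nat -> vdist (x k) y < e.
Definition extraction (phi : nat -> nat) : Prop := forall k, (phi k < phi k.+1)%nat.

Lemma extraction_ge phi : extraction phi -> forall k, (k <= phi k)%nat.
Proof. by move=> H; elim=> // k IH; apply: leq_ltn_trans IH (H k). Qed.

Lemma extraction_mono phi : extraction phi -> forall j k, (j < k)%nat -> (phi j < phi k)%nat.
Proof.
move=> H j; elim=> // k IH; rewrite ltnS leq_eqVlt => /orP[/eqP->|/IH h]; first exact: H.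
exact: ltn_trans h (H k).
Qed.

Lemma extraction_comp phi psi : extraction phi -> extraction psi -> extraction (fun k => phi (psi k)).
Proof. by move=> H1 H2 k; apply: extraction_mono. Qed.

Lemma cvg_extract {n} (x : nat -> Cn n) y phi :
  extraction phi -> vcvg x y -> vcvg (fun k => x (phi k)) y.
Proof.
move=> H c e e0; have [N HN] := c e e0; exists N => k Nk.
by apply: HN; apply: leq_trans Nk (extraction_ge H k).
Qed.

Lemma cvg_unique {n} (x : nat -> Cn n) y z : vcvg x y -> vcvg x z -> y = z.
Proof.
move=> c1 c2; apply: vdist_eq0; apply: Rle_antisym; last exact: vdist_ge0.
apply: Rnot_lt_le => h.
have [|N1 H1] := c1 (vdist y z / 2); first lra.
have [|N2 H2] := c2 (vdist y z / 2); first lra.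
have := H1 _ (leq_maxl N1 N2); have := H2 _ (leq_maxr N1 N2).
set k := maxn _ _; have := vdist_triangle y (x k) z; rewrite (vdist_sym y (x k)); lra.
Qed.

Lemma exists_inv_lt e : 0 < e -> exists N : nat, forall k, (N <= k)%nat -> / (INR k + 1) < e.
Proof.
move=> e0; have [N [HN N0]] := archimed_cor1 _ e0; exists N => k /leP Nk.
apply: Rle_lt_trans HN; apply: Rinv_le_contravar; first by apply: lt_0_INR; lia.
by have := le_INR _ _ Nk; lra.
Qed.

Lemma R_bounded_subseq (u : nat -> R) M : (forall k, Rabs (u k) <= M) ->
  exists phi l, extraction phi /\ forall e, 0 < e -> exists N, forall k, (N <= k)%nat ->
    Rabs (u (phi k) - l) < e.
Proof.
move=> H.
have [l Hl] := Bolzano_Weierstrass u _ (compact_P3 (- M) M) (fun k => proj1 (Rabs_le_between _ _) (H k)).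
have P (N k : nat) : exists p, (N <= p)%nat /\ Rabs (u p - l) < / (INR k + 1).
  have p0 : 0 < / (INR k + 1) by apply: Rinv_0_lt_compat; have := pos_INR k; lra.
  have [] := Hl (disc l (mkposreal _ p0)) N; first by exists (mkposreal _ p0) => y.
  by move=> p [/leP p1 p2]; exists p.
pose F N k := proj1_sig (constructive_indefinite_description _ (P N k)).
have FP N k : (N <= F N k)%nat /\ Rabs (u (F N k) - l) < / (INR k + 1).
  by rewrite /F; case: constructive_indefinite_description.
pose phi := fix phi k := match k with O => F O O | S j => F (phi j).+1 j.+1 end.
exists phi, l; split; first by move=> k; exact: (proj1 (FP (phi k).+1 k.+1)).
move=> e e0; have [N HN] := exists_inv_lt e0; exists N => k Nk.
by apply: Rlt_trans (HN k Nk); case: k {Nk} => [|k]; [exact: (proj2 (FP _ _)) | exact: (proj2 (FP _ _))].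
Qed.

Lemma bounded_subseq {n} (x : nat -> Cn n) M : (forall k, vnorm (x k) <= M) ->
  exists phi y, extraction phi /\ vcvg (fun k => x (phi k)) y.
Proof.
move=> H.
have P (s : seq ('I_n * bool)) : exists phi (l : 'I_n * bool -> R), extraction phi /\
   forall c, c \in s -> forall e, 0 < e -> exists N, forall k, (N <= k)%nat ->
     Rabs (coord (x (phi k)) c - l c) < e.
  elim: s => [|c s [phi [l [E Hl]]]]; first by exists id, (fun _ => 0); split => // k.
  have [psi [a [Epsi Ha]]] := @R_bounded_subseq (fun k => coord (x (phi k)) c) M
     (fun k => Rle_trans _ _ _ (coord_le_vnorm _ _) (H _)).
  exists (fun k => phi (psi k)), (fun d => if d == c then a else l d); split.
    exact: extraction_comp.
  move=> d; rewrite inE; case: eqP => [-> _|_ /= ds] e e0; first exact: Ha.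
  have [N HN] := Hl d ds e e0; exists N => k Nk; apply: HN.
  exact: leq_trans Nk (extraction_ge Epsi k).
have [phi [l [E Hl]]] := P (enum {: 'I_n * bool}).
pose y : Cn n := fun i => (l (i, false), l (i, true)).
have yl c : coord y c = l c by case: c => i [].
exists phi, y; split=> // e e0.
pose e' := e / (INR #|{: 'I_n * bool}| + 1).
have c0 := pos_INR #|{: 'I_n * bool}|.
have e'0 : 0 < e' by apply: Rdiv_lt_0_compat; lra.
have Q c : exists N, forall k, (N <= k)%nat -> Rabs (coord (x (phi k)) c - l c) < e'.
  by apply: Hl => //; rewrite mem_enum.
have [N NP] := choice_fun Q.
exists (\max_c N c) => k Nk.
apply: Rle_lt_trans (vnorm_le_coord _) _.
apply: (@Rle_lt_trans _ (\sum_(c : 'I_n * bool) e')).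
  apply: sum_le => c _; rewrite coord_sub yl; apply/Rlt_le/NP.
  exact: leq_trans (leq_bigmax c) Nk.
have Ee : e = e' * (INR #|{: 'I_n * bool}| + 1) by rewrite /e'; field; lra.
rewrite sum_const [X in _ < X]Ee; move: c0 e'0; set K := INR _; clear; nra.
Qed.

Definition seq_closed {n} (E : Cn n -> Prop) : Prop :=
  forall x y, (forall k, E (x k)) -> vcvg x y -> E y.

Lemma closure_closed {n} (D : Cn n -> Prop) : seq_closed (closure D).
Proof.
move=> x y Ex c e e0; have [|N HN] := c (e / 2); first lra.
have [|w [Dw h]] := Ex N (e / 2); first lra.
exists w; split=> //; have := vdist_triangle w (x N) y; have := HN N (leqnn N); lra.
Qed.

Lemma subset_closure {n} (D : Cn n -> Prop) z : D z -> closure D z.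
Proof. by move=> Dz e e0; exists z; rewrite vdist_refl. Qed.

Lemma closure_bounded {n} (D : Cn n -> Prop) : bounded_set D -> bounded_set (closure D).
Proof.
move=> [M H]; exists (M + 1) => z /(_ 1 Rlt_0_1) [w [/H Dw h]].
by have /Rabs_le_between := vnorm_dist w z; lra.
Qed.

Lemma compact_subseq {n} (E : Cn n -> Prop) (x : nat -> Cn n) :
  bounded_set E -> seq_closed E -> (forall k, E (x k)) ->
  exists phi y, extraction phi /\ vcvg (fun k => x (phi k)) y /\ E y.
Proof.
move=> [M B] cl Ex; have [phi [y [e c]]] := bounded_subseq (fun k => B _ (Ex k)).
by exists phi, y; do !split=> //; apply: cl c.
Qed.

Lemma vcvg_dist0 {n} (x w : nat -> Cn n) y : vcvg x y ->
  (forall e, 0 < e -> exists N, forall k, (N <= k)%nat -> vdist (w k) (x k) < e) -> vcvg w y.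
Proof.
move=> c d e e0; have [|N1 H1] := c (e / 2); first lra.
have [|N2 H2] := d (e / 2); first lra.
exists (maxn N1 N2) => k; rewrite geq_max => /andP[/H1 h1 /H2 h2].
by have := vdist_triangle (w k) (x k) y; lra.
Qed.

Section PseudoMetric.
Context {n : nat} (E : Cn n -> Prop) (d : Cn n -> Cn n -> R).
Hypothesis Ebd : bounded_set E.
Hypothesis Ecl : seq_closed E.
Hypothesis d_sym : forall z w, d z w = d w z.
Hypothesis d_tri : forall z w v, d z v <= d z w + d w v.
Hypothesis d_cont : forall z, E z -> forall e, 0 < e -> exists r, 0 < r /\
  forall w, E w -> vdist w z < r -> d w z < e.

Lemma pseudo_cvg x y : (forall k, E (x k)) -> E y -> vcvg x y ->
  forall e, 0 < e -> exists N, forall k, (N <= k)%nat -> d (x k) y < e.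
Proof.
move=> Ex Ey c e e0; have [r [r0 H]] := d_cont Ey e0; have [N HN] := c r r0.
by exists N => k Nk; apply: H => //; apply: HN.
Qed.

Lemma pseudo_bounded : exists B, forall z w, E z -> E w -> d z w <= B.
Proof.
have [[z0 Ez0]|nE] := classic (exists z, E z); last by exists 0 => z w Ez; case: nE; exists z.
apply: NNPP => H.
have P (k : nat) : exists z, E z /\ INR k < d z z0.
  apply: NNPP => H'; apply: H; exists (INR k + INR k) => z w Ez Ew.
  have L u : E u -> d u z0 <= INR k.
    by move=> Eu; apply: Rnot_lt_le => h; apply: H'; exists u.
  have := d_tri z z0 w; rewrite (d_sym z0 w); have := L z Ez; have := L w Ew; lra.
have [x xP] := choice_fun P.
have [phi [y [ex [c Ey]]]] := compact_subseq Ebd Ecl (fun k => proj1 (xP k)).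
have [N HN] := pseudo_cvg (fun k => proj1 (xP _)) Ey c Rlt_0_1.
have [K HK] := INR_unbounded (d y z0 + 1).
have h1 := HN _ (leq_maxl N K).
have h2 := proj2 (xP (phi (maxn N K))).
have h3 := d_tri (x (phi (maxn N K))) y z0.
have /leP h4 := leq_trans (leq_maxr N K) (extraction_ge ex _).
by have := le_INR _ _ h4; lra.
Qed.

Lemma pseudo_modulus eta : 0 < eta ->
  exists A, 0 <= A /\ forall z w, E z -> E w -> d z w <= eta + A * (vdist z w * vdist z w).
Proof.
move=> eta0; apply: NNPP => H.
have P (k : nat) : exists zw, E zw.1 /\ E zw.2 /\
    eta + INR k * (vdist zw.1 zw.2 * vdist zw.1 zw.2) < d zw.1 zw.2.
  apply: NNPP => H'; apply: H; exists (INR k); split; first exact: pos_INR.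
  by move=> z w Ez Ew; apply: Rnot_lt_le => h; apply: H'; exists (z, w).
have [u uP] := choice_fun P.
have [B HB] := pseudo_bounded.
have [phi [y [ex [c Ey]]]] := compact_subseq Ebd Ecl (fun k => proj1 (uP k)).
have c2 : vcvg (fun k => (u (phi k)).2) y.
  apply: vcvg_dist0 c _ => e e0.
  have [K HK] := INR_unbounded (B / (e * e)); exists K => k Kk.
  have [Ez [Ew h]] := uP (phi k); have hB := HB _ _ Ez Ew.
  rewrite vdist_sym; apply: Rnot_le_lt => h'.
  have /leP/le_INR h4 := leq_trans Kk (extraction_ge ex k).
  have ee : 0 < e * e by nra.
  have : B < INR (phi k) * (e * e).
    have -> : B = B / (e * e) * (e * e) by field; lra.
    by apply: Rmult_lt_compat_r => //; lra.
  have : INR (phi k) * (e * e) <= INR (phi k) * (vdist (u (phi k)).1 (u (phi k)).2 * vdist (u (phi k)).1 (u (phi k)).2).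
    by apply: Rmult_le_compat_l; [exact: pos_INR | nra].
  lra.
have [|N1 H1] := pseudo_cvg (fun k => proj1 (uP _)) Ey c (e := eta / 2); first lra.
have [|N2 H2] := pseudo_cvg (fun k => proj1 (proj2 (uP _))) Ey c2 (e := eta / 2); first lra.
have h1 := H1 _ (leq_maxl N1 N2); have h2 := H2 _ (leq_maxr N1 N2).
set k := phi (maxn N1 N2) in h1 h2.
have [Ez [Ew h]] := uP k.
have := d_tri (u k).1 y (u k).2; rewrite (d_sym y (u k).2).
have : 0 <= INR k * (vdist (u k).1 (u k).2 * vdist (u k).1 (u k).2).
  by apply: Rmult_le_pos; [exact: pos_INR | exact: Rle_0_sqr].
lra.
Qed.

End PseudoMetric.

(** * Calculus along segments *)

Lemma Re_inner_coord {n} (u v : Cn n) :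
  Re (inner u v) = \sum_(k : 'I_n * bool) (coord u k * coord v k).
Proof.
rewrite /inner Re_sum -(pair_bigA _ (fun i b => coord u (i, b) * coord v (i, b))) /=.
by apply: eq_bigr => i _; rewrite big_bool /coord /Re /Im /=; ring.
Qed.

Definition ebasis {n} (k : 'I_n * bool) : Cn n :=
  fun i => if i == k.1 then (if k.2 then Ci else RtoC 1) else RtoC 0.

Lemma vsum_app {n} (I : finType) (F : I -> Cn n) i :
  (\big[vadd/vzero n]_k F k) i = \big[Cplus/RtoC 0]_k F k i.
Proof. by apply: (big_morph (fun w : Cn n => w i)). Qed.

Lemma ebasis_expansion {n} (v : Cn n) :
  v = \big[vadd/vzero n]_(k : 'I_n * bool) vscal (RtoC (coord v k)) (ebasis k).
Proof.
apply: functional_extensionality => i; rewrite vsum_app.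
rewrite -(pair_bigA _ (fun j b => vscal (RtoC (coord v (j, b))) (ebasis (j, b)) i)) /=.
rewrite (bigD1 i) //= [X in Cplus _ X]big1 => [|j ji].
  rewrite big_bool /vscal /ebasis /coord /= eqxx.
  by case: (v i) => x y; rewrite /Ci /Cplus /Cmult /Re /Im /=; congr pair; ring.
by rewrite big_bool /vscal /ebasis /= eq_sym (negbTE ji); ring.
Qed.

Lemma rlinear_fun_zero {n} (l : Cn n -> R) : rlinear_fun l -> l (vzero n) = 0.
Proof.
case=> la _; have := la (vzero n) (vzero n).
have -> : vadd (vzero n) (vzero n) = vzero n by vext.
lra.
Qed.

Lemma rlinear_fun_expansion {n} (l : Cn n -> R) v : rlinear_fun l ->
  l v = \sum_(k : 'I_n * bool) (coord v k * l (ebasis k)).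
Proof.
move=> lin; rewrite {1}(ebasis_expansion v).
rewrite (big_morph l (proj1 lin) (rlinear_fun_zero lin)).
by apply: eq_bigr => k _; rewrite (proj2 lin).
Qed.

Lemma rlinear_fun_bounded {n} (l : Cn n -> R) : rlinear_fun l ->
  exists B, 0 <= B /\ forall v, Rabs (l v) <= B * vnorm v.
Proof.
move=> lin; exists (\sum_(k : 'I_n * bool) Rabs (l (ebasis k))).
split=> [|v]; first by apply: sum_ge0 => k _; exact: Rabs_pos.
rewrite (rlinear_fun_expansion v lin) Rmult_comm sum_mull.
apply: Rle_trans (Rabs_sum _ _) _; apply: sum_le => k _.
by rewrite Rabs_mult; apply: Rmult_le_compat_r; [exact: Rabs_pos | exact: coord_le_vnorm].
Qed.

Lemma rderiv_fun_cont {n} (g : Cn n -> R) z l : is_rderiv_fun g z l ->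
  forall e, 0 < e -> exists d, 0 < d /\ forall w, vdist w z < d -> Rabs (g w - g z) < e.
Proof.
move=> [lin H] e e0; have [B [B0 HB]] := rlinear_fun_bounded lin.
have [d [d0 Hd]] := H 1 Rlt_0_1.
exists (Rmin d (e / (B + 2))); split.
  by apply: Rmin_pos => //; apply: Rdiv_lt_0_compat; lra.
move=> w hw; have h1 := Rlt_le_trans _ _ _ hw (Rmin_l _ _); have h2 := Rlt_le_trans _ _ _ hw (Rmin_r _ _).
have := Hd (vsub w z) h1; rewrite vadd_sub; have := HB (vsub w z); rewrite -/(vdist w z) => h3 h4.
have h5 : (B + 2) * vdist w z < e.
  have -> : e = (B + 2) * (e / (B + 2)) by field; lra.
  by apply: Rmult_lt_compat_l => //; lra.
have h6 : Rabs (g w - g z) <= Rabs (g w - g z - l (vsub w z)) + Rabs (l (vsub w z)).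
  have {1}-> : g w - g z = (g w - g z - l (vsub w z)) + l (vsub w z) by ring.
  exact: Rabs_triang.
have := vdist_ge0 w z; nra.
Qed.

Lemma rderiv_fun_unique {n} (g g' : Cn n -> R) z l l' : is_rderiv_fun g z l -> is_rderiv_fun g' z l' ->
  (exists r, 0 < r /\ forall w, vdist w z < r -> g w = g' w) -> forall v, l v = l' v.
Proof.
move=> [lin H] [lin' H'] [r [r0 E]] v.
have [v0|v0] := Req_dec (vnorm v) 0.
  by rewrite (vnorm_eq0 v0) !rlinear_fun_zero.
have vp : 0 < vnorm v by have := vnorm_ge0 v; lra.
apply: cond_eq => e e0.
have e1 : 0 < e / (4 * vnorm v) by apply: Rdiv_lt_0_compat; lra.
have [d [d0 Hd]] := H _ e1; have [d' [d0' Hd']] := H' _ e1.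
pose m := Rmin r (Rmin d d'); have m0 : 0 < m by do !apply: Rmin_pos.
pose t := m / (2 * vnorm v).
have t0 : 0 < t by apply: Rdiv_lt_0_compat; lra.
have nt : vnorm (vscal (RtoC t) v) = m / 2.
  by rewrite vnorm_scalR Rabs_right /t; [field; lra | apply/Rle_ge/Rlt_le].
have m1 : m <= r by exact: Rmin_l.
have m2 : m <= d by apply: Rle_trans (Rmin_r _ _) (Rmin_l _ _).
have m3 : m <= d' by apply: Rle_trans (Rmin_r _ _) (Rmin_r _ _).
have h1 := Hd (vscal (RtoC t) v); have h2 := Hd' (vscal (RtoC t) v).
rewrite nt in h1 h2; have {}h1 := h1 ltac:(lra); have {}h2 := h2 ltac:(lra).
rewrite -E ?vdist_add ?nt in h2; last lra.
rewrite -E ?vdist_refl in h2; last lra.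
rewrite (proj2 lin) in h1; rewrite (proj2 lin') in h2.
have e2 : e / (4 * vnorm v) * (m / 2) = e * t / 4 by rewrite /t; field; lra.
rewrite e2 in h1 h2; move: h1 h2; set a := g _ - g _ => /Rabs_le_between h1 /Rabs_le_between h2.
apply: (Rmult_lt_reg_l t) => //.
rewrite -{1}(Rabs_right t); last by apply/Rle_ge/Rlt_le.
by rewrite -Rabs_mult; apply: Rabs_def1; nra.
Qed.

Definition line {n} (z v : Cn n) (t : R) : Cn n := vadd z (vscal (RtoC t) v).

Lemma line0 {n} (z v : Cn n) : line z v 0 = z.
Proof. by rewrite /line; vext. Qed.
Lemma line1 {n} (z v : Cn n) : line z v 1 = vadd z v.
Proof. by rewrite /line; vext. Qed.

Lemma line_dist {n} (z v : Cn n) s t : vdist (line z v s) (line z v t) = Rabs (s - t) * vnorm v.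
Proof.
rewrite /vdist -vnorm_scalR; congr vnorm; rewrite /line; vext.
by rewrite RtoC_minus; ring.
Qed.

Lemma derive_line {n} (g : Cn n -> R) z v t l : is_rderiv_fun g (line z v t) l ->
  derivable_pt_lim (fun s => g (line z v s)) t (l v).
Proof.
move=> [lin H] e e0.
have e1 : 0 < e / (2 * (vnorm v + 1)) by apply: Rdiv_lt_0_compat; have := vnorm_ge0 v; lra.
have [d [d0 Hd]] := H _ e1.
have vp : 0 < vnorm v + 1 by have := vnorm_ge0 v; lra.
have r0 : 0 < d / (vnorm v + 1) by apply: Rdiv_lt_0_compat.
exists (mkposreal _ r0) => h h0 /= hh.
have nh : vnorm (vscal (RtoC h) v) < d.
  rewrite vnorm_scalR; have -> : d = d / (vnorm v + 1) * (vnorm v + 1) by field; lra.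
  have := Rabs_pos h; have := vnorm_ge0 v; nra.
have := Hd _ nh.
have -> : vadd (line z v t) (vscal (RtoC h) v) = line z v (t + h).
  by rewrite /line; vext; rewrite RtoC_plus; ring.
rewrite (proj2 lin) vnorm_scalR => H1.
have -> : (g (line z v (t + h)) - g (line z v t)) / h - l v
   = (g (line z v (t + h)) - g (line z v t) - h * l v) / h by field.
rewrite Rabs_div //; have hp := Rabs_pos_lt h h0.
apply: (Rmult_lt_reg_r (Rabs h)) => //.
have -> : Rabs (g (line z v (t + h)) - g (line z v t) - h * l v) / Rabs h * Rabs h
  = Rabs (g (line z v (t + h)) - g (line z v t) - h * l v) by field; lra.
apply: Rle_lt_trans H1 _.
have -> : e / (2 * (vnorm v + 1)) * (Rabs h * vnorm v)
   = (e * Rabs h) * (vnorm v / (2 * (vnorm v + 1))) by field; lra.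
have e2 : 0 < e * Rabs h by nra.
rewrite -{2}(Rmult_1_r (e * Rabs h)); apply: Rmult_lt_compat_l => //.
apply: (Rmult_lt_reg_r (2 * (vnorm v + 1))); first lra.
have -> : vnorm v / (2 * (vnorm v + 1)) * (2 * (vnorm v + 1)) = vnorm v by field; lra.
have := vnorm_ge0 v; lra.
Qed.

Lemma taylor2 (u u1 u2 : R -> R) :
  (forall t, 0 <= t <= 1 -> derivable_pt_lim u t (u1 t)) ->
  (forall t, 0 <= t <= 1 -> derivable_pt_lim u1 t (u2 t)) ->
  exists x, 0 < x < 1 /\ u 1 = u 0 + u1 0 + u2 x / 2.
Proof.
move=> H1 H2.
pose K := u 1 - u 0 - u1 0.
pose G t := u t + (1 - t) * u1 t + K * ((1 - t) * (1 - t)).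
have dG t : 0 <= t <= 1 -> derivable_pt_lim G t ((1 - t) * (u2 t - 2 * K)).
  move=> ht; apply/is_derive_Reals.
  have /is_derive_Reals h1 := H1 t ht; have /is_derive_Reals h2 := H2 t ht.
  have h3 : is_derive (fun t => 1 - t) t (-1) by auto_derive => //; ring.
  evar_last.
    exact: is_derive_plus (is_derive_plus _ _ _ _ _ h1 (is_derive_mult _ _ _ _ _ h3 h2 Rmult_comm))
      (is_derive_scal _ _ K _ (is_derive_mult _ _ _ _ _ h3 h3 Rmult_comm)).
  by rewrite /plus /mult /=; ring.
have [x [h hx]] := MVT_cor2 _ _ 0 1 Rlt_0_1 dG.
exists x; split=> //.
have : (1 - x) * (u2 x - 2 * K) = 0 by move: h; rewrite /G /K; nra.
by case/Rmult_integral; rewrite /K; lra.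
Qed.

(** * Limits of real sequences along vector sequences *)

Lemma is_lim_seqP u (l : R) : is_lim_seq u (Rbar.Finite l) <->
  forall e, 0 < e -> exists N, forall k, (N <= k)%nat -> Rabs (u k - l) < e.
Proof.
rewrite -is_lim_seq_spec; split=> [H e e0|H [e e0]].
  by have [N HN] := H (mkposreal _ e0); exists N => k /leP; exact: HN.
by have [N HN] := H e e0; exists N => k /leP; exact: HN.
Qed.

Lemma lim_sum (I : finType) (u : I -> nat -> R) (l : I -> R) :
  (forall i, is_lim_seq (u i) (l i)) -> is_lim_seq (fun k => \sum_i u i k) (\sum_i l i).
Proof.
move=> H.
elim: (index_enum I) => [|i s IH].
  rewrite big_nil; apply: is_lim_seq_ext (is_lim_seq_const 0) => k; by rewrite big_nil.
rewrite big_cons; apply: is_lim_seq_ext (is_lim_seq_plus' _ _ _ _ (H i) IH) => k.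
by rewrite big_cons.
Qed.

Lemma lim_coord {n} (x : nat -> Cn n) y c : vcvg x y -> is_lim_seq (fun k => coord (x k) c) (coord y c).
Proof.
move=> H; apply/is_lim_seqP => e e0; have [N HN] := H e e0; exists N => k Nk.
rewrite -coord_sub; exact: Rle_lt_trans (coord_le_vnorm _ _) (HN k Nk).
Qed.

Lemma lim_cont_fun {n} (A : Cn n -> Prop) g x y : cont_fun_on A g -> (forall k, A (x k)) -> A y ->
  vcvg x y -> is_lim_seq (fun k => g (x k)) (g y).
Proof.
move=> H Ax Ay c; apply/is_lim_seqP => e e0; have [d [d0 Hd]] := H y Ay e e0.
by have [N HN] := c d d0; exists N => k /HN; apply: Hd.
Qed.

Lemma lim_vdist {n} (x w : nat -> Cn n) y z : vcvg x y -> vcvg w z ->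
  is_lim_seq (fun k => vdist (x k) (w k)) (vdist y z).
Proof.
move=> c1 c2; apply/is_lim_seqP => e e0.
have [|N1 H1] := c1 (e / 2); first lra.
have [|N2 H2] := c2 (e / 2); first lra.
exists (maxn N1 N2) => k; rewrite geq_max => /andP[/H1 h1 /H2 h2].
have t1 := vdist_triangle (x k) y (w k); have t2 := vdist_triangle y z (w k).
have t3 := vdist_triangle y (x k) z; have t4 := vdist_triangle (x k) (w k) z.
rewrite (vdist_sym z) in t2; rewrite (vdist_sym y (x k)) in t3.
by apply: Rabs_def1; lra.
Qed.

Lemma vcvg_comb {n} (a : nat -> R) (a0 : R) (b : nat -> R) (b0 : R) (x w : nat -> Cn n) y z :
  is_lim_seq a a0 -> is_lim_seq b b0 -> vcvg x y -> vcvg w z ->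
  vcvg (fun k => vadd (vscal (RtoC (a k)) (x k)) (vscal (RtoC (b k)) (w k)))
       (vadd (vscal (RtoC a0) y) (vscal (RtoC b0) z)).
Proof.
move=> la lb cx cw.
have L : is_lim_seq (fun k => \sum_(c : 'I_n * bool)
    Rabs (a k * coord (x k) c + b k * coord (w k) c - (a0 * coord y c + b0 * coord z c))) 0.
  have {2}-> : 0 = \sum_(c : 'I_n * bool)
      Rabs (a0 * coord y c + b0 * coord z c - (a0 * coord y c + b0 * coord z c)).
    by rewrite big1 // => c _; rewrite Rminus_diag Rabs_R0.
  apply: lim_sum => c; apply: (is_lim_seq_abs _ (Rbar.Finite _)).
  apply: is_lim_seq_minus'; last exact: is_lim_seq_const.
  by apply: is_lim_seq_plus'; apply: is_lim_seq_mult'; first [exact: la | exact: lb | exact: lim_coord].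
move/is_lim_seqP: L => L e e0; have [N HN] := L e e0; exists N => k /HN.
rewrite Rminus_0_r => h; apply: Rle_lt_trans (Rle_lt_trans _ _ _ (Rle_abs _) h).
apply: Rle_trans (vnorm_le_coord _) _; apply: Req_le; apply: eq_bigr => c _.
by rewrite coord_sub !coord_add !coord_scal.
Qed.

Lemma vcvg_sub {n} (x w : nat -> Cn n) y z : vcvg x y -> vcvg w z ->
  vcvg (fun k => vsub (x k) (w k)) (vsub y z).
Proof.
move=> c1 c2 e e0.
have [|N HN] := vcvg_comb (is_lim_seq_const 1) (is_lim_seq_const (-1)) c1 c2 (e := e); first by [].
have E (a b : Cn n) : vsub a b = vadd (vscal (RtoC 1) a) (vscal (RtoC (-1)) b) by vext.
by exists N => k /HN; rewrite !E.
Qed.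

Lemma cont_fun_bounded {n} (E : Cn n -> Prop) g : bounded_set E -> seq_closed E -> cont_fun_on E g ->
  exists B, 0 <= B /\ forall z, E z -> Rabs (g z) <= B.
Proof.
move=> bd cl ct.
have [B HB] : exists B, forall z w, E z -> E w -> Rabs (g z - g w) <= B.
  apply: (@pseudo_bounded n E (fun z w => Rabs (g z - g w))) => //.
  - by move=> z w; exact: Rabs_minus_sym.
  - move=> z w v; have -> : g z - g v = (g z - g w) + (g w - g v) by ring.
    exact: Rabs_triang.
have [[z0 Ez0]|nE] := classic (exists z, E z); last by exists 0; split=> [|z Ez]; [lra | case: nE; exists z].
exists (B + Rabs (g z0)); split=> [|z Ez].
  have := HB z0 z0 Ez0 Ez0; have := Rabs_pos (g z0 - g z0); have := Rabs_pos (g z0); lra.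
have {1}-> : g z = (g z - g z0) + g z0 by ring.
by have := Rabs_triang (g z - g z0) (g z0); have := HB _ _ Ez Ez0; lra.
Qed.

(** * Geometry of strictly convex domains *)

Lemma increases_initially (u u1 : R -> R) d u2 : 0 < d ->
  (forall t, 0 <= t < d -> derivable_pt_lim u t (u1 t)) ->
  0 <= u1 0 -> derivable_pt_lim u1 0 u2 -> (u1 0 = 0 -> 0 < u2) ->
  exists d', 0 < d' /\ forall t, 0 < t < d' -> u 0 < u t.
Proof.
move=> d0 H1 h0 H2 h2.
have [e [e0 He]] : exists e, 0 < e /\ forall t, 0 < t < e -> 0 < u1 t.
  have [z|p] := Req_dec (u1 0) 0.
    have u20 := h2 z; have [[r r0] Hr] := H2 (u2 / 2) ltac:(lra); exists r; split=> // t ht.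
    have := Hr t ltac:(lra) ltac:(rewrite /= Rabs_right; lra).
    rewrite Rplus_0_l z Rminus_0_r => /Rabs_def2 [_ h].
    have -> : u1 t = u1 t / t * t by field; lra.
    by apply: Rmult_lt_0_compat; lra.
  have a0 : 0 < Rabs u2 + 1 by have := Rabs_pos u2; lra.
  have [[r r0] Hr] := H2 1 ltac:(lra).
  exists (Rmin r (u1 0 / (Rabs u2 + 1))); split.
    by apply: Rmin_pos => //; apply: Rdiv_lt_0_compat; lra.
  move=> t [t0 ht]; have t1 := Rlt_le_trans _ _ _ ht (Rmin_l _ _); have t2 := Rlt_le_trans _ _ _ ht (Rmin_r _ _).
  have := Hr t ltac:(lra) ltac:(rewrite /= Rabs_right; lra).
  rewrite Rplus_0_l => /Rabs_def2 [_ h].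
  have E : u1 t = u1 0 + (u1 t - u1 0) / t * t by field; lra.
  have h3 : - (Rabs u2 + 1) < (u1 t - u1 0) / t.
    have := Rle_abs (- u2); rewrite Rabs_Ropp; lra.
  have h4 : (Rabs u2 + 1) * t < u1 0.
    have -> : u1 0 = (Rabs u2 + 1) * (u1 0 / (Rabs u2 + 1)) by field; lra.
    by apply: Rmult_lt_compat_l.
  rewrite E; nra.
exists (Rmin d e); split; first exact: Rmin_pos.
move=> t [t0 ht]; have t1 := Rlt_le_trans _ _ _ ht (Rmin_l _ _); have t2 := Rlt_le_trans _ _ _ ht (Rmin_r _ _).
have [c [Ec hc]] := MVT_cor2 u u1 0 t t0 (fun c hc => H1 c ltac:(lra)).
have := He c ltac:(lra); nra.
Qed.

Section Convexity.
Context {n : nat} (D U : Cn n -> Prop) (rho : Cn n -> R)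
  (D1 : Cn n -> Cn n -> R) (D2 : Cn n -> Cn n -> Cn n -> R).
Hypothesis D_open : open_set D.
Hypothesis D_conn : connected_set D.
Hypothesis D_bd : bounded_set D.
Hypothesis U_open : open_set U.
Hypothesis EU : forall z, closure D z -> U z.
Hypothesis C2 : C2_on U rho D1 D2.
Hypothesis D_rho : forall z, U z -> (D z <-> rho z < 0).
Hypothesis bdry_pos : forall z, bdry D z -> forall v, v <> vzero n -> D1 z v = 0 -> D2 z v v > 0.

Lemma cont_rho : cont_fun_on U rho.
Proof.
move=> z Uz e e0; have [d [d0 H]] := rderiv_fun_cont (proj1 C2 z Uz) e0.
by exists d; split=> // w _; exact: H.
Qed.

Lemma cont_D1 v : cont_fun_on U (fun z => D1 z v).
Proof.
move=> z Uz e e0; have [d [d0 H]] := rderiv_fun_cont (proj1 (proj2 C2) z v Uz) e0.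
by exists d; split=> // w _; exact: H.
Qed.

Lemma rho_le0 z : closure D z -> rho z <= 0.
Proof.
move=> Ez; apply: Rnot_lt_le => h.
have [d [d0 Hd]] := cont_rho (EU Ez) h.
have [w [Dw hw]] := Ez d d0; have Uw := EU (subset_closure Dw).
have := Hd w Uw hw; have := proj1 (D_rho Uw) Dw; move=> h1 /Rabs_def2; lra.
Qed.

Lemma bdry_rho z : closure D z -> rho z = 0 -> bdry D z.
Proof. by move=> Ez h; split=> // /(proj1 (D_rho (EU Ez))); lra. Qed.

Lemma line_in_U z v : U z -> exists d, 0 < d /\ forall t, Rabs t < d -> U (line z v t).
Proof.
move=> Uz; have [e [e0 He]] := U_open Uz.
have vp : 0 < vnorm v + 1 by have := vnorm_ge0 v; lra.
exists (e / (vnorm v + 1)); split; first exact: Rdiv_lt_0_compat.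
move=> t ht; apply: He; rewrite -{2}(line0 z v) line_dist Rminus_0_r.
have -> : e = e / (vnorm v + 1) * (vnorm v + 1) by field; lra.
have := Rabs_pos t; have := vnorm_ge0 v; nra.
Qed.

Lemma leaves_domain z v : bdry D z -> v <> vzero n -> 0 <= D1 z v ->
  exists d, 0 < d /\ forall t, 0 < t < d -> 0 < rho (line z v t).
Proof.
move=> bz v0 hv; have Uz := EU (proj1 bz).
have [d [d0 Hd]] := line_in_U v Uz.
have z0 : rho z = 0.
  apply: Rle_antisym; first exact: rho_le0 (proj1 bz).
  by apply: Rnot_lt_le => /(proj2 (D_rho Uz)) /(proj2 bz).
suff: exists d, 0 < d /\ forall t, 0 < t < d -> rho (line z v 0) < rho (line z v t).
  by rewrite line0 z0.
apply: (@increases_initially (fun t => rho (line z v t)) (fun t => D1 (line z v t) v) d (D2 z v v)) => //.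
- move=> t ht; apply: derive_line; apply: (proj1 C2); apply: Hd; rewrite Rabs_right; lra.
- by rewrite line0.
- apply: (@derive_line _ (fun x => D1 x v)); rewrite line0; exact: (proj1 (proj2 C2)).
- by rewrite line0; exact: bdry_pos.
Qed.

Lemma segment_limit_in_D x y : D x -> D y ->
  (forall t, 0 <= t <= 1 -> closure D (line x (vsub y x) t)) ->
  forall t, 0 <= t <= 1 -> D (line x (vsub y x) t).
Proof.
move=> Dx Dy H t ht; apply: NNPP => nD.
set v := vsub y x in H nD *.
have b : bdry D (line x v t) by split=> //; exact: H.
have v0 : v <> vzero n by move=> v0; apply: nD; rewrite (_ : line x v t = x) // v0 /line; vext.
have shift w s : line (line x v t) w s = vadd (line x v t) (vscal (RtoC s) w) by [].
have ht1 : t < 1.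
  apply: Rnot_le_lt => h; have t1 : t = 1 by lra.
  by apply: nD; rewrite t1 line1 vadd_sub.
have ht0 : 0 < t.
  by apply: Rnot_le_lt => h; have t1 : t = 0 by [lra]; apply: nD; rewrite t1 line0.
have [h|h] := Rle_lt_dec 0 (D1 (line x v t) v).
  have [d [d0 Hd]] := leaves_domain b v0 h.
  have h1 := Rmin_l d (1 - t); have h2 := Rmin_r d (1 - t).
  have m0 : 0 < Rmin d (1 - t) by apply: Rmin_pos; lra.
  set s := Rmin d (1 - t) / 2; have s0 : 0 < s < d by rewrite /s; lra.
  have := Hd s s0; have -> : line (line x v t) v s = line x v (t + s).
    by rewrite /line; vext; rewrite RtoC_plus; ring.
  have := rho_le0 (H (t + s) ltac:(rewrite /s in s0 *; lra)); lra.
have lin := proj1 (proj1 C2 _ (EU (proj1 b))).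
have hm : D1 (line x v t) (vscal (RtoC (-1)) v) = - D1 (line x v t) v by rewrite (proj2 lin); ring.
have v0' : vscal (RtoC (-1)) v <> vzero n.
  move=> E; apply: v0; have -> : v = vscal (RtoC (-1)) (vscal (RtoC (-1)) v) by vext.
  by rewrite E; vext.
have [d [d0 Hd]] := leaves_domain b v0' ltac:(lra).
have h1 := Rmin_l d t; have h2 := Rmin_r d t.
have m0 : 0 < Rmin d t by apply: Rmin_pos; lra.
set s := Rmin d t / 2; have s0 : 0 < s < d by rewrite /s; lra.
have := Hd s s0; have -> : line (line x v t) (vscal (RtoC (-1)) v) s = line x v (t - s).
  by rewrite /line; vext; rewrite RtoC_minus; ring.
have := rho_le0 (H (t - s) ltac:(rewrite /s in s0 *; lra)); lra.
Qed.

Lemma line_move (x y y' : Cn n) t : 0 <= t <= 1 ->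
  vdist (line x (vsub y x) t) (line x (vsub y' x) t) <= vdist y y'.
Proof.
move=> ht; have -> : vdist (line x (vsub y x) t) (line x (vsub y' x) t) = Rabs t * vdist y y'.
  by rewrite /vdist -vnorm_scalR; congr vnorm; rewrite /line; vext.
by rewrite Rabs_right; [have := vdist_ge0 y y'; nra | lra].
Qed.

Lemma domain_convex x y : D x -> D y -> forall t, 0 <= t <= 1 -> D (line x (vsub y x) t).
Proof.
move=> Dx Dy; pose S y := D y /\ forall t, 0 <= t <= 1 -> D (line x (vsub y x) t).
apply: NNPP => nS.
apply: (D_conn (U := S) (V := fun y => D y /\ ~ S y)).
- move=> z [Dz Hz]; apply: NNPP => H.
  have P (k : nat) : exists wt : Cn n * R, vdist wt.1 z < / (INR k + 1) /\ 0 <= wt.2 <= 1 /\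
      ~ D (line x (vsub wt.1 x) wt.2).
    apply: NNPP => H'; apply: H; have [r [r0 Hr]] := D_open Dz.
    have k0 : 0 < / (INR k + 1) by apply: Rinv_0_lt_compat; have := pos_INR k; lra.
    exists (Rmin r (/ (INR k + 1))); split; first exact: Rmin_pos.
    move=> w hw; split; first by apply: Hr; apply: Rlt_le_trans hw (Rmin_l _ _).
    move=> t ht; apply: NNPP => nD; apply: H'; exists (w, t); split=> //.
    exact: Rlt_le_trans hw (Rmin_r _ _).
  have [u uP] := choice_fun P.
  have [phi [t [ex Ht]]] := @R_bounded_subseq (fun k => (u k).2) 1
    (fun k => ltac:(have [_ [h _]] := uP k; rewrite Rabs_right; lra)).
  have lt : is_lim_seq (fun k => (u (phi k)).2) t by apply/is_lim_seqP.
  have t01 : 0 <= t <= 1.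
    split.
      have := is_lim_seq_le (fun=> 0) _ 0 t (fun k => proj1 (proj1 (proj2 (uP (phi k)))))
        (is_lim_seq_const 0) lt.
      by [].
    have := is_lim_seq_le _ (fun=> 1) t 1 (fun k => proj2 (proj1 (proj2 (uP (phi k)))))
      lt (is_lim_seq_const 1).
    by [].
  have [r [r0 Hr]] := D_open (Hz t t01).
  have vz : 0 < vnorm (vsub z x) + 1 by have := vnorm_ge0 (vsub z x); lra.
  have [|N1 H1] := Ht (r / 2 / (vnorm (vsub z x) + 1)); first by apply: Rdiv_lt_0_compat; lra.
  have [|N2 H2] := exists_inv_lt (e := r / 2); first lra.
  have h1 := H1 _ (leq_maxl N1 N2); have h2 := H2 _ (leq_trans (leq_maxr N1 N2) (extraction_ge ex _)).
  set k := phi (maxn N1 N2) in h1 h2; have [q1 [q2 q3]] := uP k; apply: q3; apply: Hr.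
  apply: Rle_lt_trans (vdist_triangle _ (line x (vsub z x) (u k).2) _) _.
  have := line_move x (u k).1 z q2; rewrite line_dist => q4.
  have q5 : Rabs ((u k).2 - t) * vnorm (vsub z x) < r / 2.
    have -> : r / 2 = r / 2 / (vnorm (vsub z x) + 1) * (vnorm (vsub z x) + 1) by field; lra.
    have := Rabs_pos ((u k).2 - t); have := vnorm_ge0 (vsub z x); nra.
  lra.
- move=> z [Dz nSz]; apply: NNPP => H; apply: nSz; split=> //.
  apply: segment_limit_in_D => // t ht e e0.
  have [r [r0 Hr]] := D_open Dz.
  have : exists w, vdist w z < Rmin r e /\ S w.
    apply: NNPP => H'; apply: H; exists (Rmin r e); split; first exact: Rmin_pos.
    move=> w hw; split; first by apply: Hr; apply: Rlt_le_trans hw (Rmin_l _ _).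
    by move=> Sw; apply: H'; exists w.
  move=> [w [hw [Dw Sw]]]; exists (line x (vsub w x) t); split; first exact: Sw.
  apply: Rle_lt_trans (line_move x w z ht) _; exact: Rlt_le_trans hw (Rmin_r _ _).
- by move=> z Dz; have [h|h] := classic (S z); [left | right].
- by move=> z _ Sz [_].
- exists x; split=> //; split=> // t ht.
  by have -> : line x (vsub x x) t = x by rewrite /line; vext.
- by exists y; split=> //; split=> // -[_].
Qed.

Lemma closure_convex x y : closure D x -> closure D y ->
  forall t, 0 <= t <= 1 -> closure D (line x (vsub y x) t).
Proof.
move=> Ex Ey t ht e e0.
have [x' [Dx hx]] := Ex (e / 2) ltac:(lra); have [y' [Dy hy]] := Ey (e / 2) ltac:(lra).
exists (line x' (vsub y' x') t); split; first exact: domain_convex.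
rewrite /vdist.
have -> : vsub (line x' (vsub y' x') t) (line x (vsub y x) t) =
  vadd (vscal (RtoC (1 - t)) (vsub x' x)) (vscal (RtoC t) (vsub y' y)).
  by rewrite /line; vext; rewrite RtoC_minus; ring.
apply: Rle_lt_trans (vnorm_triangle _ _) _; rewrite !vnorm_scalR !Rabs_right; try lra.
rewrite -!/(vdist _ _); have := vdist_ge0 x' x; have := vdist_ge0 y' y; nra.
Qed.

Lemma supporting p z : bdry D p -> closure D z -> z <> p -> D1 p (vsub z p) < 0.
Proof.
move=> bp Ez zp; apply: Rnot_le_lt => h.
have v0 : vsub z p <> vzero n.
  by move=> E; apply: zp; rewrite -(vadd_sub p z) E; vext.
have [d [d0 Hd]] := leaves_domain bp v0 h.
have h1 := Rmin_l d 1; have h2 := Rmin_r d 1; have h3 : 0 < Rmin d 1 by apply: Rmin_pos; lra.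
have := Hd (Rmin d 1 / 2) ltac:(lra).
have := rho_le0 (closure_convex (proj1 bp) Ez (t := Rmin d 1 / 2) ltac:(lra)); lra.
Qed.

Lemma taylor_rho p z : closure D p -> closure D z -> exists x, 0 <= x <= 1 /\
  rho z = rho p + D1 p (vsub z p) + D2 (line p (vsub z p) x) (vsub z p) (vsub z p) / 2.
Proof.
move=> Ep Ez; set v := vsub z p.
have [x [hx E]] := @taylor2 (fun t => rho (line p v t)) (fun t => D1 (line p v t) v)
   (fun t => D2 (line p v t) v v)
   (fun t ht => derive_line (proj1 C2 _ (EU (closure_convex Ep Ez ht))))
   (fun t ht => @derive_line _ (fun y => D1 y v) _ _ _ _ (proj1 (proj2 C2) _ v (EU (closure_convex Ep Ez ht)))).
exists x; split; first lra.
by move: E; rewrite line0 line1 vadd_sub.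
Qed.

Lemma D1_expansion z v : U z -> D1 z v = \sum_(k : 'I_n * bool) (coord v k * D1 z (ebasis k)).
Proof. by move=> Uz; apply: rlinear_fun_expansion; case: (proj1 C2 z Uz). Qed.

Lemma D2_expansion z v w : U z -> D2 z v w =
  \sum_(k : 'I_n * bool) (coord v k * \sum_(l : 'I_n * bool) (coord w l * D2 z (ebasis k) (ebasis l))).
Proof.
move=> Uz.
have lw v' : rlinear_fun (D2 z v') by case: (proj1 (proj2 C2) z v' Uz).
have [r [r0 Ur]] := U_open Uz.
have lv : rlinear_fun (fun v' => D2 z v' w).
  split=> [h k|a h].
    pose l x := D2 z h x + D2 z k x.
    have : D2 z (vadd h k) w = l w; last by [].
    apply: (@rderiv_fun_unique _ (fun x => D1 x (vadd h k)) (fun x => D1 x h + D1 x k) z).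
    - exact: (proj1 (proj2 C2)).
    - split.
        split=> [x y|b x]; rewrite /l ?(proj1 (lw _)) ?(proj2 (lw _)); ring.
      move=> e e0.
      have [d [d0 Hd]] := proj2 (proj1 (proj2 C2) z h Uz) (e / 2) ltac:(lra).
      have [d' [d0' Hd']] := proj2 (proj1 (proj2 C2) z k Uz) (e / 2) ltac:(lra).
      exists (Rmin d d'); split; first exact: Rmin_pos.
      move=> x hx; have := Hd x (Rlt_le_trans _ _ _ hx (Rmin_l _ _)).
      have := Hd' x (Rlt_le_trans _ _ _ hx (Rmin_r _ _)).
      rewrite /l => /Rabs_le_between h1 /Rabs_le_between h2.
      by apply: Rabs_le; lra.
    - by exists r; split=> // x /Ur Ux; case: (proj1 (proj1 C2 x Ux)).
  pose l x := a * D2 z h x.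
  have : D2 z (vscal (RtoC a) h) w = l w; last by [].
  apply: (@rderiv_fun_unique _ (fun x => D1 x (vscal (RtoC a) h)) (fun x => a * D1 x h) z).
  - exact: (proj1 (proj2 C2)).
  - split.
      split=> [x y|b x]; rewrite /l ?(proj1 (lw _)) ?(proj2 (lw _)); ring.
    move=> e e0; have a0 : 0 < Rabs a + 1 by have := Rabs_pos a; lra.
    have [d [d0 Hd]] := proj2 (proj1 (proj2 C2) z h Uz) (e / (Rabs a + 1)) ltac:(apply: Rdiv_lt_0_compat; lra).
    exists d; split=> // x /Hd hx.
    have -> : a * D1 (vadd z x) h - a * D1 z h - l x = a * (D1 (vadd z x) h - D1 z h - D2 z h x).
      by rewrite /l; ring.
    rewrite Rabs_mult.
    have -> : e * vnorm x = (Rabs a + 1) * (e / (Rabs a + 1) * vnorm x) by field; lra.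
    have := Rabs_pos (D1 (vadd z x) h - D1 z h - D2 z h x); have := Rabs_pos a; nra.
  - by exists r; split=> // x /Ur Ux; case: (proj1 (proj1 C2 x Ux)).
rewrite (rlinear_fun_expansion v lv); apply: eq_bigr => k _.
by rewrite (rlinear_fun_expansion w (lw _)).
Qed.

Lemma D1_lim (x v : nat -> Cn n) y w : (forall k, U (x k)) -> U y -> vcvg x y -> vcvg v w ->
  is_lim_seq (fun k => D1 (x k) (v k)) (D1 y w).
Proof.
move=> Ux Uy cx cv; rewrite D1_expansion //.
apply: is_lim_seq_ext => [k|]; first by rewrite D1_expansion.
apply: lim_sum => c; apply: is_lim_seq_mult'; first exact: lim_coord.
exact: (lim_cont_fun (cont_D1 _) Ux Uy cx).
Qed.

Lemma D2_lim (x v : nat -> Cn n) y w : (forall k, U (x k)) -> U y -> vcvg x y -> vcvg v w ->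
  is_lim_seq (fun k => D2 (x k) (v k) (v k)) (D2 y w w).
Proof.
move=> Ux Uy cx cv; rewrite D2_expansion //.
apply: is_lim_seq_ext => [k|]; first by rewrite D2_expansion.
apply: lim_sum => c; apply: is_lim_seq_mult'; first exact: lim_coord.
apply: lim_sum => c'; apply: is_lim_seq_mult'; first exact: lim_coord.
exact: (lim_cont_fun (proj2 (proj2 C2) _ _) Ux Uy cx).
Qed.

Lemma D1_bounded : exists B, 0 < B /\ forall p, closure D p -> forall k, Rabs (D1 p (ebasis k)) <= B.
Proof.
have ct k : cont_fun_on (closure D) (fun z => D1 z (ebasis k)).
  move=> z Ez e e0; have [d [d0 H]] := cont_D1 (ebasis k) (EU Ez) e0.
  by exists d; split=> // w /EU; exact: H.
have P k := cont_fun_bounded (closure_bounded D_bd) (@closure_closed _ D) (ct k).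
have [B BP] := choice_fun P.
exists (1 + \sum_(k : 'I_n * bool) B k).
have B0 k : 0 <= B k by case: (BP k).
have S0 : 0 <= \sum_(k : 'I_n * bool) B k by apply: sum_ge0.
split; first lra.
move=> p Ep k.
have : B k <= \sum_(k : 'I_n * bool) B k by exact: sum_ge_term.
have := proj2 (BP k) p Ep; lra.
Qed.

Lemma D2_bounded : exists B, 0 < B /\ forall p v, closure D p ->
  Rabs (D2 p v v) <= B * (vnorm v * vnorm v).
Proof.
have P (kl : ('I_n * bool) * ('I_n * bool)) :
    exists B, 0 <= B /\ forall z, closure D z -> Rabs (D2 z (ebasis kl.1) (ebasis kl.2)) <= B.
  apply: (cont_fun_bounded (closure_bounded D_bd) (@closure_closed _ D)).
  move=> z Ez e e0; have [d [d0 H]] := proj2 (proj2 C2) (ebasis kl.1) (ebasis kl.2) z (EU Ez) e e0.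
  by exists d; split=> // w /EU; exact: H.
have [B BP] := choice_fun P.
have B0 kl : 0 <= B kl by case: (BP kl).
have S0 : 0 <= \sum_kl B kl by apply: sum_ge0.
exists (1 + \sum_kl B kl); split; first lra.
move=> p v Ep; have v0 := Rle_0_sqr (vnorm v); rewrite /Rsqr in v0.
apply: (@Rle_trans _ ((vnorm v * vnorm v) * \sum_kl B kl)); last nra.
rewrite (D2_expansion v v (EU Ep)).
rewrite (eq_bigr (fun k => \sum_(l : 'I_n * bool) (coord v k * (coord v l * D2 p (ebasis k) (ebasis l)))));
  last by move=> k _; rewrite sum_mull.
rewrite (pair_bigA _ (fun k l => coord v k * (coord v l * D2 p (ebasis k) (ebasis l)))) /= sum_mull.
apply: Rle_trans (Rabs_sum _ _) _; apply: sum_le => -[k l] _ /=.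
rewrite !Rabs_mult -Rmult_assoc; apply: Rmult_le_compat; try exact: Rabs_pos.
- by apply: Rmult_le_pos; exact: Rabs_pos.
- by apply: Rmult_le_compat; try exact: Rabs_pos; exact: coord_le_vnorm.
- exact: (proj2 (BP (k, l))).
Qed.

Lemma D2_scal z r w : U z -> D2 z (vscal (RtoC r) w) (vscal (RtoC r) w) = r * r * D2 z w w.
Proof.
move=> Uz; rewrite !D2_expansion // sum_mull; apply: eq_bigr => k _.
have -> : \sum_(l : 'I_n * bool) (coord (vscal (RtoC r) w) l * D2 z (ebasis k) (ebasis l))
   = r * \sum_(l : 'I_n * bool) (coord w l * D2 z (ebasis k) (ebasis l)).
  by rewrite sum_mull; apply: eq_bigr => l _; rewrite coord_scal; ring.
by rewrite coord_scal; ring.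
Qed.

Lemma quadratic_supporting : exists c, 0 < c /\ forall p z, bdry D p -> closure D z ->
  D1 p (vsub z p) <= - c * (vdist z p * vdist z p).
Proof.
apply: NNPP => H.
have P (k : nat) : exists pz : Cn n * Cn n, bdry D pz.1 /\ closure D pz.2 /\
   - / (INR k + 1) * (vdist pz.2 pz.1 * vdist pz.2 pz.1) < D1 pz.1 (vsub pz.2 pz.1).
  apply: NNPP => H'; apply: H; exists (/ (INR k + 1)); split.
    by apply: Rinv_0_lt_compat; have := pos_INR k; lra.
  by move=> p z bp Ez; apply: Rnot_lt_le => h; apply: H'; exists (p, z).
have [u uP] := choice_fun P.
have zp k : (u k).2 <> (u k).1.
  move=> E; have [bp [_ h]] := uP k; move: h; rewrite E vdist_refl.
  have -> : vsub (u k).1 (u k).1 = vzero n by vext.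
  rewrite rlinear_fun_zero; first lra.
  by case: (proj1 C2 _ (EU (proj1 bp))).
have dp k : 0 < vdist (u k).2 (u k).1.
  have := vdist_ge0 (u k).2 (u k).1 => -[//|/esym E]; case: (zp k); exact: vdist_eq0 E.
have bd := closure_bounded D_bd; have cl := @closure_closed _ D.
have [f1 [p [ex1 [c1 Ep]]]] := compact_subseq bd cl (fun k => proj1 (proj1 (uP k))).
have [f2 [z [ex2 [c2 Ez]]]] := compact_subseq bd cl (fun k => proj1 (proj2 (uP (f1 k)))).
have {}c1 := cvg_extract ex2 c1.
pose w k : Cn n := vscal (RtoC (/ vdist (u k).2 (u k).1)) (vsub (u k).2 (u k).1).
have nw k : vnorm (w k) = 1.
  rewrite vnorm_scalR -/(vdist _ _) Rabs_right; first by field; have := dp k; lra.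
  by apply/Rle_ge/Rlt_le/Rinv_0_lt_compat.
have wv k : vsub (u k).2 (u k).1 = vscal (RtoC (vdist (u k).2 (u k).1)) (w k).
  rewrite /w vscal_mul Rinv_r; last by have := dp k; lra.
  by vext.
have [f3 [w0 [ex3 c3]]] := bounded_subseq (fun k => Req_le _ _ (nw (f1 (f2 k)))).
pose f k := f1 (f2 (f3 k)).
have ef : extraction f by apply: extraction_comp ex1 (extraction_comp ex2 ex3).
have cp : vcvg (fun k => (u (f k)).1) p := cvg_extract ex3 c1.
have cz : vcvg (fun k => (u (f k)).2) z := cvg_extract ex3 c2.
have cw : vcvg (fun k => w (f k)) w0 := c3.
have lD : is_lim_seq (fun k => vdist (u (f k)).2 (u (f k)).1) (vdist z p) := lim_vdist cz cp.
have linv : is_lim_seq (fun k => / (INR (f k) + 1)) 0.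
  apply/is_lim_seqP => e e0; have [N HN] := exists_inv_lt e0; exists N => k Nk.
  rewrite Rminus_0_r Rabs_right; last by apply/Rle_ge/Rlt_le/Rinv_0_lt_compat; have := pos_INR (f k); lra.
  by apply: HN; apply: leq_trans Nk (extraction_ge ef k).
have Up k : U (u (f k)).1 := EU (proj1 (proj1 (uP (f k)))).
have nw0 : vnorm w0 = 1.
  have := lim_vdist cw (y := w0) (w := fun=> vzero n) (z := vzero n).
  have h0 : vcvg (fun=> vzero n) (vzero n) by move=> e e0; exists O => k _; rewrite vdist_refl.
  move/(_ h0) => h1; have E (x : Cn n) : vdist x (vzero n) = vnorm x by rewrite /vdist; congr vnorm; vext.
  have h2 : is_lim_seq (fun=> 1) (vdist w0 (vzero n)) by apply: is_lim_seq_ext h1 => k; rewrite E nw.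
  have h3 := is_lim_seq_unique _ _ (is_lim_seq_const 1); rewrite (is_lim_seq_unique _ _ h2) E in h3.
  by case: h3.
have l1 : is_lim_seq (fun k => D1 (u (f k)).1 (w (f k))) (D1 p w0).
  by apply: D1_lim => //; exact: EU.
have bp : bdry D p.
  apply: bdry_rho => //.
  have l2 := lim_cont_fun cont_rho Up (EU Ep) cp.
  have l3 : is_lim_seq (fun=> 0) (rho p).
    apply: is_lim_seq_ext l2 => k; have [[Ek nk] _] := uP (f k).
    apply: Rle_antisym; first exact: rho_le0.
    by apply: Rnot_lt_le => /(proj2 (D_rho (EU Ek))).
  have h3 := is_lim_seq_unique _ _ l3; rewrite (is_lim_seq_unique _ _ (is_lim_seq_const 0)) in h3.
  by case: h3.
have D1w k : D1 (u (f k)).1 (vsub (u (f k)).2 (u (f k)).1) =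
    vdist (u (f k)).2 (u (f k)).1 * D1 (u (f k)).1 (w (f k)).
  by rewrite {1}wv (proj2 (proj1 (proj1 C2 _ (Up k)))).
have low k : -1 * / (INR (f k) + 1) * vdist (u (f k)).2 (u (f k)).1 <= D1 (u (f k)).1 (w (f k)).
  have [_ [_ h]] := uP (f k); rewrite D1w in h; have := dp (f k).
  by move=> h1; apply: (Rmult_le_reg_l _ _ _ h1); nra.
have [zp0|zp0] := classic (z = p); last first.
  have cv : vcvg (fun k => vsub (u (f k)).2 (u (f k)).1) (vsub z p).
    exact: vcvg_sub.
  have l4 : is_lim_seq (fun k => D1 (u (f k)).1 (vsub (u (f k)).2 (u (f k)).1)) (D1 p (vsub z p)).
    by apply: D1_lim => //; exact: EU.
  have l5 := is_lim_seq_mult' _ _ _ _ (is_lim_seq_mult' _ _ _ _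
     (is_lim_seq_mult' _ _ _ _ (is_lim_seq_const (-1)) linv) lD) lD.
  have := is_lim_seq_le _ _ _ _ (fun k => _) l5 l4.
  have h5 := supporting bp Ez zp0.
  move=> h; have : -1 * 0 * vdist z p * vdist z p <= D1 p (vsub z p); last lra.
  apply: h => k; rewrite D1w; have := low k; have := dp (f k) => h1 h2.
  by rewrite [X in _ <= X]Rmult_comm; apply: Rmult_le_compat_r; lra.
have lD0 : is_lim_seq (fun k => vdist (u (f k)).2 (u (f k)).1) 0.
  by move: lD; rewrite zp0 vdist_refl.
have X k : exists x, 0 <= x <= 1 /\ D1 (u (f k)).1 (w (f k)) <=
    - vdist (u (f k)).2 (u (f k)).1 * D2 (line (u (f k)).1 (vsub (u (f k)).2 (u (f k)).1) x) (w (f k)) (w (f k)) / 2.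
  have [bk [Ek _]] := uP (f k); have [x [hx E]] := taylor_rho (proj1 bk) Ek; exists x; split=> //.
  have Ux := EU (closure_convex (proj1 bk) Ek hx).
  have r0 := rho_le0 Ek.
  have p0 : rho (u (f k)).1 = 0.
    apply: Rle_antisym; first exact: rho_le0 (proj1 bk).
    by apply: Rnot_lt_le => /(proj2 (D_rho (EU (proj1 bk)))); case: bk.
  rewrite E p0 D1w in r0; set q := D2 _ _ _ in r0; set q' := D2 _ _ _.
  have Eq : q = vdist (u (f k)).2 (u (f k)).1 * vdist (u (f k)).2 (u (f k)).1 * q'.
    by rewrite -(D2_scal _ _ Ux) -wv.
  rewrite Eq in r0; have h1 := dp (f k); apply: (Rmult_le_reg_l _ _ _ h1); nra.
have [x xP] := choice_fun X.
pose y k := line (u (f k)).1 (vsub (u (f k)).2 (u (f k)).1) (x k).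
have cy : vcvg y p.
  apply: vcvg_dist0 cp _ => e e0; move/is_lim_seqP: lD0 => /(_ e e0) [N HN]; exists N => k /HN.
  rewrite Rminus_0_r => /(Rle_lt_trans _ _ _ (Rle_abs _)).
  have -> : vdist (y k) (u (f k)).1 = Rabs (x k) * vdist (u (f k)).2 (u (f k)).1.
    have := line_dist (u (f k)).1 (vsub (u (f k)).2 (u (f k)).1) (x k) 0.
    by rewrite line0 Rminus_0_r.
  have [hx _] := xP k; rewrite Rabs_right; last lra.
  have := dp (f k); nra.
have Uy k : U (y k).
  by have [bk [Ek _]] := uP (f k); apply: EU; apply: closure_convex (proj1 (xP k)) => //; case: bk.
have lq : is_lim_seq (fun k => D2 (y k) (w (f k)) (w (f k))) (D2 p w0 w0).
  by apply: D2_lim => //; exact: EU.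
have D1p : D1 p w0 = 0.
  apply: Rle_antisym.
    have l5 := is_lim_seq_mult' _ _ _ _ (is_lim_seq_mult' _ _ _ _ (is_lim_seq_const (-1/2)) lD0) lq.
    have h : -1/2 * 0 * D2 p w0 w0 >= D1 p w0; last lra.
    apply/Rle_ge; apply: (is_lim_seq_le _ _ (Rbar.Finite _) (Rbar.Finite _) _ l1 l5) => k; have := proj2 (xP k); rewrite -/(y k); lra.
  have l5 := is_lim_seq_mult' _ _ _ _ (is_lim_seq_mult' _ _ _ _ (is_lim_seq_const (-1)) linv) lD0.
  have h : -1 * 0 * 0 <= D1 p w0; last lra.
  exact: (is_lim_seq_le _ _ (Rbar.Finite _) (Rbar.Finite _) low l5 l1).
have w00 : w0 <> vzero n by move=> E; move: nw0; rewrite E vnorm_zero; lra.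
have := bdry_pos bp w00 D1p.
have l6 := is_lim_seq_mult' _ _ _ _ (is_lim_seq_const 2) linv.
have : D2 p w0 w0 <= 2 * 0; last lra.
apply: (is_lim_seq_le _ _ (Rbar.Finite _) (Rbar.Finite _) _ lq l6) => k.
have := proj2 (xP k); rewrite -/(y k); have := low k; have := dp (f k) => h1 h2 h3.
apply: (Rmult_le_reg_l _ _ _ h1); nra.
Qed.

End Convexity.

Definition peak_data {n} (D : Cn n -> Prop) (rho : Cn n -> R) (nu : Cn n -> Cn n) (Lam c Q : R) : Prop :=
  [/\ 0 < Lam /\ 0 < c /\ 0 < Q, cont_fun_on (closure D) rho,
      forall z, closure D z -> (D z <-> rho z < 0),
      forall z, closure D z -> rho z <= 0 &
      forall p, closure D p -> rho p = 0 ->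
        [/\ vnorm (nu p) <= Lam,
            forall z, closure D z -> Re (inner (vsub z p) (nu p)) <= - c * (vdist z p * vdist z p) &
            forall z, closure D z -> rho z = 0 ->
              - Q * (vdist z p * vdist z p) <= Re (inner (vsub z p) (nu p))]].

Lemma strictly_convex_peak_data {n} (D : Cn n -> Prop) : bounded_set D -> strictly_convex_C2_domain D ->
  exists rho nu Lam c Q, peak_data D rho nu Lam c Q.
Proof.
move=> bd [[op [cn _]] [U [rho [D1 [D2 [Uo [EU [C2 [Dr H]]]]]]]]].
have bp z : bdry D z -> forall v, v <> vzero n -> D1 z v = 0 -> D2 z v v > 0 by move=> /H [].
have [c [c0 Hc]] := quadratic_supporting op cn bd Uo EU C2 Dr bp.
have [B [B0 HB]] := D1_bounded bd EU C2.
have [B2 [B20 HB2]] := D2_bounded bd Uo EU C2.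
pose nu p : Cn n := fun i => (D1 p (ebasis (i, false)), D1 p (ebasis (i, true))).
have cnu p k : coord (nu p) k = D1 p (ebasis k) by case: k => i [].
have Enu p v : closure D p -> Re (inner v (nu p)) = D1 p v.
  move=> Ep; rewrite Re_inner_coord (D1_expansion C2 _ (EU _ Ep)).
  by apply: eq_bigr => k _; rewrite cnu.
have lam0 : 0 <= \sum_(k : 'I_n * bool) B by apply: sum_ge0 => k _; lra.
exists rho, nu, (\sum_(k : 'I_n * bool) B + 1), c, (B2 / 2); split.
- by do !split; lra.
- move=> z Ez e e0; have [d [d0 Hd]] := cont_rho C2 (EU z Ez) e0.
  by exists d; split=> // w /EU; exact: Hd.
- by move=> z Ez; apply: Dr; exact: EU.
- exact: (rho_le0 EU C2 Dr).
- move=> p Ep p0; have bdp := bdry_rho EU Dr Ep p0; split.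
  + apply: Rle_trans (vnorm_le_coord _) _; apply: (@Rle_trans _ (\sum_(k : 'I_n * bool) B)); last lra.
    by apply: sum_le => k _; rewrite cnu; exact: HB.
  + by move=> z Ez; rewrite Enu //; exact: Hc.
  + move=> z Ez z0; rewrite Enu //.
    have [x [hx E]] := taylor_rho op cn Uo EU C2 Dr bp Ep Ez.
    have := HB2 _ (vsub z p) (closure_convex op cn Uo EU C2 Dr bp Ep Ez hx).
    rewrite -/(vdist _ _) => /Rabs_le_between; lra.
Qed.

(** * Sums of complex exponential waves *)

Definition cexp (z : C) : C := (exp (Re z) * cos (Im z), exp (Re z) * sin (Im z)).

Lemma Cmod_cexp z : Cmod (cexp z) = exp (Re z).
Proof.
have p := exp_pos (Re z).
apply: Rsqr_inj; [exact: Cmod_ge_0 | lra |].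
have := Cmod2_alt (cexp z); rewrite /= !Rmult_1_r /Rsqr => ->.
rewrite /cexp /Re /Im /=; have := sin2_cos2 (Im z); rewrite /Rsqr /Re /Im => h.
have -> : forall a b c : R, a * b * (a * b) + a * c * (a * c) = a * a * (c * c + b * b) by move=> *; ring.
by rewrite h; ring.
Qed.

Lemma cexp_add a b : cexp (Cplus a b) = Cmult (cexp a) (cexp b).
Proof.
rewrite /cexp /Cmult /Cplus /Re /Im /= exp_plus cos_plus sin_plus; congr pair; ring.
Qed.

Lemma exp_segment_le x t : 0 <= t <= 1 -> exp (t * x) <= Rmax 1 (exp x).
Proof.
move=> ht; have [h|h] := Rle_lt_dec 0 x.
  apply: Rle_trans (Rmax_r _ _); have : t * x <= x by nra.
  by case=> [/exp_increasing|->]; lra.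
apply: Rle_trans (Rmax_l _ _); rewrite -exp_0; have : t * x <= 0 by nra.
by case=> [/exp_increasing|->]; lra.
Qed.

Lemma Cmod_le_abs (z : C) : Cmod z <= Rabs (Re z) + Rabs (Im z).
Proof.
have h1 := Rabs_pos (Re z); have h2 := Rabs_pos (Im z).
apply: Rsqr_incr_0_var; last lra.
have := Cmod2_alt z; rewrite /= !Rmult_1_r /Rsqr => ->.
have := Rsqr_abs (Re z); have := Rsqr_abs (Im z); rewrite /Rsqr => -> ->; nra.
Qed.

Lemma cexp_taylor (b : C) : Cmod (Cminus (Cminus (cexp b) (RtoC 1)) b)
   <= 2 * (Cmod b * Cmod b) * Rmax 1 (exp (Re b)).
Proof.
have B2 : Cmod b * Cmod b = Re b * Re b + Im b * Im b.
  by have := Cmod2_alt b; rewrite /= !Rmult_1_r.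
move: B2; case: b => x y B2; rewrite B2 /Re /Im /=.
have m0 : 0 < Rmax 1 (exp x) by apply: Rlt_le_trans (Rmax_l _ _); lra.
have bnd t a b : 0 <= t <= 1 -> -1 <= a <= 1 -> -1 <= b <= 1 ->
   Rabs (exp (t * x) * ((x * x - y * y) * a - 2 * x * y * b) / 2) <= (x * x + y * y) * Rmax 1 (exp x).
  move=> ht ha hb; have := exp_segment_le x ht; have := exp_pos (t * x).
  set e := exp _; set m := Rmax _ _ => e0 em.
  have -> : e * ((x * x - y * y) * a - 2 * x * y * b) / 2 = e * (((x * x - y * y) * a - 2 * x * y * b) / 2) by field.
  rewrite Rabs_mult Rabs_right; last lra.
  rewrite [X in _ <= X]Rmult_comm; apply: Rmult_le_compat => //; [lra | exact: Rabs_pos|].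
  have q1 := Rle_0_sqr (x + y); have q2 := Rle_0_sqr (x - y); rewrite /Rsqr in q1 q2.
  apply: Rabs_le.
  have h1 : Rabs ((x * x - y * y) * a) <= x * x + y * y.
    rewrite Rabs_mult -[X in _ <= X]Rmult_1_r; apply: Rmult_le_compat; try exact: Rabs_pos; apply: Rabs_le; split; nra.
  have h2 : Rabs (2 * x * y * b) <= x * x + y * y.
    rewrite Rabs_mult -[X in _ <= X]Rmult_1_r; apply: Rmult_le_compat; try exact: Rabs_pos; apply: Rabs_le; split; nra.
  by move/Rabs_le_between: h1; move/Rabs_le_between: h2; lra.
have [t1 [h1 E1]] := @taylor2 (fun t => exp (t * x) * cos (t * y))
  (fun t => exp (t * x) * (x * cos (t * y) - y * sin (t * y)))
  (fun t => exp (t * x) * ((x * x - y * y) * cos (t * y) - 2 * x * y * sin (t * y)))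
  (fun t _ => ltac:(apply/is_derive_Reals; auto_derive => //; ring))
  (fun t _ => ltac:(apply/is_derive_Reals; auto_derive => //; ring)).
have [t2 [h2 E2]] := @taylor2 (fun t => exp (t * x) * sin (t * y))
  (fun t => exp (t * x) * (x * sin (t * y) + y * cos (t * y)))
  (fun t => exp (t * x) * ((x * x - y * y) * sin (t * y) - 2 * x * y * (- cos (t * y))))
  (fun t _ => ltac:(apply/is_derive_Reals; auto_derive => //; ring))
  (fun t _ => ltac:(apply/is_derive_Reals; auto_derive => //; ring)).
apply: Rle_trans (Cmod_le_abs _) _; rewrite /cexp /Re /Im /=.
rewrite !Rmult_0_l !Rmult_1_l exp_0 cos_0 sin_0 in E1 E2.
have -> : exp x * cos y + - (1) + - x = exp (t1 * x) * ((x * x - y * y) * cos (t1 * y) - 2 * x * y * sin (t1 * y)) / 2.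
  by rewrite E1; field.
have -> : exp x * sin y + - 0 + - y = exp (t2 * x) * ((x * x - y * y) * sin (t2 * y) - 2 * x * y * (- cos (t2 * y))) / 2.
  by rewrite E2; field.
have := COS_bound (t1 * y); have := SIN_bound (t1 * y); have := COS_bound (t2 * y); have := SIN_bound (t2 * y).
move=> s2 c2 s1 c1.
have := bnd t1 _ _ ltac:(lra) c1 s1.
have := bnd t2 _ (- cos (t2 * y)) ltac:(lra) s2 ltac:(lra).
lra.
Qed.

Definition vlin {m} (I : finType) (P : pred I) (c : I -> C) (e : I -> Cn m) : Cn m :=
  fun j => \big[Cplus/RtoC 0]_(i | P i) Cmult (c i) (e i j).

Lemma inner_vlin {m} (I : finType) (P : pred I) c (e : I -> Cn m) w :
  inner (vlin P c e) w = \big[Cplus/RtoC 0]_(i | P i) Cmult (c i) (inner (e i) w).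
Proof.
rewrite /inner (eq_bigr (fun j => \big[Cplus/RtoC 0]_(i | P i) Cmult (c i) (Cmult (e i j) (Cconj (w j))))).
  by rewrite exchange_big /=; apply: eq_bigr => i _; rewrite Csum_mull.
move=> j _; rewrite /vlin Cmult_comm Csum_mull; apply: eq_bigr => i _; ring.
Qed.

Lemma vnorm_vlin {m} (I : finType) (P : pred I) c (e : I -> Cn m) :
  (forall i, P i -> vnorm (e i) <= 1) -> vnorm (vlin P c e) <= \sum_(i | P i) Cmod (c i).
Proof.
move=> H.
have E : vlin P c e = \big[vadd/vzero m]_(i | P i) vscal (c i) (e i).
  apply: functional_extensionality => j.
  by rewrite (big_morph (fun w : Cn m => w j) (op1 := Cplus) (id1 := RtoC 0)).
rewrite E; apply: (big_ind2 (fun x y => vnorm x <= y)); first by rewrite vnorm_zero; lra.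
- by move=> x1 x2 y1 y2 h1 h2; have := vnorm_triangle x1 y1; lra.
- move=> i Pi; rewrite vnorm_scal -[X in _ <= X]Rmult_1_r.
  by apply: Rmult_le_compat_l; [exact: Cmod_ge_0 | exact: H].
Qed.

Lemma vlin_sub {m} (I : finType) (P : pred I) c c' (e : I -> Cn m) :
  vsub (vlin P c e) (vlin P c' e) = vlin P (fun i => Cminus (c i) (c' i)) e.
Proof.
apply: functional_extensionality => j; rewrite /vsub /vlin /Cminus.
have -> : Copp (\big[Cplus/RtoC 0]_(i | P i) Cmult (c' i) (e i j)) =
   Cmult (RtoC (-1)) (\big[Cplus/RtoC 0]_(i | P i) Cmult (c' i) (e i j)) by rewrite RtoC_m1; ring.
by rewrite Csum_mull -big_split; apply: eq_bigr => i _; rewrite RtoC_m1 /=; ring.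
Qed.

Lemma is_cderiv_quad {n m} (F : Cn n -> Cn m) z L A r : clinear L -> 0 < r ->
  (forall v, vnorm v < r -> vnorm (vsub (vsub (F (vadd z v)) (F z)) (L v)) <= A * (vnorm v * vnorm v)) ->
  is_cderiv F z L.
Proof.
move=> cl r0 H; split=> //; split; first by case: cl.
move=> e e0; have a0 : 0 < Rabs A + 1 by have := Rabs_pos A; lra.
exists (Rmin r (e / (Rabs A + 1))); split; first by apply: Rmin_pos => //; exact: Rdiv_lt_0_compat.
move=> v hv; have h1 := Rlt_le_trans _ _ _ hv (Rmin_l _ _); have h2 := Rlt_le_trans _ _ _ hv (Rmin_r _ _).
apply: Rle_trans (H v h1) _; rewrite -Rmult_assoc; apply: Rmult_le_compat_r; first exact: vnorm_ge0.
have : (Rabs A + 1) * vnorm v < e.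
  have -> : e = (Rabs A + 1) * (e / (Rabs A + 1)) by field; lra.
  exact: Rmult_lt_compat_l.
have := Rle_abs A; have := vnorm_ge0 v; nra.
Qed.

Section Waves.
Context {n m : nat} (I : finType) (P : pred I) (a : I -> R) (N Lam : R)
  (p nu : I -> Cn n) (e : I -> Cn m).
Hypothesis a01 : forall i, P i -> 0 <= a i <= 1.
Hypothesis N0 : 0 <= N.
Hypothesis nu_bd : forall i, P i -> vnorm (nu i) <= Lam.
Hypothesis e_bd : forall i, P i -> vnorm (e i) <= 1.

Definition wave (i : I) (z : Cn n) : C := cexp (Cmult (RtoC N) (inner (vsub z (p i)) (nu i))).
Definition wave_sum (z : Cn n) : Cn m := vlin P (fun i => Cmult (RtoC (a i)) (wave i z)) e.
Definition wave_deriv (z v : Cn n) : Cn m :=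
  vlin P (fun i => Cmult (RtoC (a i)) (Cmult (Cmult (RtoC N) (inner v (nu i))) (wave i z))) e.

Lemma Cmod_wave i z : Cmod (wave i z) = exp (N * Re (inner (vsub z (p i)) (nu i))).
Proof. by rewrite Cmod_cexp Re_scalR. Qed.

Lemma wave_add i z v : wave i (vadd z v) = Cmult (wave i z) (cexp (Cmult (RtoC N) (inner v (nu i)))).
Proof.
rewrite /wave -cexp_add; congr cexp.
have -> : vsub (vadd z v) (p i) = vadd (vsub z (p i)) v by vext.
by rewrite inner_addl; ring.
Qed.

Lemma clinear_wave_deriv z : clinear (wave_deriv z).
Proof.
split; [split|].
- move=> h k; apply: functional_extensionality => j; rewrite /wave_deriv /vlin /vadd -big_split.
  by apply: eq_bigr => i _; rewrite inner_addl /=; ring.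
- move=> r h; apply: functional_extensionality => j; rewrite /wave_deriv /vlin /vscal Csum_mull.
  by apply: eq_bigr => i _; rewrite inner_scall /=; ring.
- move=> h; apply: functional_extensionality => j; rewrite /wave_deriv /vlin /vscal Csum_mull.
  by apply: eq_bigr => i _; rewrite inner_scall /=; ring.
Qed.

Lemma Cmod_inner_nu i v : P i -> Cmod (Cmult (RtoC N) (inner v (nu i))) <= N * Lam * vnorm v.
Proof.
move=> Pi; rewrite Cmod_mult Cmod_R Rabs_right; last lra.
rewrite Rmult_assoc; apply: Rmult_le_compat_l => //.
apply: Rle_trans (cauchy_schwarz _ _) _; rewrite Rmult_comm.
by apply: Rmult_le_compat_r; [exact: vnorm_ge0 | exact: nu_bd].
Qed.

Lemma wave_sum_norm z : vnorm (wave_sum z) <= \sum_(i | P i) (a i * Cmod (wave i z)).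
Proof.
apply: Rle_trans (vnorm_vlin _ e_bd) _; apply: sum_le => i Pi.
by rewrite Cmod_mult Cmod_R Rabs_right; [lra | have := a01 Pi; lra].
Qed.

Lemma wave_deriv_norm z v : vnorm (wave_deriv z v) <=
  N * Lam * vnorm v * \sum_(i | P i) Cmod (wave i z).
Proof.
apply: Rle_trans (vnorm_vlin _ e_bd) _; rewrite sum_mull; apply: sum_le => i Pi.
have [h0 h1] := a01 Pi; rewrite !Cmod_mult -Cmod_mult Cmod_R Rabs_right; last lra.
have h2 := Cmod_inner_nu v Pi; rewrite Cmod_mult in h2 *.
have h3 := Cmod_ge_0 (wave i z); have h4 := Cmod_ge_0 (RtoC N); have h5 := Cmod_ge_0 (inner v (nu i)).
have h6 : 0 <= Cmod N * Cmod (inner v (nu i)) * Cmod (wave i z) by do !apply: Rmult_le_pos.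
apply: Rle_trans (Rmult_le_compat_r _ _ _ h3 h2); nra.
Qed.

Lemma wave_sum_quad z v : vnorm (vsub (vsub (wave_sum (vadd z v)) (wave_sum z)) (wave_deriv z v)) <=
  2 * (N * Lam * vnorm v) * (N * Lam * vnorm v) *
  (\sum_(i | P i) Cmod (wave i z) + \sum_(i | P i) Cmod (wave i (vadd z v))).
Proof.
rewrite /wave_sum /wave_deriv !vlin_sub -big_split.
apply: Rle_trans (vnorm_vlin _ e_bd) _; rewrite sum_mull; apply: sum_le => i Pi /=.
set b := Cmult (RtoC N) (inner v (nu i)).
have -> : Cminus (Cminus (Cmult (RtoC (a i)) (wave i (vadd z v))) (Cmult (RtoC (a i)) (wave i z)))
   (Cmult (RtoC (a i)) (Cmult b (wave i z)))
  = Cmult (RtoC (a i)) (Cmult (wave i z) (Cminus (Cminus (cexp b) (RtoC 1)) b)).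
  by rewrite wave_add -/b; ring.
have [h0 h1] := a01 Pi; rewrite Cmod_mult Cmod_R Rabs_right; last lra.
have h2 := Cmod_inner_nu v Pi; rewrite -/b in h2.
rewrite Cmod_mult wave_add -/b Cmod_mult [Cmod (cexp b)]Cmod_cexp.
have h3 := cexp_taylor b; have h4 := Cmod_ge_0 (wave i z); have h5 := Cmod_ge_0 b.
have h6 : Rmax 1 (exp (Re b)) <= 1 + exp (Re b).
  by have h := exp_pos (Re b); apply: Rmax_lub; lra.
have h7 := Cmod_ge_0 (Cminus (Cminus (cexp b) (RtoC 1)) b).
have h8 := exp_pos (Re b).
set T := Cmod (Cminus _ _) in h3 h7 *; set w := Cmod (wave i z) in h4 *.
have h9 : Cmod b * Cmod b <= N * Lam * vnorm v * (N * Lam * vnorm v) by nra.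
have h10 : T <= 2 * (N * Lam * vnorm v * (N * Lam * vnorm v)) * (1 + exp (Re b)).
  by have h11 := Rmax_l 1 (exp (Re b)); apply: Rle_trans h3 _; apply: Rmult_le_compat; nra.
have wT := Rmult_le_pos _ _ h4 h7.
apply: (@Rle_trans _ (w * T)); first by nra.
have := Rmult_le_compat_l _ _ _ h4 h10; lra.
Qed.

Lemma wave_sum_cderiv z : is_cderiv wave_sum z (wave_deriv z).
Proof.
set S := \sum_(i | P i) Cmod (wave i z).
have S0 : 0 <= S by apply: sum_ge0 => i _; exact: Cmod_ge_0.
apply: (@is_cderiv_quad _ _ _ _ _ (2 * (N * Lam) * (N * Lam) * (S + exp (N * Rabs Lam) * S)) 1) => [||v hv].
- exact: clinear_wave_deriv.
- lra.
apply: Rle_trans (wave_sum_quad z v) _; rewrite -/S.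
have -> : 2 * (N * Lam * vnorm v) * (N * Lam * vnorm v) * (S + \sum_(i | P i) Cmod (wave i (vadd z v)))
  = 2 * (N * Lam) * (N * Lam) * (vnorm v * vnorm v) * (S + \sum_(i | P i) Cmod (wave i (vadd z v))) by ring.
have -> : 2 * (N * Lam) * (N * Lam) * (S + exp (N * Rabs Lam) * S) * (vnorm v * vnorm v)
  = 2 * (N * Lam) * (N * Lam) * (vnorm v * vnorm v) * (S + exp (N * Rabs Lam) * S) by ring.
have h0 := vnorm_ge0 v.
apply: Rmult_le_compat_l; first by nra.
apply: Rplus_le_compat_l; rewrite /S sum_mull; apply: sum_le => i Pi.
rewrite wave_add Cmod_mult Cmod_cexp Rmult_comm; apply: Rmult_le_compat_r; first exact: Cmod_ge_0.
have h1 : Re (Cmult (RtoC N) (inner v (nu i))) <= N * Rabs Lam.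
  apply: Rle_trans (Rle_trans _ _ _ (Rle_abs _) (re_le_Cmod _)) _.
  apply: Rle_trans (Cmod_inner_nu v Pi) _; rewrite Rmult_assoc.
  have := Rle_abs Lam; have := Rabs_pos Lam => h1 h2.
  by apply: Rmult_le_compat_l => //; nra.
by case: h1 => [/exp_increasing|->]; lra.
Qed.

End Waves.

(** * Coloured nets *)

Lemma two_sided_geometric_sum c u L : 0 < c ->
  \sum_(b < L) exp (- c * Rabs (u - INR b)) <= 2 / (1 - exp (- c)).
Proof.
move=> c0; set q := exp (- c).
have q1 : q < 1 by rewrite /q -exp_0; apply: exp_increasing; lra.
have q0 : 0 < q := exp_pos _.
pose F (x : R) := exp (- c * x).
have F0 x : 0 < F x := exp_pos _.
have F1 x : 0 <= x -> F x <= 1.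
  by move=> hx; rewrite -exp_0 /F; have : - c * x <= 0 by [nra]; case=> [/exp_increasing|->]; lra.
have FS x : F (x + 1) = F x * q by rewrite /F /q -exp_plus; congr exp; ring.
pose G L := if Rle_dec (INR L - 1) u then F (u - INR L + 1) else 2 - F (INR L - u).
have H : (1 - q) * \sum_(b < L) exp (- c * Rabs (u - INR b)) <= G L.
  elim: L => [|L IH].
    rewrite big_ord0 Rmult_0_r /G; case: Rle_dec => /= h; first by have := F0 (u - 0 + 1); lra.
    by have := F1 (0 - u); lra.
  rewrite big_ord_recr /= Rmult_plus_distr_l.
  apply: Rle_trans (Rplus_le_compat_r _ _ _ IH) _.
  rewrite /G S_INR -/(F (Rabs (u - INR L))).
  case: Rle_dec => h1; case: Rle_dec => h2 /=; try lra.
  - rewrite Rabs_right; last lra.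
    have -> : u - (INR L + 1) + 1 = u - INR L by ring.
    by rewrite (FS (u - INR L)); lra.
  - rewrite Rabs_left; last lra.
    have -> : INR L + 1 - u = (INR L - u) + 1 by ring.
    have -> : - (u - INR L) = INR L - u by ring.
    rewrite (FS (INR L - u)); have := F1 (u - INR L + 1) ltac:(lra); have := F1 (INR L - u) ltac:(lra).
    by have := F0 (INR L - u); nra.
  - rewrite Rabs_left; last lra.
    have -> : INR L + 1 - u = (INR L - u) + 1 by ring.
    have -> : - (u - INR L) = INR L - u by ring.
    by rewrite FS; lra.
have G2 : G L <= 2.
  rewrite /G; case: Rle_dec => h /=; first by have := F1 (u - INR L + 1) ltac:(lra); lra.
  by have := F0 (INR L - u); lra.
apply: (Rmult_le_reg_l (1 - q)); first lra.
have -> : (1 - q) * (2 / (1 - q)) = 2 by field; lra.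
lra.
Qed.

Lemma exp_sum (I : finType) (F : I -> R) : exp (\sum_i F i) = \big[Rmult/1]_i exp (F i).
Proof. by apply: (big_morph exp) => [x y|]; [exact: exp_plus | exact: exp_0]. Qed.

Lemma prod_le (I : finType) (F G : I -> R) : (forall i, 0 <= F i <= G i) ->
  0 <= \big[Rmult/1]_i F i <= \big[Rmult/1]_i G i.
Proof.
move=> H; apply: (big_ind2 (fun x y => 0 <= x <= y)) => //; first lra.
by move=> x1 x2 y1 y2 [h1 h2] [h3 h4]; split; [exact: Rmult_le_pos | apply: Rmult_le_compat].
Qed.

(* The net consists of one point in each cell of a cubic grid of side [delta] that meets [b]; the
   colour of a cell is its index vector modulo [M+1]. *)
Lemma coloured_net n (b : Cn n -> Prop) c : bounded_set b -> 0 < c ->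
  exists S0 K, 1 <= S0 /\ 0 <= K /\ forall M : nat, exists s : nat, (0 < s)%nat /\
  forall delta, 0 < delta -> exists (I : finType) (P : pred I) (p : I -> Cn n) (col : I -> 'I_s),
  [/\ forall i, P i -> b (p i),
      forall z, b z -> exists2 i, P i & vdist z (p i) <= K * delta,
      forall i j, P i -> P j -> col i = col j -> i <> j -> INR M * delta <= vdist (p i) (p j) &
      forall z, \sum_(i | P i) exp (- c * (vdist z (p i) * vdist z (p i) / (delta * delta))) <= S0].
Proof.
move=> [B bB] c0.
pose S1 := exp (2 * c) * (2 / (1 - exp (- c))).
exists (1 + \big[Rmult/1]_(k : 'I_n * bool) S1), (\sum_(k : 'I_n * bool) 1).
have q1 : exp (- c) < 1 by rewrite -exp_0; apply: exp_increasing; lra.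
have S10 : 0 < S1.
  by apply: Rmult_lt_0_compat; [exact: exp_pos | apply: Rdiv_lt_0_compat; lra].
split.
  have : 0 <= \big[Rmult/1]_(k : 'I_n * bool) S1; last lra.
  by apply: (proj1 (@prod_le _ _ (fun=> S1) _)) => _; lra.
split; first by apply: sum_ge0 => k _; lra.
move=> M; pose colT := {ffun 'I_n * bool -> 'I_M.+1}.
exists #|{: colT}|; split.
  by apply/card_gt0P; exists [ffun=> ord0].
move=> d d0.
pose x (z : Cn n) k := (coord z k + B) / d.
have [L HL] := INR_unbounded (2 * B / d + 1).
pose I := {ffun 'I_n * bool -> 'I_L}.
pose cell (i : I) z := b z /\ forall k, INR (i k) <= x z k <= INR (i k) + 1.
pose P (i : I) := if excluded_middle_informative (exists z, cell i z) then true else false.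
pose p (i : I) : Cn n := epsilon (inhabits (vzero n)) (cell i).
have pP i : P i -> cell i (p i).
  by rewrite /P; case: excluded_middle_informative => // h _; exact: epsilon_spec.
pose col (i : I) := enum_rank ([ffun k => inord (i k %% M.+1)] : colT).
have xd z w k : coord z k - coord w k = d * (x z k - x w k) by rewrite /x; field; lra.
exists I, P, p, col; split.
- by move=> i /pP [].
- move=> z bz.
  have xb k : 0 <= x z k < INR L.
    have /Rabs_le_between h := Rle_trans _ _ _ (coord_le_vnorm z k) (bB z bz).
    split; first by apply: Rmult_le_pos; [lra | apply/Rlt_le/Rinv_0_lt_compat].
    apply: Rle_lt_trans HL; have : x z k <= 2 * B / d; last lra.
    by apply: Rmult_le_compat_r; [apply/Rlt_le/Rinv_0_lt_compat | lra].
  have Q k : exists j : 'I_L, INR j <= x z k <= INR j + 1.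
    have [j hj] := nfloor_ex _ (proj1 (xb k)).
    have jL : (j < L)%nat by apply/ltP/INR_lt; have := xb k; lra.
    by exists (Ordinal jL) => /=; lra.
  pose i : I := [ffun k => proj1_sig (constructive_indefinite_description _ (Q k))].
  have ci : cell i z.
    by split=> // k; rewrite /i ffunE; case: constructive_indefinite_description.
  have Pi : P i by rewrite /P; case: excluded_middle_informative => // -[]; exists z.
  exists i => //; apply: Rle_trans (vnorm_le_coord _) _.
  rewrite Rmult_comm sum_mull; apply: sum_le => k _; rewrite coord_sub xd Rabs_mult Rabs_right; last lra.
  apply: Rmult_le_compat_l; first lra.
  have [_ /(_ k) h1] := ci; have [_ /(_ k) h2] := pP i Pi.
  by apply: Rabs_le; lra.
- move=> i j Pi Pj /enum_rank_inj /ffunP E ij.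
  have [k hk] : exists k, i k <> j k.
    by apply: NNPP => h; apply: ij; apply/ffunP => k; apply: NNPP => h'; apply: h; exists k.
  have Ek : i k = j k %[mod M.+1].
    have := E k; rewrite !ffunE => /(f_equal val) /=; rewrite !inordK ?ltn_pmod //.
  apply: Rle_trans (coord_le_vnorm _ k); rewrite coord_sub xd Rabs_mult Rabs_right; last lra.
  rewrite Rmult_comm; apply: Rmult_le_compat_l; first lra.
  have [_ /(_ k) h1] := pP i Pi; have [_ /(_ k) h2] := pP j Pj.
  have arith a a' r y y' : a <= y <= a + 1 -> a' <= y' <= a' + 1 -> a + r + 1 <= a' -> r <= Rabs (y' - y).
    by move=> *; have := Rle_abs (y' - y); lra.
  have sep (a b' : nat) : (a < b')%nat -> a = b' %[mod M.+1] -> INR a + INR M + 1 <= INR b'.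
    move=> ab /esym /eqP; rewrite eqn_mod_dvd 1?ltnW // => /dvdn_leq; rewrite subn_gt0 => /(_ ab) h.
    have /leP/le_INR : ((a + M).+1 <= b')%nat by rewrite -addnS -leq_subRL // ltnW.
    by rewrite S_INR plus_INR.
  have [g|g|g] := ltngtP (i k) (j k); last by case: hk; exact: val_inj.
    by rewrite Rabs_minus_sym; exact: (arith _ _ _ _ _ h1 h2 (sep _ _ g Ek)).
  exact: (arith _ _ _ _ _ h2 h1 (sep _ _ g (esym Ek))).
move=> z.
apply: (@Rle_trans _ (\sum_(i : I) \big[Rmult/1]_(k : 'I_n * bool)
    (exp (2 * c) * exp (- c * Rabs (x z k - INR (i k)))))).
  apply: (@Rle_trans _ (\sum_(i | P i) \big[Rmult/1]_(k : 'I_n * bool)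
    (exp (2 * c) * exp (- c * Rabs (x z k - INR (i k)))))); last first.
    apply: sum_le_pred => i.
    apply: (proj1 (@prod_le _ _ (fun k => exp (2 * c) * exp (- c * Rabs (x z k - INR (i k)))) _)) => k.
    by split; [apply: Rmult_le_pos; apply/Rlt_le/exp_pos | exact: Rle_refl].
  apply: sum_le => i Pi; rewrite /vdist vnorm_sqr_coord.
  have -> : - c * ((\sum_(k : 'I_n * bool) (coord (vsub z (p i)) k * coord (vsub z (p i)) k)) / (d * d))
     = \sum_(k : 'I_n * bool) (- c * ((x z k - x (p i) k) * (x z k - x (p i) k))).
    rewrite -sum_mull; congr Rmult; rewrite /Rdiv Rmult_comm sum_mull; apply: eq_bigr => k _.
    by rewrite coord_sub xd; field; lra.
  rewrite exp_sum; apply: (proj2 (@prod_le _ _ _ _)) => k; split; first exact/Rlt_le/exp_pos.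
  rewrite -exp_plus.
  have : - c * ((x z k - x (p i) k) * (x z k - x (p i) k)) <= 2 * c + - c * Rabs (x z k - INR (i k)).
    have [_ /(_ k) h] := pP i Pi.
    have arith a y : a <= y <= a + 1 -> Rabs (y - a) <= 1 by move=> ?; apply: Rabs_le; lra.
    have : Rabs (x z k - INR (i k)) <= Rabs (x z k - x (p i) k) + 1.
      have -> : x z k - INR (i k) = (x z k - x (p i) k) + (x (p i) k - INR (i k)) by ring.
      apply: Rle_trans (Rabs_triang _ _) _; apply: Rplus_le_compat_l; exact: (arith _ _ h).
    have -> : (x z k - x (p i) k) * (x z k - x (p i) k) = Rabs (x z k - x (p i) k) * Rabs (x z k - x (p i) k).
      by rewrite -Rabs_mult Rabs_right //; apply/Rle_ge/Rle_0_sqr.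
    set y := Rabs (x z k - x (p i) k); set y' := Rabs _ => h'.
    have : y' <= 2 + y * y by have := Rle_0_sqr (y - 1 / 2); rewrite /Rsqr; lra.
    nra.
  by case=> [/exp_increasing|->]; lra.
rewrite -(bigA_distr_bigA (fun (k : 'I_n * bool) (j : 'I_L) => exp (2 * c) * exp (- c * Rabs (x z k - INR j)))) /=.
apply: (@Rle_trans _ (\big[Rmult/1]_(k : 'I_n * bool) S1)); last first.
  by rewrite -[X in X <= _]Rplus_0_l; apply: Rplus_le_compat_r; lra.
apply: (proj2 (@prod_le _ _ _ _)) => k; split.
  by apply: sum_ge0 => j _; apply: Rmult_le_pos; apply/Rlt_le/exp_pos.
rewrite -sum_mull; apply: Rmult_le_compat_l; first exact/Rlt_le/exp_pos.
exact: two_sided_geometric_sum.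
Qed.

(** * The pushing step *)

Lemma inner_conj {n} (u v : Cn n) : inner u v = Cconj (inner v u).
Proof.
rewrite /inner (big_morph Cconj (op1 := Cplus) (id1 := RtoC 0)).
- by apply: eq_bigr => i _; rewrite /Cconj /Cmult /=; congr pair; ring.
- by move=> x y; rewrite /Cconj /Cplus /=; congr pair; ring.
- by rewrite /Cconj /RtoC /= Ropp_0.
Qed.

Lemma inner_self {n} (u : Cn n) : inner u u = RtoC (vnorm u * vnorm u).
Proof.
rewrite vnorm_sqr RtoC_sum /inner; apply: eq_bigr => i _.
by rewrite -Cmod2_conj /= Rmult_1_r.
Qed.

Lemma y_exp_le1 y : y * exp (- y) <= 1.
Proof.
rewrite exp_Ropp; have := exp_ineq1_le y; have := exp_pos y => h1 h2.
apply: (Rmult_le_reg_r (exp y)) => //; field_simplify; lra.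
Qed.

Lemma exp_le1 x : x <= 0 -> exp x <= 1.
Proof. by move=> h; rewrite -exp_0; case: h => [/exp_increasing|->]; lra. Qed.

Lemma exp_le x y : x <= y -> exp x <= exp y.
Proof. by case=> [/exp_increasing|->]; lra. Qed.

Lemma Rdiv_ge0 x y : 0 <= x -> 0 < y -> 0 <= x / y.
Proof. by move=> h1 h2; apply: Rmult_le_pos => //; apply/Rlt_le/Rinv_0_lt_compat. Qed.

Section Step.
Context {n m : nat} (E : Cn n -> Prop) (f : Cn n -> Cn m) (phi : Cn n -> R).
Context (I : finType) (P : pred I) (p nu : I -> Cn n) (e : I -> Cn m).
Context (c S0 kap eps A delta Lam : R).
Hypothesis c0 : 0 < c.
Hypothesis S01 : 1 <= S0.
Hypothesis kapE : kap = / (2 * S0).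
Hypothesis eps01 : 0 < eps <= 1.
Hypothesis A0 : 0 <= A.
Hypothesis delta01 : 0 < delta <= 1.
Hypothesis deltaA : 2 * A * (delta * delta) <= eps * c.
Hypothesis phi01 : forall z, E z -> 0 <= phi z <= 1.
Hypothesis phi_mod : forall z w, E z -> E w -> phi z <= phi w + eps + A * (vdist w z * vdist w z).
Hypothesis f_mod : forall z w, E z -> E w -> vdist (f z) (f w) <= eps + A * (vdist z w * vdist z w).
Hypothesis pE : forall i, P i -> E (p i).
Hypothesis e1 : forall i, P i -> vnorm (e i) = 1.
Hypothesis ef : forall i, P i -> inner (f (p i)) (e i) = RtoC 0.
Hypothesis nu_dec : forall i z, P i -> E z ->
  Re (inner (vsub z (p i)) (nu i)) <= - c * (vdist z (p i) * vdist z (p i)).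
Hypothesis nu_bd : forall i, P i -> vnorm (nu i) <= Lam.
Hypothesis net_sum : forall z,
  \sum_(i | P i) exp (- (c / 2) * (vdist z (p i) * vdist z (p i) / (delta * delta))) <= S0.

Let N := / (delta * delta).
Let a i := kap * phi (p i).
Let g := wave_sum P a N p nu e.
Let W i z := Cmod (wave N p nu i z).
Let d2 z i := vdist z (p i) * vdist z (p i).
Let G z i := exp (- (c / 2) * (d2 z i / (delta * delta))).

Let dd0 : 0 < delta * delta.
Proof. by nra. Qed.
Let N0 : 0 < N.
Proof. exact: Rinv_0_lt_compat. Qed.
Let kap0 : 0 < kap.
Proof. by rewrite kapE; apply: Rinv_0_lt_compat; lra. Qed.
Let kapS : kap * S0 = / 2.
Proof. by rewrite kapE; field; lra. Qed.
Let kap1 : kap <= / 2.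
Proof. by have := kapS; nra. Qed.
Let d2_ge0 z i : 0 <= d2 z i.
Proof. exact: Rle_0_sqr. Qed.
Let y_ge0 z i : 0 <= c / 2 * (d2 z i / (delta * delta)).
Proof. by apply: Rmult_le_pos; [lra | exact: Rdiv_ge0]. Qed.
Let G01 z i : 0 < G z i <= 1.
Proof. by split; [exact: exp_pos | apply: exp_le1; have := y_ge0 z i; rewrite /G; lra]. Qed.
Let a01 i : P i -> 0 <= a i <= 1.
Proof. by move=> Pi; have := phi01 (pE Pi); rewrite /a; nra. Qed.
Let W_ge0 i z : 0 <= W i z.
Proof. exact: Cmod_ge_0. Qed.

Let W_le i z : P i -> E z -> W i z <= G z i * G z i.
Proof.
move=> Pi Ez; rewrite /W Cmod_wave /G -exp_plus; apply: exp_le.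
have h := nu_dec Pi Ez; rewrite -/(d2 z i) in h *.
have := Rmult_le_compat_l _ _ _ (Rlt_le _ _ N0) h.
by rewrite /N /Rdiv; lra.
Qed.

Let W_weighted i z : P i -> E z -> W i z * (eps + A * d2 z i) <= 2 * eps * G z i.
Proof.
move=> Pi Ez; have h := W_le Pi Ez; have [h1 h2] := G01 z i.
have h3 : G z i * (eps + A * d2 z i) <= 2 * eps.
  have Y := y_ge0 z i; have := y_exp_le1 (c / 2 * (d2 z i / (delta * delta))).
  have -> : - (c / 2 * (d2 z i / (delta * delta))) = - (c / 2) * (d2 z i / (delta * delta)) by ring.
  rewrite -/(G z i); set y := c / 2 * _ in Y * => h4.
  have h5 : A * d2 z i <= eps * y.
    have -> : A * d2 z i = 2 * A * (delta * delta) * (d2 z i / (delta * delta)) / 2 by field; lra.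
    have q0 : 0 <= d2 z i / (delta * delta) by exact: Rdiv_ge0.
    have := Rmult_le_compat_r _ _ _ q0 deltaA; rewrite /y; lra.
  nra.
have h4 : 0 <= eps + A * d2 z i by have := d2_ge0 z i; nra.
apply: (@Rle_trans _ (G z i * G z i * (eps + A * d2 z i))); first exact: Rmult_le_compat_r.
by rewrite Rmult_assoc; nra.
Qed.

Let sum_W_weighted z : E z -> \sum_(i | P i) (W i z * (eps + A * d2 z i)) <= 2 * eps * S0.
Proof.
move=> Ez; apply: Rle_trans (Rmult_le_compat_l _ _ _ _ (net_sum z)); last lra.
by rewrite sum_mull; apply: sum_le => i Pi; exact: W_weighted.
Qed.

Let sum_W z : E z -> \sum_(i | P i) W i z <= S0.
Proof.
move=> Ez; apply: Rle_trans (net_sum z); apply: sum_le => i Pi.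
by have := W_le Pi Ez; have := G01 z i; rewrite /G -/(d2 z i) => h1 h2; nra.
Qed.

Lemma push_norm z : E z -> vnorm (g z) <= (phi z + 2 * eps) / 2.
Proof.
move=> Ez.
apply: Rle_trans (wave_sum_norm _ _ _ a01 (fun i Pi => Req_le _ _ (e1 Pi)) z) _.
apply: (@Rle_trans _ (\sum_(i | P i) (kap * phi z * W i z + kap * (W i z * (eps + A * d2 z i))))).
  apply: sum_le => i Pi; rewrite /a -/(W i z).
  have h := phi_mod (pE Pi) Ez; rewrite -/(d2 z i) in h.
  have := Rmult_le_compat_r _ _ _ (W_ge0 i z) h; have := kap0; nra.
rewrite big_split -!sum_mull /=.
have h1 := sum_W Ez; have h2 := sum_W_weighted Ez; have [h3 _] := phi01 Ez.
have h4 : 0 <= kap * phi z by have := kap0; nra.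
have h5 := Rmult_le_compat_l _ _ _ h4 h1.
have h6 := Rmult_le_compat_l _ _ _ (Rlt_le _ _ kap0) h2.
have h7 := kapS; nra.
Qed.

Lemma push_cross z : E z -> Rabs (Re (inner (f z) (g z))) <= eps.
Proof.
move=> Ez; rewrite Re_inner_sym /g /wave_sum inner_vlin.
apply: Rle_trans (re_le_Cmod _) _; apply: Rle_trans (Cmod_sum _ _) _.
apply: (@Rle_trans _ (\sum_(i | P i) (kap * (W i z * (eps + A * d2 z i))))); last first.
  rewrite -sum_mull; have := Rmult_le_compat_l _ _ _ (Rlt_le _ _ kap0) (sum_W_weighted Ez).
  by have := kapS; nra.
apply: sum_le => i Pi; rewrite !Cmod_mult Cmod_R Rabs_right; last by have := a01 Pi; lra.
rewrite -/(W i z).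
have h1 : Cmod (inner (e i) (f z)) <= eps + A * d2 z i.
  rewrite inner_conj Cmod_conj.
  have -> : inner (f z) (e i) = inner (vsub (f z) (f (p i))) (e i) by rewrite inner_subl ef //; ring.
  apply: Rle_trans (cauchy_schwarz _ _) _; rewrite e1 // Rmult_1_r.
  exact: f_mod Ez (pE Pi).
have [h2 _] := a01 Pi; have := proj2 (phi01 (pE Pi)) => h3.
have h4 : a i <= kap by rewrite /a; have := kap0; nra.
rewrite Rmult_assoc; apply: Rmult_le_compat => //.
  by apply: Rmult_le_pos => //; exact: Cmod_ge_0.
exact: Rmult_le_compat_l.
Qed.

Lemma push_change z : E z ->
  vnorm (g z) * vnorm (g z) - 2 * eps <=
    vnorm (vadd (f z) (g z)) * vnorm (vadd (f z) (g z)) - vnorm (f z) * vnorm (f z)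
    <= phi z * phi z / 4 + 4 * eps.
Proof.
move=> Ez; rewrite vnorm_sqr_add; have /Rabs_le_between h1 := push_cross Ez.
have h2 := push_norm Ez; have h3 := vnorm_ge0 (g z); have h4 := phi01 Ez.
have h5 : vnorm (g z) * vnorm (g z) <= (phi z + 2 * eps) / 2 * ((phi z + 2 * eps) / 2) by nra.
split; first lra.
nra.
Qed.

Lemma push_leading j theta M R0 z : P j -> E z ->
  (forall i, P i -> i <> j -> inner (e i) (e j) = RtoC 0 \/ M * delta <= vdist (p i) (p j)) ->
  R0 <= M -> S0 * exp (- (c / 2) * ((M - R0) * (M - R0))) <= theta -> vdist z (p j) <= R0 * delta ->
  Rabs (Cmod (inner (g z) (e j)) - kap * phi (p j) * W j z) <= kap * theta * phi z + eps.
Proof.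
move=> Pj Ez sep RM Hth hz.
set q := exp _ in Hth.
have q0 : 0 < q := exp_pos _.
have far i : P i -> M * delta <= vdist (p i) (p j) -> W i z <= q * G z i.
  move=> Pi hM; apply: Rle_trans (W_le Pi Ez) _; apply: Rmult_le_compat_r; first by have := G01 z i; lra.
  apply: exp_le; have hd : (M - R0) * delta <= vdist z (p i).
    have := vdist_triangle (p i) z (p j); rewrite (vdist_sym (p i) z); lra.
  have : (M - R0) * (M - R0) <= d2 z i / (delta * delta).
    apply: (Rmult_le_reg_r (delta * delta)) => //.
    have -> : d2 z i / (delta * delta) * (delta * delta) = d2 z i by field; lra.
    rewrite /d2; have : 0 <= (M - R0) * delta by nra.
    by move: hd; set u := vdist _ _; nra.
  by nra.
have E1 : Cmod (inner (g z) (e j)) - kap * phi (p j) * W j z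
   = Cmod (inner (g z) (e j)) - Cmod (Cmult (RtoC (a j)) (wave N p nu j z)).
  by rewrite Cmod_mult Cmod_R Rabs_right // -/(a j); have := a01 Pj; lra.
rewrite E1.
have tri (x y : C) : Rabs (Cmod x - Cmod y) <= Cmod (Cminus x y).
  have h1 := Cmod_triangle (Cminus x y) y; have h2 := Cmod_triangle (Copp (Cminus x y)) x.
  rewrite Cmod_opp in h2.
  have E2 : Cplus (Cminus x y) y = x by ring.
  have E3 : Cplus (Copp (Cminus x y)) x = y by ring.
  by rewrite E2 in h1; rewrite E3 in h2; apply: Rabs_le; lra.
apply: Rle_trans (tri _ _) _.
rewrite /g /wave_sum inner_vlin (bigD1 j) //= inner_self e1 // !Rmult_1_l.
rewrite /Cminus Cplus_comm Cplus_assoc.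
have -> : Cplus (Copp (Cmult (RtoC (a j)) (wave N p nu j z)))
   (Cmult (Cmult (RtoC (a j)) (wave N p nu j z)) (RtoC 1)) = RtoC 0 by ring.
rewrite Cplus_0_l; apply: Rle_trans (Cmod_sum _ _) _.
apply: (@Rle_trans _ (\sum_(i | P i) (kap * phi z * q * G z i + kap * (W i z * (eps + A * d2 z i))))).
  apply: (@Rle_trans _ (\sum_(i | P i && (i != j)) (kap * phi z * q * G z i + kap * (W i z * (eps + A * d2 z i))))).
    apply: sum_le => i /andP[Pi /eqP ij].
    have h0 : 0 <= kap * phi z by have := kap0; have := phi01 Ez; nra.
    have hw : 0 <= W i z * (eps + A * d2 z i).
      by apply: Rmult_le_pos => //; have := d2_ge0 z i; nra.
    case: (sep i Pi ij) => [->|hM].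
      rewrite Cmult_0_r Cmod_0; have := G01 z i => hG.
      have : 0 <= kap * phi z * q * G z i by apply: Rmult_le_pos; [apply: Rmult_le_pos|]; lra.
      by have := kap0; nra.
    rewrite !Cmod_mult Cmod_R Rabs_right; last by have := a01 Pi; lra.
    have he : Cmod (inner (e i) (e j)) <= 1.
      by apply: Rle_trans (cauchy_schwarz _ _) _; rewrite !e1 //; lra.
    have h1 := phi_mod (pE Pi) Ez; rewrite -/(d2 z i) in h1.
    have h2 := far i Pi hM; have h3 := W_ge0 i z; rewrite -/(W i z).
    have [h4 _] := a01 Pi.
    apply: (@Rle_trans _ (a i * W i z)).
      have h5 := Rmult_le_pos _ _ h4 h3; have := Cmod_ge_0 (inner (e i) (e j)); nra.
    have h6 : a i * W i z <= kap * phi z * W i z + kap * (W i z * (eps + A * d2 z i)).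
      have := Rmult_le_compat_r _ _ _ h3 h1; rewrite /a; have := kap0; nra.
    have := Rmult_le_compat_l _ _ _ h0 h2; lra.
  rewrite big_mkcondr; apply: sum_le => i Pi; case: ifP => _; first lra.
  have h0 : 0 <= kap * phi z by have := kap0; have := phi01 Ez; nra.
  have hw : 0 <= W i z * (eps + A * d2 z i).
    by apply: Rmult_le_pos => //; have := d2_ge0 z i; nra.
  have := G01 z i => hG.
  have : 0 <= kap * phi z * q * G z i by apply: Rmult_le_pos; [apply: Rmult_le_pos|]; lra.
  by have := kap0; nra.
rewrite big_split -!sum_mull /=.
have h2 := sum_W_weighted Ez; have [h3 _] := phi01 Ez; have h4 := net_sum z.
have h5 := Rmult_le_compat_l _ _ _ (Rlt_le _ _ kap0) h2.
have h6 : kap * phi z * q * \sum_(i | P i) G z i <= kap * theta * phi z.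
  have k0 : 0 <= kap * phi z by have := kap0; nra.
  have := Rmult_le_compat_l _ _ _ (Rlt_le _ _ q0) h4; rewrite -/(G z) => h7.
  have h8 : q * \sum_(i | P i) G z i <= theta by move: h7; rewrite /G /d2; lra.
  by have := Rmult_le_compat_l _ _ _ k0 h8; lra.
have := kapS; nra.
Qed.

Lemma push_far X d z : 0 <= d -> (forall i, P i -> d <= vdist z (p i)) -> E z ->
  S0 * exp (- (c / 2) * (d * d / (delta * delta))) <= X -> \sum_(i | P i) W i z <= X.
Proof.
move=> d0 hd Ez HX; set q := exp _ in HX.
have q0 : 0 < q := exp_pos _.
apply: (@Rle_trans _ (q * \sum_(i | P i) G z i)); last first.
  by have := net_sum z; rewrite /G /d2; nra.
rewrite sum_mull; apply: sum_le => i Pi; apply: Rle_trans (W_le Pi Ez) _.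
apply: Rmult_le_compat_r; first by have := G01 z i; lra.
apply: exp_le.
have : d * d / (delta * delta) <= d2 z i / (delta * delta).
  apply: Rmult_le_compat_r; first by apply/Rlt_le/Rinv_0_lt_compat.
  by have := hd i Pi; rewrite /d2; nra.
nra.
Qed.

Lemma push_small X z : E z -> \sum_(i | P i) W i z <= X -> vnorm (g z) <= X.
Proof.
move=> Ez HX; apply: Rle_trans (wave_sum_norm _ _ _ a01 (fun i Pi => Req_le _ _ (e1 Pi)) z) _.
apply: Rle_trans HX; apply: sum_le => i Pi.
by have := a01 Pi; have := W_ge0 i z; rewrite -/(W i z); nra.
Qed.

End Step.

Lemma sum_two_terms (T : Type) (idx : T) (op : Monoid.com_law idx) (I : finType) (i j : I) (F : I -> T) :
  i != j -> (forall k, k != i -> k != j -> F k = idx) -> \big[op/idx]_k F k = op (F i) (F j).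
Proof.
move=> ij H; rewrite (bigD1 i) //= (bigD1 j) 1?eq_sym //= big1 ?Monoid.mulm1 // => k /andP[ki kj].
exact: H.
Qed.

Lemma orthogonal_pair_vector s (v : Cn (2 * s)) (k : 'I_s) :
  exists e : Cn (2 * s), [/\ vnorm e = 1, inner v e = RtoC 0 & forall j, e j <> RtoC 0 -> j./2 = k].
Proof.
have h0 : (k.*2 < 2 * s)%nat by rewrite mul2n ltn_double.
have h1 : (k.*2.+1 < 2 * s)%nat by rewrite mul2n ltn_Sdouble.
pose i0 := Ordinal h0; pose i1 := Ordinal h1.
have i01 : i0 != i1 by rewrite -val_eqE /= -[X in X == _]addn0 -addn1 eqn_add2l.
suff [al [be [E1 E2]]] : exists al be, Cmod al * Cmod al + Cmod be * Cmod be = 1 /\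
    Cplus (Cmult (v i0) (Cconj al)) (Cmult (v i1) (Cconj be)) = RtoC 0.
  pose e : Cn (2 * s) := fun j => if j == i0 then al else if j == i1 then be else RtoC 0.
  have e0 : e i0 = al by rewrite /e eqxx.
  have e1 : e i1 = be by rewrite /e eqxx eq_sym (negbTE i01).
  have eo j : j != i0 -> j != i1 -> e j = RtoC 0 by rewrite /e => /negbTE -> /negbTE ->.
  exists e; split.
  - rewrite /vnorm (@sum_two_terms _ 0 Rplus _ i0 i1) //; last by move=> j a b; rewrite eo // Cmod_0; ring.
    by rewrite /= e0 e1 E1 sqrt_1.
  - rewrite /inner (@sum_two_terms _ (RtoC 0) Cplus _ i0 i1) //; last first.
      by move=> j a b; rewrite eo // /Cconj /= Ropp_0 -/(RtoC 0); ring.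
    by rewrite e0 e1.
  - move=> j; rewrite /e; case: eqP => [-> _|_]; first by rewrite /= doubleK.
    by case: eqP => [-> _|_] //=; rewrite uphalf_double.
have [v0|v0] := Req_dec (Cmod (v i0) * Cmod (v i0) + Cmod (v i1) * Cmod (v i1)) 0.
  exists (RtoC 1), (RtoC 0); rewrite Cmod_1 Cmod_0; split; first ring.
  have -> : v i0 = RtoC 0 by apply: Cmod_eq_0; have := Cmod_ge_0 (v i0); have := Cmod_ge_0 (v i1); nra.
  have -> : v i1 = RtoC 0 by apply: Cmod_eq_0; have := Cmod_ge_0 (v i0); have := Cmod_ge_0 (v i1); nra.
  ring.
set q := _ + _ in v0; have qp : 0 < q by have := Cmod_ge_0 (v i0); have := Cmod_ge_0 (v i1); rewrite /q in v0 *; nra.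
have rp : 0 < sqrt q := sqrt_lt_R0 _ qp; have rr := sqrt_sqrt _ (Rlt_le _ _ qp).
exists (Cmult (RtoC (/ sqrt q)) (Cconj (Copp (v i1)))), (Cmult (RtoC (/ sqrt q)) (Cconj (v i0))); split.
  rewrite !Cmod_mult !Cmod_conj Cmod_opp Cmod_R Rabs_right; last by apply/Rle_ge/Rlt_le/Rinv_0_lt_compat.
  have -> : / sqrt q * Cmod (v i1) * (/ sqrt q * Cmod (v i1)) + / sqrt q * Cmod (v i0) * (/ sqrt q * Cmod (v i0))
    = q / (sqrt q * sqrt q) by rewrite /q; field; rewrite -/q; lra.
  by rewrite rr; field; lra.
case: (v i0) => a b; case: (v i1) => a' b'.
rewrite /Cconj /Copp /Cmult /Cplus /RtoC /=; congr pair; ring.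
Qed.

Lemma square_times_exp_decay a N : 0 < a -> 0 < N -> N * N * exp (- (a * N)) <= 27 / (a * a * a * N).
Proof.
move=> a0 N0; set y := a * N / 3; have y0 : 0 < y by rewrite /y; nra.
have -> : exp (- (a * N)) = exp (- y) * exp (- y) * exp (- y) by rewrite -!exp_plus; congr exp; rewrite /y; field.
have h := y_exp_le1 y; have h0 := exp_pos (- y); set z := exp (- y) in h h0 *.
have h1 : 0 < y * z by nra.
have h2 : (y * z) * ((y * z) * (y * z)) <= 1.
  have : (y * z) * (y * z) <= 1 by nra.
  by nra.
have aN : 0 < a * a * a * N by do !apply: Rmult_lt_0_compat.
apply: (Rmult_le_reg_r (a * a * a * N)) => //.
have -> : 27 / (a * a * a * N) * (a * a * a * N) = 27 by field; lra.
have -> : N * N * (z * z * z) * (a * a * a * N) = 27 * ((y * z) * ((y * z) * (y * z))) by rewrite /y; field.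
lra.
Qed.

Definition path_cont {n} (g : R -> Cn n) a b : Prop :=
  forall t, a <= t <= b -> forall e, 0 < e -> exists d, 0 < d /\
    forall s, a <= s <= b -> Rabs (s - t) < d -> vdist (g s) (g t) < e.

Lemma first_hit (u : R -> R) a b v : a <= b ->
  (forall t, a <= t <= b -> forall e, 0 < e -> exists d, 0 < d /\
     forall s, a <= s <= b -> Rabs (s - t) < d -> Rabs (u s - u t) < e) ->
  u a <= v <= u b -> exists t, [/\ a <= t <= b, u t = v & forall s, a <= s <= t -> u s <= v].
Proof.
move=> ab ct [ua ub].
pose S t := a <= t <= b /\ forall s, a <= s <= t -> u s <= v.
have Sa : S a by split=> [|s hs]; [lra | have -> : s = a by lra].
have [t [Ht1 Ht2]] : {t | is_lub S t}.
  by apply: completeness; [exists b => x [[]] | exists a].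
have at0 : a <= t := Ht1 a Sa.
have tb : t <= b by apply: Ht2 => x [[]].
have below s : a <= s < t -> u s <= v.
  move=> hs; apply: Rnot_lt_le => h.
  have : t <= s; last lra.
  apply: Ht2 => x [hx1 hx2]; apply: Rnot_lt_le => sx.
  by have := hx2 s ltac:(lra); lra.
have ut : u t <= v.
  have [<-//|at1] := Req_dec a t; apply: Rnot_lt_le => h.
  have [d [d0 Hd]] := ct t (conj at0 tb) (u t - v) ltac:(lra).
  pose s := Rmax a (t - d / 2).
  have s1 := Rmax_l a (t - d / 2); have s2 := Rmax_r a (t - d / 2).
  have s3 : s < t by apply: Rmax_lub_lt; lra.
  have := Hd s ltac:(rewrite /s in s3 *; lra) ltac:(rewrite /s in s3 *; apply: Rabs_def1; lra).
  have := below s ltac:(rewrite /s in s3 *; lra) => h1 /Rabs_def2; lra.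
exists t; split=> //; last first.
  by move=> s hs; have [->//|st] := Req_dec s t; apply: below; lra.
apply: Rle_antisym => //; apply: Rnot_lt_le => h.
have tb1 : t < b by apply: Rnot_le_lt => h1; have E : t = b by [lra]; rewrite E in h; lra.
have [d [d0 Hd]] := ct t (conj at0 tb) (v - u t) ltac:(lra).
have h1 := Rmin_l (d / 2) (b - t); have h2 := Rmin_r (d / 2) (b - t).
have h3 : 0 < Rmin (d / 2) (b - t) by apply: Rmin_pos; lra.
have : S (t + Rmin (d / 2) (b - t)); last by move/Ht1; lra.
split; first lra.
move=> s hs; have [st|st] := Rle_lt_dec s t.
  by have [->//|st'] := Req_dec s t; apply: below; lra.
by have := Hd s ltac:(lra) ltac:(apply: Rabs_def1; lra); move/Rabs_def2; lra.
Qed.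

Lemma fun_modulus {n} (E : Cn n -> Prop) (g : Cn n -> R) eta : bounded_set E -> seq_closed E ->
  cont_fun_on E g -> 0 < eta ->
  exists A, 0 <= A /\ forall z w, E z -> E w -> g z <= g w + eta + A * (vdist w z * vdist w z).
Proof.
move=> bd cl ct eta0.
have [A [A0 HA]] := @pseudo_modulus n E (fun z w => Rabs (g z - g w))
  bd cl (fun z w => Rabs_minus_sym _ _)
  (fun z w v => ltac:(have -> : g z - g v = (g z - g w) + (g w - g v) by [ring]; exact: Rabs_triang))
  ct eta eta0.
exists A; split=> // z w Ez Ew; have := HA z w Ez Ew; rewrite vdist_sym.
by move/Rabs_le_between; lra.
Qed.

Section Levels.
Context {n : nat} (D : Cn n -> Prop) (rho : Cn n -> R).
Hypothesis D_bd : bounded_set D.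
Hypothesis rho_ct : cont_fun_on (closure D) rho.
Hypothesis rho_le : forall z, closure D z -> rho z <= 0.

Lemma level_dist t : 0 < t -> exists d, 0 < d /\ forall z p, closure D z -> closure D p ->
  rho z <= - t -> rho p = 0 -> d <= vdist z p.
Proof.
move=> t0.
have [A [A0 HA]] := fun_modulus (closure_bounded D_bd) (@closure_closed _ D) rho_ct (eta := t / 2) ltac:(lra).
have q0 : 0 < t / (2 * (A + 1)) by apply: Rdiv_lt_0_compat; lra.
exists (Rmin 1 (t / (2 * (A + 1)))); split; first by apply: Rmin_pos; lra.
move=> z p Ez Ep zt p0; apply: Rnot_lt_le => h.
have h1 := Rlt_le_trans _ _ _ h (Rmin_l _ _); have h2 := Rlt_le_trans _ _ _ h (Rmin_r _ _).
have := HA p z Ep Ez; rewrite p0.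
have h3 := vdist_ge0 z p; move=> h4.
have h5 : (A + 1) * vdist z p < t / 2.
  have -> : t / 2 = (A + 1) * (t / (2 * (A + 1))) by field; lra.
  by apply: Rmult_lt_compat_l; lra.
have : vdist z p * vdist z p <= vdist z p by nra.
nra.
Qed.

Lemma near_boundary (X : Cn n -> Prop) :
  (forall p, closure D p -> rho p = 0 -> exists r, 0 < r /\ forall y, closure D y -> vdist y p < r -> X y) ->
  exists t, 0 < t /\ forall y, closure D y -> - t <= rho y -> X y.
Proof.
move=> H; apply: NNPP => H0.
have Q (k : nat) : exists y, closure D y /\ - / (INR k + 1) <= rho y /\ ~ X y.
  apply: NNPP => H1; apply: H0; exists (/ (INR k + 1)); split.
    by apply: Rinv_0_lt_compat; have := pos_INR k; lra.
  by move=> y Ey hy; apply: NNPP => nX; apply: H1; exists y.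
have [y yP] := choice_fun Q.
have [phi [p [ex [c Ep]]]] := compact_subseq (closure_bounded D_bd) (@closure_closed _ D) (fun k => proj1 (yP k)).
have p0 : rho p = 0.
  apply: Rle_antisym; first exact: rho_le.
  apply: Rnot_lt_le => h.
  have [d [d0 Hd]] := rho_ct Ep (e := - rho p / 2) ltac:(lra).
  have [N1 H1] := c d d0; have [N2 H2] := exists_inv_lt (e := - rho p / 2) ltac:(lra).
  have h1 := H1 _ (leq_maxl N1 N2).
  have h2 := H2 _ (leq_trans (leq_maxr N1 N2) (extraction_ge ex _)).
  have [Ey [hy _]] := yP (phi (maxn N1 N2)).
  have /Rabs_def2 := Hd _ Ey h1; lra.
have [r [r0 Hr]] := H p Ep p0; have [N HN] := c r r0.
have [Ey [_ nX]] := yP (phi N); apply: nX; apply: Hr => //; exact: HN.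
Qed.

End Levels.

Lemma sqr_le a b : 0 <= a -> a <= b -> a * a <= b * b.
Proof. by move=> h1 h2; apply: Rmult_le_compat. Qed.

Lemma sqr_ge_sub a b e : 0 <= a <= 1 -> 0 <= b -> 0 <= e -> a - e <= b -> a * a - 2 * e <= b * b.
Proof. by move=> h1 h2 h3 h4; have [h|h] := Rle_lt_dec a e; nra. Qed.

Lemma Rmult_le1 a b : 0 <= a <= 1 -> 0 <= b <= 1 -> 0 <= a * b <= 1.
Proof. nra. Qed.

Lemma small_scale (B : R) : 0 <= B -> exists d, 0 < d <= 1 /\ forall T, 0 <= T <= B -> d * T <= 1 /\ d * d * T <= 1.
Proof.
move=> B0; exists (/ (B + 1)).
have d0 : 0 < / (B + 1) by apply: Rinv_0_lt_compat; lra.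
have d1 : / (B + 1) <= 1 by rewrite -Rinv_1; apply: Rinv_le_contravar; lra.
have dB : / (B + 1) * (B + 1) = 1 by field; lra.
split=> // T hT.
have h : / (B + 1) * T <= 1 by nra.
split=> //; rewrite Rmult_assoc; have : 0 <= / (B + 1) * T by [nra]; nra.
Qed.

Lemma cont_normsq {n m} (E : Cn n -> Prop) (f : Cn n -> Cn m) : cont_on E f ->
  cont_fun_on E (fun z => vnorm (f z) * vnorm (f z)).
Proof.
move=> H z Ez e e0; have f0 := vnorm_ge0 (f z).
have q0 : 0 < e / (2 * (vnorm (f z) + 1)) by apply: Rdiv_lt_0_compat; lra.
have [d [d0 Hd]] := H z Ez (Rmin 1 (e / (2 * (vnorm (f z) + 1)))) ltac:(apply: Rmin_pos; lra).
exists d; split=> // w Ew /(Hd w Ew) h.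
have h1 := Rlt_le_trans _ _ _ h (Rmin_l _ _); have h2 := Rlt_le_trans _ _ _ h (Rmin_r _ _).
have := vnorm_dist (f w) (f z); have g0 := vnorm_ge0 (f w).
set D := vdist _ _ in h h1 h2 * => h3.
have -> : vnorm (f w) * vnorm (f w) - vnorm (f z) * vnorm (f z) =
  (vnorm (f w) - vnorm (f z)) * (vnorm (f w) + vnorm (f z)) by ring.
rewrite Rabs_mult (Rabs_right (_ + _)); last lra.
have h4 : vnorm (f w) + vnorm (f z) <= 2 * (vnorm (f z) + 1) by move/Rabs_le_between: h3; lra.
have D0 : 0 <= D by exact: vdist_ge0.
apply: (@Rle_lt_trans _ (D * (2 * (vnorm (f z) + 1)))).
  by apply: Rmult_le_compat => //; [exact: Rabs_pos | lra].
have -> : e = e / (2 * (vnorm (f z) + 1)) * (2 * (vnorm (f z) + 1)) by field; lra.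
apply: Rmult_lt_compat_r => //; lra.
Qed.

Lemma cont_gap {n m} (E : Cn n -> Prop) (q : Cn n -> R) (f : Cn n -> Cn m) :
  cont_fun_on E q -> cont_on E f -> cont_fun_on E (fun z => q z - vnorm (f z) * vnorm (f z)).
Proof.
move=> q_ct f_ct z Ez e e0; have [d1 [d10 H1]] := q_ct z Ez (e / 2) ltac:(lra).
have [d2 [d20 H2]] := cont_normsq f_ct Ez (e := e / 2) ltac:(lra).
exists (Rmin d1 d2); split; first exact: Rmin_pos.
move=> w Ew h; have /Rabs_def2 := H1 w Ew (Rlt_le_trans _ _ _ h (Rmin_l _ _)).
have /Rabs_def2 := H2 w Ew (Rlt_le_trans _ _ _ h (Rmin_r _ _)).
by move=> h1 h2; apply: Rabs_def1; lra.
Qed.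

Definition push {n m} (f g : Cn n -> Cn m) : Cn n -> Cn m := fun z => vadd (f z) (g z).

Definition small_on {n m} (K : Cn n -> Prop) (g : Cn n -> Cn m) (eta : R) : Prop :=
  forall z, K z -> vnorm (g z) <= eta /\ exists L, [/\ clinear L,
    forall v, vnorm (L v) <= eta * vnorm v &
    forall v, K (vadd z v) ->
      vnorm (vsub (vsub (g (vadd z v)) (g z)) (L v)) <= eta * (vnorm v * vnorm v)].

Definition sublevel {n} (D : Cn n -> Prop) (rho : Cn n -> R) t : Cn n -> Prop :=
  fun z => closure D z /\ rho z <= - t.

Lemma push_step {n} (D : Cn n -> Prop) rho nu Lam c Q : bounded_set D -> peak_data D rho nu Lam c Q ->
  exists (s : nat) (u : R), (0 < s)%nat /\ 0 < u <= / 2 /\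
  forall (q : Cn n -> R) (f : Cn n -> Cn (2 * s)) x t eta,
    cont_fun_on (closure D) q -> (forall z, closure D z -> q z <= 1) -> cont_on (closure D) f ->
    0 < x -> (forall z, closure D z -> x <= q z - vnorm (f z) * vnorm (f z)) -> 0 < t -> 0 < eta ->
  exists (g : Cn n -> Cn (2 * s)) t', 0 < t' /\
   [/\ forall z, exists L, is_cderiv g z L,
      small_on (sublevel D rho t) g eta,
      forall z, closure D z -> let ph := q z - vnorm (f z) * vnorm (f z) in
        - eta <= vnorm (push f g z) * vnorm (push f g z) - vnorm (f z) * vnorm (f z) <= ph * ph / 4 + eta,
      forall z, closure D z -> rho z = 0 -> let ph := q z - vnorm (f z) * vnorm (f z) in
        u * (ph * ph) - eta <= vnorm (push f g z) * vnorm (push f g z) - vnorm (f z) * vnorm (f z) &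
      forall gam a b, a <= b -> path_cont gam a b -> (forall tau, a <= tau <= b -> closure D (gam tau)) ->
        rho (gam a) <= - t -> - t' <= rho (gam b) ->
        exists2 tau, a <= tau <= b & u * x <= vdist (push f g (gam tau)) (push f g (gam b))].
Proof.
move=> D_bd [[Lam0 [c0 Q0]] rho_ct rho_D rho_le peak].
have E_bd := closure_bounded D_bd; have E_cl := @closure_closed _ D.
pose bd z := closure D z /\ rho z = 0.
have bd_bd : bounded_set bd by case: E_bd => B HB; exists B => z [/HB].
have [S0 [K [S01 [K0 net]]]] := coloured_net bd_bd (c := c / 2) ltac:(lra).
pose w0 := exp (- (Q * (K * K) + Lam)).
have w00 : 0 < w0 := exp_pos _.
have w01 : w0 <= 1 by apply: exp_le1; nra.
have [R0 [RK HR]] : exists R0, K + 1 <= R0 /\ exp (- c * (R0 * R0)) <= w0 / 8.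
  exists (K + 1 + 8 / (w0 * c)); have h : 0 < 8 / (w0 * c) by apply: Rdiv_lt_0_compat; nra.
  split; first lra.
  set R0 := K + 1 + _; have R1 : 1 <= R0 by rewrite /R0; lra.
  have := y_exp_le1 (c * (R0 * R0)).
  have -> : - (c * (R0 * R0)) = - c * (R0 * R0) by ring.
  have := exp_pos (- c * (R0 * R0)); set z := exp _ => z0 hz.
  have h1 : 8 / w0 <= c * (R0 * R0).
    have -> : 8 / w0 = c * (8 / (w0 * c)) by field; lra.
    by apply: Rmult_le_compat_l; [lra | rewrite /R0 in R1 *; nra].
  apply: (Rmult_le_reg_l (8 / w0)); first by apply: Rdiv_lt_0_compat; lra.
  have -> : 8 / w0 * (w0 / 8) = 1 by field; lra.
  by apply: Rle_trans hz; apply: Rmult_le_compat_r; lra.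
have R00 : 1 <= R0 by lra.
have [M [MR HM]] : exists M : nat, R0 <= INR M /\ S0 * exp (- (c / 2) * ((INR M - R0) * (INR M - R0))) <= w0 / 8.
  have [M HM] := INR_unbounded (R0 + 1 + 16 * S0 / (w0 * c)); exists M.
  have h : 0 < 16 * S0 / (w0 * c) by apply: Rdiv_lt_0_compat; nra.
  split; first lra.
  set r := INR M - R0; have r1 : 1 <= r by rewrite /r; lra.
  have := y_exp_le1 (c / 2 * (r * r)).
  have -> : - (c / 2 * (r * r)) = - (c / 2) * (r * r) by ring.
  have := exp_pos (- (c / 2) * (r * r)); set z := exp _ => z0 hz.
  have h1 : 8 * S0 / w0 <= c / 2 * (r * r).
    have -> : 8 * S0 / w0 = c / 2 * (16 * S0 / (w0 * c)) by field; lra.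
    by apply: Rmult_le_compat_l; [lra | rewrite /r in r1 *; nra].
  apply: (Rmult_le_reg_l (8 / w0)); first by apply: Rdiv_lt_0_compat; lra.
  have -> : 8 / w0 * (w0 / 8) = 1 by field; lra.
  apply: Rle_trans hz; rewrite -Rmult_assoc; apply: Rmult_le_compat_r; first lra.
  by apply: Rle_trans h1; apply: Req_le; field; lra.
have [s [s0 {}net]] := net M.
pose kap := / (2 * S0).
have kap0 : 0 < kap by apply: Rinv_0_lt_compat; lra.
have kap1 : kap <= / 2 by apply: Rinv_le_contravar; lra.
have kw : 0 < kap * w0 <= / 2 by clear -kap0 kap1 w00 w01; nra.
pose u1 := kap * w0 / 2.
have u10 : 0 < u1 by rewrite /u1; nra.
have u11 : u1 <= / 4 by rewrite /u1; nra.
exists s, (u1 * u1); split=> //; split; first by clear -u10 u11; nra.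
move=> q f x t eta q_ct q1 f_ct x0 phx t0 eta0.
pose phi z := q z - vnorm (f z) * vnorm (f z).
have phi_ct : cont_fun_on (closure D) phi by exact: cont_gap.
have phi01 z : closure D z -> 0 <= phi z <= 1.
  move=> Ez; have := phx z Ez; have := q1 z Ez; have := Rle_0_sqr (vnorm (f z)); rewrite /Rsqr /phi; lra.
have kphi01 z : closure D z -> 0 <= kap * phi z <= 1 by move=> /phi01 h; apply: Rmult_le1 => //; lra.
have x1 : forall z, closure D z -> x <= phi z by exact: phx.
pose eps := Rmin (/ 16) (Rmin (eta / 16) (u1 * x / 32)).
have eps0 : 0 < eps by rewrite /eps; do !apply: Rmin_pos; nra.
have eps1 : eps <= / 16 by exact: Rmin_l.
have eps2 : eps <= eta / 16 by apply: Rle_trans (Rmin_r _ _) (Rmin_l _ _).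
have eps3 : eps <= u1 * x / 32 by apply: Rle_trans (Rmin_r _ _) (Rmin_r _ _).
clearbody eps.
have [A1 [A10 HA1]] := fun_modulus E_bd E_cl phi_ct eps0.
have [A2 [A20 HA2]] := @pseudo_modulus n (closure D) (fun z w => vdist (f z) (f w)) E_bd E_cl
   (fun z w => vdist_sym _ _) (fun z w v => vdist_triangle _ _ _) f_ct eps eps0.
pose A := A1 + A2; have A0 : 0 <= A by rewrite /A; lra.
have phi_mod z w : closure D z -> closure D w -> phi z <= phi w + eps + A * (vdist w z * vdist w z).
  move=> Ez Ew; have := HA1 z w Ez Ew; have := Rle_0_sqr (vdist w z); rewrite /Rsqr /A; nra.
have f_mod z w : closure D z -> closure D w -> vdist (f z) (f w) <= eps + A * (vdist z w * vdist z w).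
  move=> Ez Ew; have := HA2 z w Ez Ew; have := Rle_0_sqr (vdist z w); rewrite /Rsqr /A; nra.
clearbody A.
have [d [d0 Hd]] := level_dist D_bd rho_ct t0.
pose a := c / 2 * (d * d); have a0 : 0 < a by rewrite /a; do !apply: Rmult_lt_0_compat; lra.
have aaa : 0 < a * a * a := Rmult_lt_0_compat _ _ (Rmult_lt_0_compat _ _ a0 a0) a0.
pose Y := 4 * ((1 + Lam) * (1 + Lam)) * S0 * (27 / (a * a * a)).
have Y0 : 0 <= Y.
  apply: Rmult_le_pos; first by do !apply: Rmult_le_pos; lra.
  by apply: Rdiv_ge0 aaa; lra.
pose T1 := 2 * A / (eps * c); pose T2 := A * (2 * R0 * (2 * R0)) / eps; pose T3 := 2 * R0 / d; pose T4 := Y / eta.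
have T10 : 0 <= T1 by apply: Rdiv_ge0; clear -A0 eps0 c0; nra.
have T20 : 0 <= T2 by apply: Rdiv_ge0 => //; apply: Rmult_le_pos => //; clear -R00; nra.
have T30 : 0 <= T3 by apply: Rdiv_ge0; lra.
have T40 : 0 <= T4 by apply: Rdiv_ge0.
have [dl [dl01 Hdl]] := small_scale (B := T1 + T2 + T3 + T4) ltac:(lra).
have dd0 : 0 < dl * dl by clear -dl01; nra.
have C1 : 2 * A * (dl * dl) <= eps * c.
  have [_ h] := Hdl T1 ltac:(lra).
  have -> : 2 * A * (dl * dl) = (dl * dl * T1) * (eps * c) by rewrite /T1; field; lra.
  by clear -h eps0 c0; have : 0 < eps * c by [nra]; nra.
have C2 : A * (2 * R0 * dl * (2 * R0 * dl)) <= eps.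
  have [_ h] := Hdl T2 ltac:(lra).
  have -> : A * (2 * R0 * dl * (2 * R0 * dl)) = (dl * dl * T2) * eps by rewrite /T2; field; lra.
  by clear -h eps0; nra.
have C3 : R0 * dl < d.
  have [h _] := Hdl T3 ltac:(lra).
  have H : 2 * R0 * dl <= d.
    have -> : 2 * R0 * dl = (dl * T3) * d by rewrite /T3; field; lra.
    by clear -h d0; nra.
  by clear -H R00 dl01; nra.
have C4 : dl * dl * Y <= eta.
  have [_ h] := Hdl T4 ltac:(lra).
  have -> : dl * dl * Y = (dl * dl * T4) * eta by rewrite /T4; field; lra.
  by clear -h eta0; nra.
have [I [P [p [col [pb near sep sumP]]]]] := net dl (proj1 dl01).
have O i := orthogonal_pair_vector (f (p i)) (col i).
have [e eP] := choice_fun O.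
have e1 i : P i -> vnorm (e i) = 1 by case: (eP i).
have ef i : P i -> inner (f (p i)) (e i) = RtoC 0 by case: (eP i).
have ee i j : col i <> col j -> inner (e i) (e j) = RtoC 0.
  move=> h; rewrite /inner big1 // => k _.
  have [->|h1] := classic (e i k = RtoC 0); first ring.
  have [->|h2] := classic (e j k = RtoC 0); first by rewrite /Cconj /RtoC /Cmult /=; congr pair; ring.
  case: h; apply: val_inj => /=; have [_ _ /(_ k h1) <-] := eP i; have [_ _ /(_ k h2) <-] := eP j; done.
pose nup i := nu (p i).
have pE i : P i -> closure D (p i) by move/pb => [].
have nu_bd i : P i -> vnorm (nup i) <= Lam by move/pb => [Ep p0]; case: (peak _ Ep p0).
have nu_dec i z : P i -> closure D z ->
    Re (inner (vsub z (p i)) (nup i)) <= - c * (vdist z (p i) * vdist z (p i)).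
  by move=> /pb [Ep p0] Ez; case: (peak _ Ep p0) => _ /(_ z Ez).
have sep' j i : P j -> P i -> i <> j -> inner (e i) (e j) = RtoC 0 \/ INR M * dl <= vdist (p i) (p j).
  move=> Pj Pi ij; have [h|h] := classic (col i = col j); last by left; exact: ee.
  by right; apply: sep.
have eps01 : 0 < eps <= 1 by lra.
pose N := / (dl * dl).
have N0 : 0 < N by exact: Rinv_0_lt_compat.
have N1 : 1 <= N by rewrite /N -Rinv_1; apply: Rinv_le_contravar => //; clear -dl01; nra.
pose g := wave_sum P (fun i => kap * phi (p i)) N p nup e.
pose W i z := Cmod (wave N p nup i z).
have LEAD := push_leading c0 S01 (erefl _ : kap = _) eps01 A0 dl01 C1 phi01 phi_mod pE e1 nu_dec sumP.
have CHANGE := push_change c0 S01 (erefl _ : kap = _) eps01 A0 dl01 C1 phi01 phi_mod f_mod pE e1 ef nu_dec sumP.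
have FAR := push_far c0 dl01 nu_dec sumP.
have SMALL := push_small S01 (erefl _ : kap = _) phi01 pE e1.
have expN (r : R) : - (c / 2) * (r * r / (dl * dl)) = - (c / 2 * (r * r) * N) by rewrite /N /Rdiv; ring.
pose X := S0 * exp (- (c / 2) * (d * d / (dl * dl))).
have X0 : 0 < X by apply: Rmult_lt_0_compat; [lra | exact: exp_pos].
have WX z : sublevel D rho t z -> \sum_(i | P i) W i z <= X.
  move=> [Ez zt]; apply: (FAR X d z _ _ Ez _) => [|i /pb [Ep p0]|]; [lra | exact: Hd | exact: Rle_refl].
have NX : 4 * (N * N) * ((1 + Lam) * (1 + Lam)) * X <= eta.
  apply: Rle_trans C4; rewrite /X expN -/a.
  have := square_times_exp_decay a0 N0; set z := exp _ => h.
  have -> : dl * dl * Y = (4 * ((1 + Lam) * (1 + Lam)) * S0) * (27 / (a * a * a * N)).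
    by rewrite /Y /N; field; lra.
  have -> : 4 * (N * N) * ((1 + Lam) * (1 + Lam)) * (S0 * z) = (4 * ((1 + Lam) * (1 + Lam)) * S0) * (N * N * z) by ring.
  by apply: Rmult_le_compat_l => //; do !apply: Rmult_le_pos; lra.
clearbody X.
have NN : 1 <= N * N by clear -N1; nra.
have LL : 1 <= (1 + Lam) * (1 + Lam) by clear -Lam0; nra.
have NL1 : N * Lam <= N * N * ((1 + Lam) * (1 + Lam)).
  by clear -N1 Lam0; apply: Rmult_le_compat; nra.
have NL2 : N * Lam * (N * Lam) <= N * N * ((1 + Lam) * (1 + Lam)).
  have -> : N * Lam * (N * Lam) = N * N * (Lam * Lam) by ring.
  by clear -N1 Lam0; apply: Rmult_le_compat_l; nra.
have NL3 : 1 <= N * N * ((1 + Lam) * (1 + Lam)) by clear -NN LL; nra.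
set NL := N * N * ((1 + Lam) * (1 + Lam)) in NL1 NL2 NL3.
have NX' : 4 * (NL * X) <= eta by move: NX; rewrite /NL; lra.
clearbody NL.
have Xeta : X <= eta by clear -NL3 NX' X0; nra.
have LEADING y z0 : closure D y -> closure D z0 -> rho z0 = 0 -> vdist y z0 <= dl * dl ->
  exists2 j, P j & vdist y (p j) <= R0 * dl /\
    kap * (7 / 8) * w0 * phi y - 2 * eps <= Cmod (inner (g y) (e j)).
  move=> Ey Ez z00 hy; have [j Pj hj] := near z0 (conj Ez z00).
  have [Ep p0] := pb j Pj; have [_ _ low] := peak _ Ep p0.
  have yp : vdist y (p j) <= R0 * dl.
    by have := vdist_triangle y z0 (p j); clear -hy hj RK dl01; nra.
  have Wy : w0 <= W j y.
    rewrite /W Cmod_wave; apply: exp_le.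
    have -> : vsub y (p j) = vadd (vsub z0 (p j)) (vsub y z0) by vext.
    rewrite inner_addl.
    have h1 := low z0 Ez z00.
    have h2 : - (Lam * (dl * dl)) <= Re (inner (vsub y z0) (nup j)).
      have := Re_inner_le (vsub y z0) (nup j); rewrite -/(vdist y z0) => /Rabs_le_between [h _].
      have := Rmult_le_compat _ _ _ _ (vdist_ge0 y z0) (vnorm_ge0 (nup j)) hy (nu_bd j Pj); lra.
    have h3 : vdist z0 (p j) * vdist z0 (p j) <= K * K * (dl * dl).
      by have := sqr_le (vdist_ge0 _ _) hj; lra.
    have h4 : - (Q * (K * K) + Lam) * (dl * dl) <= Re (inner (vsub z0 (p j)) (nup j)) + Re (inner (vsub y z0) (nup j)).
      by have := Rmult_le_compat_l _ _ _ (Rlt_le _ _ Q0) h3; rewrite /nup in h2 *; lra.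
    have -> : - (Q * (K * K) + Lam) = N * (- (Q * (K * K) + Lam) * (dl * dl)) by rewrite /N; field; lra.
    exact: Rmult_le_compat_l (Rlt_le _ _ N0) h4.
  exists j => //; split=> //.
  have /Rabs_le_between [h1 _] := LEAD j (w0 / 8) (INR M) R0 y Pj Ey (sep' j ^~ Pj) MR HM yp.
  rewrite -/g -/N -/(W j y) in h1.
  have [ph0 ph1] := phi01 y Ey; have [pp0 pp1] := phi01 _ Ep.
  have h2 : phi y <= phi (p j) + 2 * eps.
    have := phi_mod y (p j) Ey Ep; rewrite vdist_sym.
    have : A * (vdist y (p j) * vdist y (p j)) <= eps; last lra.
    apply: Rle_trans C2; apply: Rmult_le_compat_l => //.
    by apply: sqr_le (vdist_ge0 _ _) _; clear -yp R00 dl01; nra.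
  have h3 : kap * phi (p j) * w0 <= kap * phi (p j) * W j y by apply: Rmult_le_compat_l => //; case: (kphi01 _ Ep).
  have h4 : kap * w0 * phi y <= kap * w0 * phi (p j) + eps by clear -kw h2 eps0; nra.
  lra.
pose near_bd y := exists2 z0, closure D z0 /\ rho z0 = 0 & vdist y z0 <= dl * dl.
have [t' [t'0 Ht']] := near_boundary D_bd rho_ct rho_le (X := near_bd)
  (fun p Ep p0 => ex_intro _ (dl * dl) (conj dd0 (fun y _ h => ex_intro2 _ _ p (conj Ep p0) (Rlt_le _ _ h)))).
exists g, t'; split=> //; split.
- by move=> z; exists (wave_deriv P (fun i => kap * phi (p i)) N p nup e z);
    apply: (wave_sum_cderiv _ (Lam := Lam)) => [i Pi||//|i Pi];
    [exact: kphi01 (pE i Pi) | lra | rewrite e1 //; lra].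
- have a01 i : P i -> 0 <= kap * phi (p i) <= 1 by move/pE/kphi01.
  have e1' i : P i -> vnorm (e i) <= 1 by move=> Pi; rewrite e1 //; lra.
  move=> z Kz; split; first by apply: Rle_trans Xeta; apply: SMALL (proj1 Kz) (WX z Kz).
  exists (wave_deriv P (fun i => kap * phi (p i)) N p nup e z); split.
  + exact: clinear_wave_deriv.
  + move=> v; apply: Rle_trans (wave_deriv_norm _ a01 (Rlt_le _ _ N0) nu_bd e1' z v) _.
    have h1 := WX z Kz; have h2 := vnorm_ge0 v.
    have h3 : 0 <= N * Lam by apply: Rmult_le_pos; lra.
    apply: (@Rle_trans _ (N * Lam * X * vnorm v)).
      have := Rmult_le_compat_l _ _ _ (Rmult_le_pos _ _ h3 h2) h1; rewrite /W; lra.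
    by apply: Rmult_le_compat_r => //; clear -NL1 NL3 NX' X0; nra.
  + move=> v Kv; apply: Rle_trans (wave_sum_quad _ a01 (Rlt_le _ _ N0) nu_bd e1' z v) _.
    have h1 := WX z Kz; have h2 := WX _ Kv; have h3 := vnorm_ge0 v.
    have -> : 2 * (N * Lam * vnorm v) * (N * Lam * vnorm v) = 2 * (N * Lam * (N * Lam)) * (vnorm v * vnorm v) by ring.
    have h4 : 0 <= N * Lam * (N * Lam) by exact: Rle_0_sqr.
    have h5 : 0 <= vnorm v * vnorm v by exact: Rle_0_sqr.
    apply: (@Rle_trans _ (2 * (N * Lam * (N * Lam)) * (vnorm v * vnorm v) * (2 * X))).
      by apply: Rmult_le_compat_l; [apply: Rmult_le_pos; lra | rewrite /W in h1 h2; lra].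
    have -> : 2 * (N * Lam * (N * Lam)) * (vnorm v * vnorm v) * (2 * X) =
      4 * (N * Lam * (N * Lam) * X) * (vnorm v * vnorm v) by ring.
    by apply: Rmult_le_compat_r => //; clear -NL2 NX' X0; nra.
- move=> z Ez ph; have [h1 h2] := CHANGE z Ez.
  have := Rle_0_sqr (vnorm (g z)); rewrite /Rsqr /push -/(phi z) in h1 h2 *.
  by rewrite -/g -/N in h1 h2; rewrite /ph -/(phi z); split; lra.
- move=> z Ez z0 ph; have [h1 h2] := CHANGE z Ez; rewrite -/g -/N in h1 h2.
  have [j Pj [hj h3]] := LEADING z z Ez Ez z0 ltac:(rewrite vdist_refl; lra).
  have h4 := cauchy_schwarz (g z) (e j); rewrite e1 // Rmult_1_r in h4.
  have [ph0 ph1] := phi01 z Ez; rewrite /ph -/(phi z) /push.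
  have h5 : u1 * phi z - 2 * eps <= vnorm (g z).
    have h0 : 0 <= kap * w0 * phi z by do !apply: Rmult_le_pos; lra.
    by rewrite /u1; lra.
  have h6 := vnorm_ge0 (g z).
  have h7 : u1 * phi z * (u1 * phi z) - 4 * eps <= vnorm (g z) * vnorm (g z).
    have h8 : 0 <= u1 * phi z <= 1 by apply: Rmult_le1; lra.
    have := sqr_ge_sub h8 h6 (e := 2 * eps) ltac:(lra) h5; lra.
  lra.
- move=> gam al be ab ct Eg ra rb.
  have Eb := Eg be ltac:(lra); have Ea := Eg al ltac:(lra).
  have [z0 [Ez z00] hz] := Ht' _ Eb rb.
  have [j Pj [hj h3]] := LEADING _ z0 Eb Ez z00 hz.
  have [Ep p0] := pb j Pj.
  have [tau [htau Etau _]] := @first_hit (fun tau => - vdist (gam tau) (p j)) al be (- (R0 * dl)) ab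
     ltac:(move=> r hr ee0 e0; have [dd [ddp Hdd]] := ct r hr ee0 e0; exists dd; split=> // r' hr' h;
       have := Hdd r' hr' h; have h5 := vdist_triangle (gam r') (gam r) (p j);
       have h6 := vdist_triangle (gam r) (gam r') (p j); rewrite (vdist_sym (gam r) (gam r')) in h6;
       move=> h7; apply: Rabs_def1; lra)
     ltac:(cbv beta; have := Hd _ _ Ea Ep ra p0; lra).
  have {}Etau : vdist (gam tau) (p j) = R0 * dl by lra.
  have Et := Eg tau htau.
  exists tau => //.
  have /Rabs_le_between [_ h1] := LEAD j (w0 / 8) (INR M) R0 (gam tau) Pj Et (sep' j ^~ Pj) MR HM (Req_le _ _ Etau).
  rewrite -/g -/N -/(W j (gam tau)) in h1.
  have hW : W j (gam tau) <= w0 / 8.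
    apply: Rle_trans HR; rewrite /W Cmod_wave; apply: exp_le.
    have := nu_dec j _ Pj Et; rewrite Etau => h.
    have -> : - c * (R0 * R0) = N * (- c * (R0 * dl * (R0 * dl))) by rewrite /N; field; lra.
    exact: Rmult_le_compat_l (Rlt_le _ _ N0) h.
  have [ph0 ph1] := phi01 _ Eb; have [pp0 pp1] := phi01 _ Ep; have [pt0 pt1] := phi01 _ Et.
  have q1' : A * (R0 * dl * (R0 * dl)) <= eps.
    by have := Rmult_le_pos _ _ A0 (Rle_0_sqr (R0 * dl)); rewrite /Rsqr; lra.
  have q2 : phi (p j) <= phi (gam be) + 2 * eps.
    have := phi_mod (p j) (gam be) Ep Eb.
    have : A * (vdist (gam be) (p j) * vdist (gam be) (p j)) <= eps; last lra.
    apply: Rle_trans q1'; apply: Rmult_le_compat_l => //.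
    exact: sqr_le (vdist_ge0 _ _) hj.
  have dtb : vdist (gam be) (gam tau) <= 2 * R0 * dl.
    by have := vdist_triangle (gam be) (p j) (gam tau); rewrite (vdist_sym (p j)); lra.
  have q3' : A * (vdist (gam be) (gam tau) * vdist (gam be) (gam tau)) <= eps.
    apply: Rle_trans C2; apply: Rmult_le_compat_l => //.
    exact: sqr_le (vdist_ge0 _ _) dtb.
  have q3 : phi (gam tau) <= phi (gam be) + 2 * eps.
    by have := phi_mod (gam tau) (gam be) Et Eb; lra.
  have q4 := f_mod _ _ Eb Et.
  have q5 : Cmod (inner (g (gam tau)) (e j)) <= kap * w0 * phi (gam be) / 4 + 2 * eps.
    have H : kap * phi (p j) * W j (gam tau) <= kap * phi (p j) * (w0 / 8).
      by apply: Rmult_le_compat_l => //; case: (kphi01 _ Ep).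
    clear -h1 H kw q2 q3 eps0.
    have k1 : kap * w0 * phi (p j) <= kap * w0 * phi (gam be) + eps by nra.
    have k2 : kap * w0 * phi (gam tau) <= kap * w0 * phi (gam be) + eps by nra.
    lra.
  have q6 : Cmod (inner (g (gam be)) (e j)) - Cmod (inner (g (gam tau)) (e j)) <= vdist (g (gam be)) (g (gam tau)).
    have h5 := cauchy_schwarz (vsub (g (gam be)) (g (gam tau))) (e j).
    rewrite e1 // Rmult_1_r inner_subl in h5; apply: Rle_trans h5.
    have := Cmod_triangle (Cminus (inner (g (gam be)) (e j)) (inner (g (gam tau)) (e j))) (inner (g (gam tau)) (e j)).
    have -> : Cplus (Cminus (inner (g (gam be)) (e j)) (inner (g (gam tau)) (e j))) (inner (g (gam tau)) (e j)) = inner (g (gam be)) (e j) by ring.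
    lra.
  have q7 : vdist (g (gam be)) (g (gam tau)) <= vdist (push f g (gam tau)) (push f g (gam be)) + vdist (f (gam be)) (f (gam tau)).
    rewrite vdist_sym {1}/vdist /push.
    have -> : vsub (g (gam tau)) (g (gam be)) =
      vadd (vsub (vadd (f (gam tau)) (g (gam tau))) (vadd (f (gam be)) (g (gam be)))) (vsub (f (gam be)) (f (gam tau))) by vext.
    exact: vnorm_triangle.
  have xp := x1 _ Eb.
  have q8 : u1 * x <= vdist (push f g (gam tau)) (push f g (gam be)).
    have : kap * w0 * x <= kap * w0 * phi (gam be) by apply: Rmult_le_compat_l => //; lra.
    by rewrite /u1 in eps3 *; lra.
  apply: Rle_trans q8; apply: Rmult_le_compat_r; [lra | clear -u10 u11; nra].
Qed.

(** * Iteration and limit *)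

Section GeometricLimit.
Context (eta : nat -> R).
Hypothesis eta_dec : forall k, 0 <= eta k.+1 <= eta k / 2.

Lemma eta_ge0 k : 0 <= eta k.
Proof. by have := eta_dec k; lra. Qed.

Lemma eta_le k l : (k <= l)%nat -> eta l <= eta k.
Proof.
elim: l => [|l IH]; first by rewrite leqn0 => /eqP ->; lra.
rewrite leq_eqVlt => /orP[/eqP ->|/IH h]; first lra.
by have := eta_dec l; lra.
Qed.

Lemma eta_small e : 0 < e -> exists N, forall k, (N <= k)%nat -> eta k < e.
Proof.
move=> e0.
have h k : eta k * (INR k + 1) <= eta 0%nat.
  elim: k => [|k IH]; first by rewrite /=; lra.
  rewrite S_INR; have := eta_dec k; have := pos_INR k; nra.
have [K HK] := INR_unbounded (eta 0%nat / e).
exists K => k /leP/le_INR Kk; apply: Rnot_le_lt => hk.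
have := h k; have : eta 0%nat < e * INR k.
  have -> : eta 0%nat = e * (eta 0%nat / e) by field; lra.
  by apply: Rmult_lt_compat_l; lra.
have := pos_INR k; nra.
Qed.

Lemma geometric_limit {n} (x : nat -> Cn n) m c : 0 <= c ->
  (forall k, (m <= k)%nat -> vdist (x k.+1) (x k) <= eta k * c) ->
  exists2 y, vcvg x y & forall k, (m <= k)%nat -> vdist y (x k) <= 2 * eta k * c.
Proof.
move=> c0 H.
have far k j : (m <= k)%nat -> vdist (x (k + j)%nat) (x k) <= (2 * eta k - 2 * eta (k + j)%nat) * c.
  move=> mk; elim: j => [|j IH]; first by rewrite addn0 vdist_refl; lra.
  rewrite addnS; apply: Rle_trans (vdist_triangle _ (x (k + j)%nat) _) _.
  have := H (k + j)%nat (leq_trans mk (leq_addr _ _)); have := eta_dec (k + j)%nat; nra.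
have far2 k l : (m <= k)%nat -> (k <= l)%nat -> vdist (x l) (x k) <= 2 * eta k * c.
  move=> mk kl; have := far k (l - k)%nat mk; rewrite subnKC //.
  have := eta_ge0 l; nra.
have [phi [y [ex cy]]] := @bounded_subseq n (fun j => x (m + j)%nat) (vnorm (x m) + 2 * eta m * c)
  (fun j => ltac:(have := far2 m (m + j)%nat (leqnn m) (leq_addr _ _);
     have /Rabs_le_between := vnorm_dist (x (m + j)%nat) (x m); lra)).
have lim k : (m <= k)%nat -> vdist y (x k) <= 2 * eta k * c.
  move=> mk; apply: Rnot_lt_le => h.
  have [N HN] := cy (vdist y (x k) - 2 * eta k * c) ltac:(lra).
  pose j := maxn N k.
  have h1 := HN j (leq_maxl _ _).
  have kj : (k <= m + phi j)%nat.
    by apply: leq_trans (leq_maxr N k) _; apply: leq_trans (extraction_ge ex _) (leq_addl _ _).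
  have := far2 k _ mk kj; have := vdist_triangle y (x (m + phi j)%nat) (x k).
  rewrite (vdist_sym y (x (m + phi j)%nat)); lra.
exists y => // e e0.
have q0 : 0 < e / (2 * (c + 1)) by apply: Rdiv_lt_0_compat; lra.
have [N HN] := eta_small q0; exists (maxn m N) => k; rewrite geq_max => /andP[mk /HN h].
rewrite vdist_sym; apply: Rle_lt_trans (lim k mk) _.
have -> : e = 2 * (e / (2 * (c + 1))) * (c + 1) by field; lra.
have := eta_ge0 k; nra.
Qed.

End GeometricLimit.

Lemma vcvg_add {n} (x w : nat -> Cn n) y z : vcvg x y -> vcvg w z ->
  vcvg (fun k => vadd (x k) (w k)) (vadd y z).
Proof.
move=> c1 c2 e e0.
have [|N HN] := vcvg_comb (is_lim_seq_const 1) (is_lim_seq_const 1) c1 c2 (e := e); first by [].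
have E (a b : Cn n) : vadd a b = vadd (vscal (RtoC 1) a) (vscal (RtoC 1) b) by vext.
by exists N => k /HN; rewrite -!E.
Qed.

Lemma vcvg_scal {n} (a : C) (x : nat -> Cn n) y : vcvg x y -> vcvg (fun k => vscal a (x k)) (vscal a y).
Proof.
move=> c e e0; have a0 : 0 < Cmod a + 1 by have := Cmod_ge_0 a; lra.
have [N HN] := c (e / (Cmod a + 1)) ltac:(exact: Rdiv_lt_0_compat); exists N => k /HN h3.
have -> : vdist (vscal a (x k)) (vscal a y) = Cmod a * vdist (x k) y.
  by rewrite /vdist -vnorm_scal; congr vnorm; vext.
have -> : e = (Cmod a + 1) * (e / (Cmod a + 1)) by field; lra.
set r := e / _ in h3 *; have h1 := vdist_ge0 (x k) y; have h2 := Cmod_ge_0 a; nra.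
Qed.

Lemma vcvg_ext {n} (x w : nat -> Cn n) y : (forall k, x k = w k) -> vcvg x y -> vcvg w y.
Proof. by move=> H c e /c [N HN]; exists N => k; rewrite -H; exact: HN. Qed.

Lemma clinear_lim {n m} (L : nat -> Cn n -> Cn m) (M : Cn n -> Cn m) :
  (forall k, clinear (L k)) -> (forall v, vcvg (fun k => L k v) (M v)) -> clinear M.
Proof.
move=> cl c; split; [split|].
- move=> h k; apply: (cvg_unique (c (vadd h k))).
  by apply: vcvg_ext (vcvg_add (c h) (c k)) => j; case: (cl j) => -[-> _].
- move=> r h; apply: (cvg_unique (c (vscal (RtoC r) h))).
  by apply: vcvg_ext (vcvg_scal (RtoC r) (c h)) => j; case: (cl j) => -[_ ->].
- move=> h; apply: (cvg_unique (c (vscal Ci h))).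
  by apply: vcvg_ext (vcvg_scal Ci (c h)) => j; case: (cl j) => _ ->.
Qed.

Lemma clinear_add {n m} (L M : Cn n -> Cn m) : clinear L -> clinear M -> clinear (fun v => vadd (L v) (M v)).
Proof.
move=> [[a1 r1] i1] [[a2 r2] i2]; split; [split|].
- by move=> h k; rewrite a1 a2; vext.
- by move=> r h; rewrite r1 r2; vext.
- by move=> h; rewrite i1 i2; vext.
Qed.

Lemma cderiv_push {n m} (f g : Cn n -> Cn m) z L M : is_cderiv f z L -> is_cderiv g z M ->
  is_cderiv (push f g) z (fun v => vadd (L v) (M v)).
Proof.
move=> [c1 [r1 H1]] [c2 [r2 H2]]; split; first exact: clinear_add.
split; first by case: (clinear_add c1 c2).
move=> e e0; have [d1 [d10 h1]] := H1 (e / 2) ltac:(lra); have [d2 [d20 h2]] := H2 (e / 2) ltac:(lra).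
exists (Rmin d1 d2); split; first exact: Rmin_pos.
move=> h hh; have := h1 h (Rlt_le_trans _ _ _ hh (Rmin_l _ _)); have := h2 h (Rlt_le_trans _ _ _ hh (Rmin_r _ _)).
have -> : vsub (vsub (push f g (vadd z h)) (push f g z)) (vadd (L h) (M h)) =
  vadd (vsub (vsub (f (vadd z h)) (f z)) (L h)) (vsub (vsub (g (vadd z h)) (g z)) (M h)) by rewrite /push; vext.
move=> q1 q2; apply: Rle_trans (vnorm_triangle _ _) _; lra.
Qed.

Lemma rlinear_bounded {n m} (L : Cn n -> Cn m) : rlinear L ->
  exists B, 0 <= B /\ forall v, vnorm (L v) <= B * vnorm v.
Proof.
move=> [la ls].
have P (c : 'I_m * bool) : exists B, 0 <= B /\ forall v, Rabs (coord (L v) c) <= B * vnorm v.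
  apply: (@rlinear_fun_bounded n (fun v => coord (L v) c)); split=> [h k|r h].
    by rewrite la coord_add.
  by rewrite ls coord_scal.
have [B BP] := choice_fun P.
exists (\sum_c B c); split; first by apply: sum_ge0 => c _; case: (BP c).
move=> v; rewrite Rmult_comm sum_mull; apply: Rle_trans (vnorm_le_coord _) _; apply: sum_le => c _.
by rewrite Rmult_comm; case: (BP c).
Qed.

Lemma cderiv_cont {n m} (F : Cn n -> Cn m) z L : is_cderiv F z L ->
  forall e, 0 < e -> exists d, 0 < d /\ forall w, vdist w z < d -> vdist (F w) (F z) < e.
Proof.
move=> [_ [lin H]] e e0; have [B [B0 HB]] := rlinear_bounded lin.
have [d [d0 Hd]] := H 1 Rlt_0_1.
have q0 : 0 < e / (B + 2) by apply: Rdiv_lt_0_compat; lra.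
exists (Rmin d (e / (B + 2))); split; first exact: Rmin_pos.
move=> w hw; have h1 := Rlt_le_trans _ _ _ hw (Rmin_l _ _); have h2 := Rlt_le_trans _ _ _ hw (Rmin_r _ _).
have := Hd (vsub w z) h1; rewrite vadd_sub; have := HB (vsub w z); rewrite -/(vdist w z) => h3 h4.
have : vdist (F w) (F z) <= vnorm (vsub (vsub (F w) (F z)) (L (vsub w z))) + vnorm (L (vsub w z)).
  apply: Rle_trans _ (vnorm_triangle _ _); apply: Req_le; rewrite /vdist; congr vnorm; vext.
have : (B + 2) * vdist w z < e.
  have -> : e = (B + 2) * (e / (B + 2)) by field; lra.
  by apply: Rmult_lt_compat_l; lra.
have := vdist_ge0 w z; nra.
Qed.

Lemma holomorphic_vcvg {n m} (D : Cn n -> Prop) (F : Cn n -> Cn m) : holomorphic_on D F ->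
  forall z, D z -> forall w, vcvg w z -> vcvg (fun j => F (w j)) (F z).
Proof.
move=> hol z Dz w cw e e0; have [L HL] := hol z Dz; have [d [d0 Hd]] := cderiv_cont HL e0.
by have [N HN] := cw d d0; exists N => j /HN; exact: Hd.
Qed.

Lemma cont_push {n m} (E : Cn n -> Prop) (f g : Cn n -> Cn m) : cont_on E f ->
  (forall z, exists L, is_cderiv g z L) -> cont_on E (push f g).
Proof.
move=> cf dg z Ez e e0; have [L HL] := dg z.
have [d1 [d10 h1]] := cf z Ez (e / 2) ltac:(lra); have [d2 [d20 h2]] := cderiv_cont HL (e := e / 2) ltac:(lra).
exists (Rmin d1 d2); split; first exact: Rmin_pos.
move=> w Ew h; have := h1 w Ew (Rlt_le_trans _ _ _ h (Rmin_l _ _)); have := h2 w (Rlt_le_trans _ _ _ h (Rmin_r _ _)).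
rewrite /vdist => q1 q2.
have -> : vsub (push f g w) (push f g z) = vadd (vsub (f w) (f z)) (vsub (g w) (g z)) by rewrite /push; vext.
apply: Rle_lt_trans (vnorm_triangle _ _) _; lra.
Qed.

Lemma dependent_choice_nat (T : Type) (Inv : nat -> T -> Prop) (Rl : nat -> T -> T -> Prop) (s0 : T) :
  Inv 0%nat s0 -> (forall k s, Inv k s -> exists s', Inv k.+1 s' /\ Rl k s s') ->
  exists F : nat -> T, F 0%nat = s0 /\ forall k, Inv k (F k) /\ Rl k (F k) (F k.+1).
Proof.
move=> I0 H.
pose next k s := epsilon (inhabits s0) (fun s' => Inv k.+1 s' /\ Rl k s s').
pose F := fix F k := match k with O => s0 | S j => next j (F j) end.
have P k : Inv k (F k).
  by elim: k => // k IH; have [] := epsilon_spec (inhabits s0) _ (H k (F k) IH).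
exists F; split=> // k; split=> //.
by have [] := epsilon_spec (inhabits s0) _ (H k (F k) (P k)).
Qed.

Lemma vcvg_eventually_le {n} (x : nat -> Cn n) y w B m : vcvg x y ->
  (forall k, (m <= k)%nat -> vdist (x k) w <= B) -> vdist y w <= B.
Proof.
move=> c H; apply: Rnot_lt_le => h; have [N HN] := c (vdist y w - B) ltac:(lra).
have := HN _ (leq_maxl N m); have := H _ (leq_maxr N m); have := vdist_triangle y (x (maxn N m)) w.
rewrite (vdist_sym y (x _)); lra.
Qed.

(* The quadratic estimates on the increments make the derivatives converge, so that no Cauchy
   estimates are needed. *)
Lemma limit_cderiv {n m} (F G : nat -> Cn n -> Cn m) (f : Cn n -> Cn m) (K : Cn n -> Prop) (eta : nat -> R) k0 z r :
  (forall k, 0 <= eta k.+1 <= eta k / 2) ->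
  (forall k, F k.+1 = push (F k) (G k)) ->
  (exists L, is_cderiv (F k0) z L) -> 0 < r -> (forall w, vdist w z < r -> K w) ->
  (forall k, (k0 <= k)%nat -> small_on K (G k) (eta k)) ->
  (forall w, K w -> vcvg (fun k => F k w) (f w)) ->
  exists L, is_cderiv f z L.
Proof.
move=> eta_dec FS [L0 HL0] r0 Kr sm fl.
have Kz : K z by apply: Kr; rewrite vdist_refl.
pose good k (L : Cn n -> Cn m) := [/\ clinear L,
    forall v, vnorm (L v) <= eta k * vnorm v &
    forall v, K (vadd z v) ->
      vnorm (vsub (vsub (G k (vadd z v)) (G k z)) (L v)) <= eta k * (vnorm v * vnorm v)].
pose L k := epsilon (inhabits L0) (good k).
have LP k : (k0 <= k)%nat -> good k (L k).
  by move=> hk; have [_ ex] := sm k hk z Kz; exact: epsilon_spec ex.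
pose P := fix P k := match k with
  | O => L0
  | S j => if (k0 <= j)%nat then fun v => vadd (P j v) (L j v) else P j end.
have PS k : (k0 <= k)%nat -> forall v, P k.+1 v = vadd (P k v) (L k v) by move=> /= ->.
have P0 k : (k <= k0)%nat -> P k = L0.
  elim: k => // k IH hk; rewrite /= leqNgt hk /=; apply: IH; exact: ltnW.
have Pcl k : clinear (P k).
  elim: k => [|k IH]; first by case: HL0.
  rewrite /=; case: ifP => // hk; apply: clinear_add => //; by case: (LP k hk).
have Plim v : exists y, vcvg (fun k => P k v) y.
  have [y c _] := @geometric_limit eta eta_dec m (fun k => P k v) k0 (vnorm v) (vnorm_ge0 v)
    (fun k hk => ltac:(cbv beta; rewrite (PS k hk) /vdist; have -> : vsub (vadd (P k v) (L k v)) (P k v) = L k v by [vext];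
       by case: (LP k hk))).
  by exists y.
pose M v := epsilon (inhabits (vzero m)) (vcvg (fun k => P k v)).
have MP v : vcvg (fun k => P k v) (M v) by exact: epsilon_spec (Plim v).
have Mcl : clinear M := clinear_lim Pcl MP.
exists M; split=> //; split; first by case: Mcl.
move=> e e0; have [d [d0 Hd]] := proj2 (proj2 HL0) (e / 2) ltac:(lra).
have eta0 := eta_ge0 eta_dec k0.
have q0 : 0 < e / (4 * (eta k0 + 1)) by apply: Rdiv_lt_0_compat; lra.
exists (Rmin (Rmin d r) (e / (4 * (eta k0 + 1)))); split; first by do !apply: Rmin_pos.
move=> v hv.
have h1 : vnorm v < d := Rlt_le_trans _ _ _ hv (Rle_trans _ _ _ (Rmin_l _ _) (Rmin_l _ _)).
have h2 : vnorm v < r := Rlt_le_trans _ _ _ hv (Rle_trans _ _ _ (Rmin_l _ _) (Rmin_r _ _)).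
have h3 := Rlt_le_trans _ _ _ hv (Rmin_r _ _).
have Kv : K (vadd z v) by apply: Kr; rewrite vdist_add.
pose x k := vsub (vsub (F k (vadd z v)) (F k z)) (P k v).
have cx : vcvg x (vsub (vsub (f (vadd z v)) (f z)) (M v)).
  by do 2? apply: vcvg_sub => //; exact: fl.
have [y cy Hy] := @geometric_limit eta eta_dec m x k0 (vnorm v * vnorm v) (Rle_0_sqr _)
  (fun k hk => ltac:(rewrite /x (PS k hk) FS /push /vdist;
    have -> : vsub (vsub (vsub (vadd (F k (vadd z v)) (G k (vadd z v))) (vadd (F k z) (G k z))) (vadd (P k v) (L k v)))
       (vsub (vsub (F k (vadd z v)) (F k z)) (P k v)) = vsub (vsub (G k (vadd z v)) (G k z)) (L k v) by [vext];
    have [_ _ h] := LP k hk; exact: h)).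
rewrite -(cvg_unique cy cx).
have h4 := Hy k0 (leqnn _); have h5 := Hd v h1.
rewrite /x P0 // in h4.
have h6 : vnorm y <= vdist y (vsub (vsub (F k0 (vadd z v)) (F k0 z)) (L0 v)) + vnorm (vsub (vsub (F k0 (vadd z v)) (F k0 z)) (L0 v)).
  by apply: Rle_trans _ (vnorm_triangle _ _); apply: Req_le; congr vnorm; vext.
have h7 : 4 * (eta k0 + 1) * vnorm v < e.
  have -> : e = 4 * (eta k0 + 1) * (e / (4 * (eta k0 + 1))) by field; lra.
  by apply: Rmult_lt_compat_l; lra.
have := vnorm_ge0 v; clear -h4 h5 h6 h7 eta0; nra.
Qed.

Lemma exists_nat_inv_le m : 0 < m -> exists A : nat, (0 < A)%nat /\ / INR A <= m.
Proof.
move=> m0; have [A [h A0]] := archimed_cor1 m m0; exists A; split; [exact/ltP | lra].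
Qed.

(* [phi - phi^2/4] and [phi - u phi^2] are the extreme changes of the gap in one step; the bounds
   [x = 1/(k+A)] and [y = B/(k+B)] on the gap are carried to [1/(1/x+1)] and [1/(1/y+1/B)]. *)
Lemma gap_lower_step x ph ch eta : 0 < x <= 1 -> x <= ph <= 1 -> ch <= ph * ph / 4 + eta ->
  eta <= x * x / 4 -> / (/ x + 1) <= ph - ch.
Proof.
move=> x0 hp hc he.
have -> : / (/ x + 1) = x / (1 + x) by field; lra.
have h : x / (1 + x) <= x - x * x / 2.
  apply: (Rmult_le_reg_r (1 + x)); first lra.
  have -> : x / (1 + x) * (1 + x) = x by field; lra.
  nra.
nra.
Qed.

Lemma gap_upper_step y ph ch eta u B : 0 < y <= 1 -> 0 <= ph <= y -> 0 < u <= / 2 -> 2 <= u * B ->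
  u * (ph * ph) - eta <= ch -> eta <= y * y / B -> ph - ch <= / (/ y + / B).
Proof.
move=> y0 hp u0 uB hc he.
have B0 : 0 < B by nra.
have -> : / (/ y + / B) = y * B / (B + y) by field; split; lra.
have h1 : ph - u * (ph * ph) <= y - u * (y * y).
  have k1 : u * (y + ph) <= / 2 * (y + ph) by apply: Rmult_le_compat_r; lra.
  have : 0 <= (y - ph) * (1 - u * (y + ph)) by apply: Rmult_le_pos; lra.
  lra.
have h2 : y - y * y / B <= y * B / (B + y).
  apply: (Rmult_le_reg_r (B + y)); first lra.
  have -> : y * B / (B + y) * (B + y) = y * B by field; lra.
  have -> : (y - y * y / B) * (B + y) = y * B - y * y * y / B by field; lra.
  have : 0 <= y * y * y / B by apply: Rdiv_ge0 => //; nra.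
  lra.
have h3 : 2 * (y * y / B) <= u * (y * y).
  have -> : u * (y * y) = (u * B) * (y * y / B) by field; lra.
  have : 0 <= y * y / B by apply: Rdiv_ge0 => //; nra.
  nra.
lra.
Qed.

Lemma push_limit {n} (D : Cn n -> Prop) rho nu Lam c Q : bounded_set D -> open_set D ->
  peak_data D rho nu Lam c Q ->
  exists s : nat, (0 < s)%nat /\ forall q : Cn n -> R,
    cont_fun_on (closure D) q -> (forall z, closure D z -> 0 < q z <= 1) ->
  exists (f : Cn n -> Cn (2 * s)) (T ell : nat -> R),
    [/\ holomorphic_on D f,
        forall z, D z -> vnorm (f z) * vnorm (f z) < q z,
        forall e, 0 < e -> exists t, 0 < t /\ forall z, D z -> - t < rho z ->
          q z - vnorm (f z) * vnorm (f z) < e,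
        (forall k, 0 < T k.+1 <= T k / 2) /\
        (forall k, 0 <= ell k) /\ (forall m B, exists l, B < \sum_(i < l) ell (m + i)%nat) &
        forall k gam a b, a <= b -> path_cont gam a b ->
          (forall tau, a <= tau <= b -> sublevel D rho (T k.+1) (gam tau)) ->
          rho (gam a) <= - T k -> rho (gam b) = - T k.+1 ->
          exists2 tau, a <= tau <= b & ell k <= vdist (f (gam tau)) (f (gam b))].
Proof.
move=> D_bd D_open pk; have [_ rho_ct rho_D rho_le _] := pk.
have [s [u [s0 [u01 step]]]] := push_step D_bd pk.
exists s; split=> // q q_ct q01.
have E_bd := closure_bounded D_bd; have E_cl := @closure_closed _ D.
have [m [m0 qm]] : exists m, 0 < m /\ forall z, closure D z -> m <= q z.
  have iq : cont_fun_on (closure D) (fun z => / q z).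
    move=> z Ez e e0; have [q0 q1] := q01 z Ez.
    have a0 : 0 < Rmin (q z / 2) (e * (q z * q z) / 2).
      have := Rmult_lt_0_compat _ _ e0 (Rmult_lt_0_compat _ _ q0 q0).
      by move=> h; apply: Rmin_pos; lra.
    have [d [d0 Hd]] := q_ct z Ez _ a0; exists d; split=> // w Ew /(Hd w Ew) h.
    have h1 := Rlt_le_trans _ _ _ h (Rmin_l _ _); have h2 := Rlt_le_trans _ _ _ h (Rmin_r _ _).
    have qw : q z / 2 < q w by move/Rabs_def2: h1; lra.
    have -> : / q w - / q z = - (q w - q z) * / (q w * q z) by field; lra.
    have p0 : 0 < q w * q z by nra.
    rewrite Rabs_mult Rabs_Ropp (Rabs_right (/ _)); last by apply/Rle_ge/Rlt_le/Rinv_0_lt_compat.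
    apply: (Rmult_lt_reg_r (q w * q z)) => //.
    have -> : Rabs (q w - q z) * / (q w * q z) * (q w * q z) = Rabs (q w - q z) by field; lra.
    apply: Rlt_le_trans h2 _.
    have -> : e * (q z * q z) / 2 = e * (q z / 2 * q z) by field.
    by apply: Rmult_le_compat_l; [lra | apply: Rmult_le_compat_r; lra].
  have [B [B0 HB]] := cont_fun_bounded E_bd E_cl iq.
  exists (/ (B + 1)); split; first by apply: Rinv_0_lt_compat; lra.
  move=> z Ez; have [h0 _] := q01 z Ez; have := HB z Ez; have := Rle_abs (/ q z) => h1 h2.
  have h3 : 0 < / q z := Rinv_0_lt_compat _ h0.
  by rewrite -(Rinv_inv (q z)); apply: Rinv_le_contravar; lra.
have [B [B0 HB]] := exists_nat_inv_le (m := u / 2) ltac:(lra).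
have [A0 [A00 HA0]] := exists_nat_inv_le m0.
pose A := (A0 + B)%nat.
have B1 : 1 <= INR B by apply: (le_INR 1); exact/leP.
have A01 : 1 <= INR A0 by apply: (le_INR 1); exact/leP.
have AB : INR A = INR A0 + INR B by rewrite /A plus_INR.
have uB : 2 <= u * INR B.
  have : / INR B * INR B = 1 by field; lra.
  have := Rmult_le_compat_r (INR B) _ _ ltac:(lra) HB; lra.
pose x k := / (INR k + INR A); pose y k := INR B / (INR k + INR B).
have x01 k : 0 < x k <= 1.
  have := pos_INR k => hk; split; first by apply: Rinv_0_lt_compat; lra.
  by rewrite /x -Rinv_1; apply: Rinv_le_contravar; lra.
have y01 k : 0 < y k <= 1.
  have := pos_INR k => hk; split; first by apply: Rdiv_lt_0_compat; lra.
  apply: (Rmult_le_reg_r (INR k + INR B)); first lra.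
  have -> : y k * (INR k + INR B) = INR B by rewrite /y; field; lra.
  lra.
have xS k : x k.+1 = / (/ x k + 1).
  by rewrite /x Rinv_inv S_INR; congr (/ _); ring.
have yS k : y k.+1 = / (/ y k + / INR B).
  by rewrite /y S_INR; have := pos_INR k => hk; field; lra.
have xdec k : x k.+1 <= x k.
  by rewrite /x S_INR; have := pos_INR k => hk; apply: Rinv_le_contravar; lra.
pose eta k := u / 8 * ((/ 2) ^ k * (x k * x k)).
have h20 k : 0 < (/ 2) ^ k <= 1.
  elim: k => [|k [h1 h2]] /=; first lra.
  split; lra.
have eta_dec k : 0 <= eta k.+1 <= eta k / 2.
  rewrite /eta /=; have [h1 h2] := h20 k; have [h3 _] := x01 k.+1; have [h4 _] := x01 k; have h5 := xdec k.
  have h6 : x k.+1 * x k.+1 <= x k * x k by apply: sqr_le; lra.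
  split; first by do ?[apply: Rmult_le_pos]; lra.
  have : 0 <= (/ 2) ^ k * (x k * x k - x k.+1 * x k.+1) by apply: Rmult_le_pos; lra.
  clear -u01; nra.
have eta_x k : 0 < eta k <= u / 8 * (x k * x k).
  rewrite /eta; have [h1 h2] := h20 k; have [h3 h4] := x01 k.
  have h5 : 0 < x k * x k by apply: Rmult_lt_0_compat.
  split; first by apply: Rmult_lt_0_compat; [lra | apply: Rmult_lt_0_compat].
  by apply: Rmult_le_compat_l; [lra | clear -h1 h2 h5; nra].
have eta_y k : eta k <= y k * y k / INR B.
  have [_ h] := eta_x k; apply: Rle_trans h _.
  have hk := pos_INR k.
  have -> : y k * y k / INR B = INR B * (/ (INR k + INR B) * / (INR k + INR B)).
    by rewrite /y; field; lra.
  have h1 : x k <= / (INR k + INR B) by apply: Rinv_le_contravar; lra.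
  have [h2 _] := x01 k.
  have h3 := sqr_le (Rlt_le _ _ h2) h1.
  have h4 : 0 < x k * x k by apply: Rmult_lt_0_compat.
  by clear -h3 h4 u01 B1; nra.
pose phi (f : Cn n -> Cn (2 * s)) z := q z - vnorm (f z) * vnorm (f z).
pose Inv k (st : (Cn n -> Cn (2 * s)) * R) :=
  [/\ cont_on (closure D) st.1 /\ (forall z, exists L, is_cderiv st.1 z L), 0 < st.2,
      forall z, closure D z -> x k <= phi st.1 z,
      forall z, closure D z -> rho z = 0 -> phi st.1 z <= y k &
      forall z, closure D z -> - st.2 <= rho z -> phi st.1 z <= 2 * y k].
pose Rel k (st st' : (Cn n -> Cn (2 * s)) * R) := exists g,
  [/\ st'.1 = push st.1 g, st'.2 <= st.2 / 2, small_on (sublevel D rho st.2) g (eta k),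
      forall z, closure D z -> - eta k <= vnorm (push st.1 g z) * vnorm (push st.1 g z) - vnorm (st.1 z) * vnorm (st.1 z) &
      forall gam a b, a <= b -> path_cont gam a b -> (forall tau, a <= tau <= b -> closure D (gam tau)) ->
        rho (gam a) <= - st.2 -> - st'.2 <= rho (gam b) ->
        exists2 tau, a <= tau <= b & u * x k <= vdist (st'.1 (gam tau)) (st'.1 (gam b))].
have phi_cont f : cont_on (closure D) f -> cont_fun_on (closure D) (phi f) by exact: cont_gap.
have phi1 f z : closure D z -> phi f z <= 1.
  by move=> Ez; have [_] := q01 z Ez; have := Rle_0_sqr (vnorm (f z)); rewrite /Rsqr /phi; lra.
have I0 : Inv 0%nat (fun _ => vzero (2 * s), 1).
  have p0 z : phi (fun=> vzero (2 * s)) z = q z by rewrite /phi vnorm_zero; ring.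
  have yy : y 0%nat = 1 by rewrite /y /=; field; lra.
  split=> /=; try lra.
  - split; first by move=> z _ e e0; exists 1; split; [lra | move=> w _ _; rewrite vdist_refl].
    move=> z; exists (fun=> vzero (2 * s)); apply: (@is_cderiv_quad _ _ _ _ _ 0 1); [|lra|].
      split; [split|].
      + by move=> h k; apply: functional_extensionality => i; rewrite /vadd /vzero; ring.
      + by move=> r h; apply: functional_extensionality => i; rewrite /vscal /vzero; ring.
      + by move=> h; apply: functional_extensionality => i; rewrite /vscal /vzero; ring.
    move=> v _; have -> : vsub (vsub (vzero (2 * s)) (vzero (2 * s))) (vzero (2 * s)) = vzero (2 * s).
      by apply: functional_extensionality => i; rewrite /vsub /vzero; ring.
    by rewrite vnorm_zero; lra.
  - move=> z Ez; rewrite p0; apply: Rle_trans (qm z Ez); apply: Rle_trans HA0.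
    by rewrite /x /=; apply: Rinv_le_contravar; lra.
  - by move=> z Ez _; rewrite p0 yy; case: (q01 z Ez).
  - by move=> z Ez _; rewrite p0 yy; case: (q01 z Ez); lra.
have next k st : Inv k st -> exists st', Inv k.+1 st' /\ Rel k st st'.
  case: st => f t [[f_ct f_hol] t0 low upb upt]; rewrite /= in f_ct f_hol t0 low upb upt.
  have [e0 e1] := eta_x k; have [x0 x1] := x01 k; have [y0 y1] := y01 k.
  have [g [t1 [t10 [g_hol sm chg chb cross]]]] := step q f (x k) t (eta k) q_ct
    (fun z Ez => proj2 (q01 z Ez)) f_ct x0 low t0 e0.
  have g_ct := cont_push f_ct g_hol.
  have xx0 : 0 < x k * x k by apply: Rmult_lt_0_compat.
  have ex : eta k <= x k * x k / 4 by clear -e1 u01 xx0; nra.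
  have low' z : closure D z -> x k.+1 <= phi (push f g) z.
    move=> Ez; have [_ h] := chg z Ez; rewrite xS.
    have := gap_lower_step (conj x0 x1) (conj (low z Ez) (phi1 f z Ez)) h ex.
    by rewrite /phi; lra.
  have up' z : closure D z -> rho z = 0 -> phi (push f g) z <= y k.+1.
    move=> Ez z0; have h := chb z Ez z0; rewrite yS.
    have p0 : 0 <= phi f z by have := low z Ez; lra.
    have := gap_upper_step (conj y0 y1) (conj p0 (upb z Ez z0)) u01 uB h (eta_y k).
    by rewrite /phi; lra.
  have [t2 [t20 Ht2]] := near_boundary D_bd rho_ct rho_le (X := fun z => phi (push f g) z <= 2 * y k.+1)
    (fun p Ep p0 => ltac:(
      have [yp _] := y01 k.+1;
      have [d [d0 Hd]] := phi_cont _ g_ct p Ep (y k.+1) yp; exists d; split=> // w Ew h;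
      have /Rabs_def2 := Hd w Ew h; have := up' p Ep p0; lra)).
  pose t' := Rmin t1 (Rmin t2 (t / 2)).
  have t'0 : 0 < t' by rewrite /t'; do !apply: Rmin_pos; lra.
  have t'1 : t' <= t1 by exact: Rmin_l.
  have t'2 : t' <= t2 by apply: Rle_trans (Rmin_r _ _) (Rmin_l _ _).
  have t'3 : t' <= t / 2 by apply: Rle_trans (Rmin_r _ _) (Rmin_r _ _).
  exists (push f g, t'); split.
    split=> //=.
    - split=> // z; have [L HL] := f_hol z; have [M HM] := g_hol z.
      by exists (fun v => vadd (L v) (M v)); exact: cderiv_push.
    - by move=> z Ez h; apply: Ht2 => //; lra.
  exists g; split=> //=.
    by move=> z Ez; case: (chg z Ez).
  by move=> gam a b ab ct Eg ra rb; apply: cross => //; lra.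
have [st [_ stP]] := dependent_choice_nat I0 next.
pose F k := (st k).1; pose T k := (st k).2.
have [G GP] : exists G, forall k, [/\ F k.+1 = push (F k) (G k), T k.+1 <= T k / 2, small_on (sublevel D rho (T k)) (G k) (eta k),
      forall z, closure D z -> - eta k <= vnorm (push (F k) (G k) z) * vnorm (push (F k) (G k) z) - vnorm (F k z) * vnorm (F k z) &
      forall gam a b, a <= b -> path_cont gam a b -> (forall tau, a <= tau <= b -> closure D (gam tau)) ->
        rho (gam a) <= - T k -> - T k.+1 <= rho (gam b) ->
        exists2 tau, a <= tau <= b & u * x k <= vdist (F k.+1 (gam tau)) (F k.+1 (gam b))].
  by apply: (choice_fun (fun k => proj2 (stP k))).
have FP k : Inv k (F k, T k) by case: (stP k); rewrite /F /T; case: (st k).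
clearbody F T.
have T0 k : 0 < T k by case: (FP k).
have Tdec k : 0 <= T k.+1 <= T k / 2 by have := T0 k.+1; case: (GP k) => _ h _ _ _; lra.
have Tle := eta_le Tdec.
have sub_le k l : (k <= l)%nat -> forall z, sublevel D rho (T k) z -> sublevel D rho (T l) z.
  by move=> kl z [Ez h]; split=> //; have := Tle k l kl; lra.
have small k l z : (k <= l)%nat -> sublevel D rho (T k) z -> vdist (F l.+1 z) (F l z) <= eta l * 1.
  move=> kl Kz; have [FS _ sm _ _] := GP l; have [h _] := sm z (sub_le k l kl z Kz).
  rewrite FS /push /vdist; have -> : vsub (vadd (F l z) (G l z)) (F l z) = G l z by vext.
  lra.
pose f z := epsilon (inhabits (vzero (2 * s))) (vcvg (fun k => F k z)).
have f_lim k z : sublevel D rho (T k) z -> vcvg (fun k => F k z) (f z) /\ vdist (f z) (F k z) <= 2 * eta k.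
  move=> Kz; have [w cw Hw] := @geometric_limit eta eta_dec _ (fun k => F k z) k 1 ltac:(lra)
     (fun l kl => small k l z kl Kz).
  have cf : vcvg (fun k => F k z) (f z) by apply: epsilon_spec; exists w.
  by split=> //; rewrite (cvg_unique cf cw); have := Hw k (leqnn k); lra.
have level z : D z -> exists k, rho z < - T k.
  move=> Dz; have Ez := subset_closure Dz; have h := proj1 (rho_D z Ez) Dz.
  have [N HN] := eta_small Tdec (e := - rho z) ltac:(lra).
  by exists N; have := HN N (leqnn _); lra.
have Fn k z : closure D z -> vnorm (F k z) <= 1.
  move=> Ez; have [_ _ low _ _] := FP k; have := low z Ez; have [_ h] := q01 z Ez; have [h1 _] := x01 k.
  rewrite /phi /= => h2; have := vnorm_ge0 (F k z); clear -h h1 h2; nra.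
have eta1 k : eta k <= / 16.
  have [_ h] := eta_x k; have [h1 h2] := x01 k; have : x k * x k <= 1 by [clear -h1 h2; nra]; clear -h u01; nra.
have f_close k z : sublevel D rho (T k) z ->
    Rabs (vnorm (f z) * vnorm (f z) - vnorm (F k z) * vnorm (F k z)) <= 8 * eta k.
  move=> Kz; have [_ h] := f_lim k z Kz; have h1 := Fn k z (proj1 Kz).
  have /Rabs_le_between h2 := vnorm_dist (f z) (F k z).
  have := vnorm_ge0 (f z); have := vnorm_ge0 (F k z); have := eta1 k; have [h3 _] := eta_x k.
  by move=> h4 h5 h6; apply: Rabs_le; clear -h h1 h2 h3 h4 h5 h6; split; nra.
exists f, T, (fun k => u * x k / 2); split.
- move=> z Dz; have [k hk] := level z Dz.
  have Ez := subset_closure Dz.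
  have [r1 [r10 Hr1]] := D_open z Dz.
  have [r2 [r20 Hr2]] := rho_ct z Ez (- T k - rho z) ltac:(lra).
  have [[_ hol] _ _ _ _] := FP k.
  apply: (@limit_cderiv _ _ F G f (sublevel D rho (T k)) eta k z (Rmin r1 r2) eta_dec) => //.
  + by move=> j; case: (GP j).
  + exact: Rmin_pos.
  + move=> w hw; have Ew : closure D w.
      by apply: subset_closure; apply: Hr1; apply: Rlt_le_trans hw (Rmin_l _ _).
    split=> //; have /Rabs_def2 := Hr2 w Ew (Rlt_le_trans _ _ _ hw (Rmin_r _ _)); lra.
  + move=> l kl; have [_ _ sm _ _] := GP l => w Kw; have [h1 [L [cL bL qL]]] := sm w (sub_le k l kl w Kw).
    split=> //; exists L; split=> // v Kv; apply: qL; exact: sub_le Kv.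
  + by move=> w Kw; case: (f_lim k w Kw).
- move=> z Dz; have [k hk] := level z Dz; have Ez := subset_closure Dz.
  have Kz : sublevel D rho (T k) z by split=> //; lra.
  have /Rabs_le_between := f_close k z Kz; have [_ _ low _ _] := FP k; have := low z Ez.
  rewrite /phi /=; have [h1 h2] := eta_x k; have [h3 h4] := x01 k.
  have : x k * x k <= x k by clear -h3 h4; nra.
  clear -h1 h2 h3 u01; nra.
- move=> e e0.
  have [N HN] : exists N, forall k, (N <= k)%nat -> 2 * y k + eta k + 8 * eta k.+1 < e.
    have [N1 H1] := eta_small eta_dec (e := e / 36) ltac:(lra).
    have [N2 H2] := exists_inv_lt (e := e / (4 * INR B)) ltac:(apply: Rdiv_lt_0_compat; lra).
    exists (maxn N1 N2) => k; rewrite geq_max => /andP[k1 k2].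
    have h1 := H1 k k1; have h2 := H1 k.+1 (leq_trans k1 (leqnSn _)); have h3 := H2 k k2.
    have : 2 * y k < e / 2.
      have -> : e / 2 = 2 * INR B * (e / (4 * INR B)) by field; lra.
      apply: (@Rle_lt_trans _ (2 * INR B * / (INR k + 1))); last by apply: Rmult_lt_compat_l; lra.
      have -> : 2 * y k = 2 * INR B * / (INR k + INR B) by rewrite /y /Rdiv; ring.
      apply: Rmult_le_compat_l; first lra.
      by apply: Rinv_le_contravar; have := pos_INR k; lra.
    lra.
  exists (T N); split=> // z Dz hz; have Ez := subset_closure Dz.
  have [k [Nk [hk1 hk2]]] : exists k, (N <= k)%nat /\ - T k <= rho z /\ rho z <= - T k.+1.
    have [l hl] := level z Dz.
    have [j hj] : exists j, rho z <= - T (N + j)%nat.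
      by exists l; have := Tle l (N + l)%nat (leq_addl _ _); lra.
    elim: j hj => [|j IH] hj; first by rewrite addn0 in hj; lra.
    have [h|h] := Rle_lt_dec (rho z) (- T (N + j)%nat); first exact: IH.
    by exists (N + j)%nat; rewrite leq_addr -addnS; do !split=> //; lra.
  have Kz : sublevel D rho (T k.+1) z by split.
  have /Rabs_le_between := f_close _ z Kz; have [_ _ _ _ up] := FP k; have := up z Ez hk1.
  have [FS _ _ chg _] := GP k; have := chg z Ez; rewrite -FS /phi /=; have := HN k Nk; lra.
- split; first by move=> k; have := T0 k.+1; have := Tdec k; lra.
  split; first by move=> k; have [h _] := x01 k; apply: Rdiv_ge0; [apply: Rmult_le_pos; lra | lra].
  move=> m1 B'.
  have lb l : u / 2 * (ln (INR (m1 + l) + INR A) - ln (INR m1 + INR A)) <= \sum_(i < l) (u * x (m1 + i)%nat / 2).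
    elim: l => [|l IH]; first by rewrite big_ord0 addn0; lra.
    rewrite big_ord_recr /= addnS S_INR.
    have p0 := pos_INR (m1 + l).
    set w := INR (m1 + l) + INR A in IH *; have w0 : 0 < w by rewrite /w; lra.
    have -> : INR (m1 + l) + 1 + INR A = w + 1 by rewrite /w; ring.
    have : ln (w + 1) - ln w <= / w.
      have -> : w + 1 = w * (1 + / w) by field; lra.
      have i0 := Rinv_0_lt_compat _ w0.
      rewrite ln_mult //; last lra.
      have : ln (1 + / w) <= / w.
        by rewrite -[X in _ <= X]ln_exp; apply: ln_le; [lra | exact: exp_ineq1_le].
      lra.
    have -> : x (m1 + l)%nat = / w by [].
    move=> hd; have h := Rmult_le_compat_l (u / 2) _ _ ltac:(lra) hd.
    by apply: Rle_trans (Rplus_le_compat_r _ _ _ IH); lra.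
  pose Z := exp (2 * B' / u + ln (INR m1 + INR A)).
  have [l hl] := INR_unbounded Z.
  exists l; apply: Rlt_le_trans (lb l).
  have H : 2 * B' / u < ln (INR (m1 + l) + INR A) - ln (INR m1 + INR A).
    have -> : 2 * B' / u = ln Z - ln (INR m1 + INR A) by rewrite /Z ln_exp; ring.
    have : ln Z < ln (INR (m1 + l) + INR A); last lra.
    apply: ln_increasing; first exact: exp_pos.
    by rewrite plus_INR; have := pos_INR m1; lra.
  have -> : B' = u / 2 * (2 * B' / u) by field; lra.
  by apply: Rmult_lt_compat_l; lra.
- move=> k gam a b ab ct Kg ra rb.
  have [_ _ _ _ cross] := GP k.
  have [tau ht h] := cross gam a b ab ct (fun tau ht => proj1 (Kg tau ht)) ra ltac:(lra).
  exists tau => //.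
  have [_ h1] := f_lim k.+1 _ (Kg tau ht).
  have [_ h2] := f_lim k.+1 _ (Kg b ltac:(lra)).
  have h3 := vdist_triangle (F k.+1 (gam tau)) (f (gam tau)) (F k.+1 (gam b)).
  have h4 := vdist_triangle (f (gam tau)) (f (gam b)) (F k.+1 (gam b)).
  rewrite (vdist_sym (F k.+1 (gam tau)) (f (gam tau))) in h3.
  have h5 := eta_dec k; have [h6 h7] := eta_x k; have [h8 h9] := x01 k.
  have : eta k <= u * x k / 8.
    by apply: Rle_trans h7 _; clear -h8 h9 u01; have : x k * x k <= x k by [nra]; nra.
  lra.
Qed.

(** * Lengths of paths *)

(* [length_le F g L] amounts to the existence of such a [V] with [V 1 - V 0 <= L]; unlike
   partitions, potentials restrict to subintervals and concatenate easily. *)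
Definition length_potential {n m} (F : Cn n -> Cn m) (g : R -> Cn n) (V : R -> R) a b : Prop :=
  forall s t, a <= s -> s <= t -> t <= b -> vdist (F (g s)) (F (g t)) <= V t - V s.

Lemma length_le_of_potential {n m} (F : Cn n -> Cn m) g V L :
  length_potential F g V 0 1 -> V 1 - V 0 <= L -> length_le F g L.
Proof.
move=> H HL k t t0 tk mono; apply: Rle_trans HL.
have lo i : (i <= k)%nat -> 0 <= t i.
  elim: i => [|i IH] hi; first lra.
  by have := mono i hi; have := IH (ltnW hi); lra.
have hi i : (i <= k)%nat -> t i <= 1.
  move=> ik; rewrite -(subKn ik); elim: (k - i)%nat (leq_subr i k) => [|j IH] hj; first by rewrite subn0; lra.
  have := IH (ltnW hj); have := mono (k - j.+1)%nat; rewrite ltn_subrL /= -subSn // subSS => h.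
  by have := h (leq_ltn_trans (leq0n j) hj); lra.
have H1 l : (l <= k)%nat -> \sum_(i < l) vdist (F (g (t i.+1))) (F (g (t i))) <= V (t l) - V (t 0%nat).
  elim: l => [|l IH] hl; first by rewrite big_ord0; lra.
  rewrite big_ord_recr /=; apply: Rle_trans (Rplus_le_compat_r _ _ _ (IH (ltnW hl))) _.
  have := H (t l) (t l.+1) (lo l (ltnW hl)) (mono l hl) (hi l.+1 hl); rewrite vdist_sym; lra.
by have := H1 k (leqnn k); rewrite t0 tk.
Qed.

Lemma potential_of_length_le {n m} (F : Cn n -> Cn m) g L : length_le F g L ->
  exists V, length_potential F g V 0 1 /\ V 0 = 0 /\ V 1 <= L.
Proof.
move=> H.
pose S t r := exists (k : nat) (p : nat -> R), [/\ p 0%nat = 0, p k = t,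
   forall i, (i < k)%nat -> p i <= p i.+1 & r = \sum_(i < k) vdist (F (g (p i.+1))) (F (g (p i)))].
have ext s t r : s <= t -> S s r -> S t (r + vdist (F (g s)) (F (g t))).
  move=> st [k [p [p0 pk mono ->]]].
  exists k.+1, (fun i => if (i <= k)%nat then p i else t); split=> //=.
  - by rewrite ltnn.
  - move=> i; rewrite ltnS => ik; rewrite ik; case: ltngtP ik => // [h _|-> _]; first exact: mono.
    by rewrite pk.
  - rewrite big_ord_recr /= leqnn ltnn pk vdist_sym; congr Rplus.
    by apply: eq_bigr => i _; rewrite ltn_ord ltnW.
have bd r : S 1 r -> r <= L by move=> [k [p [p0 pk mono ->]]]; exact: H.
have S00 : S 0 0.
  by exists 0%nat, (fun=> 0); split=> //; rewrite big_ord0.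
have ne t : 0 <= t -> S t (0 + vdist (F (g 0)) (F (g t))) by move=> h; exact: ext S00.
pose V t := epsilon (inhabits 0) (is_lub (S t)).
have VP t : 0 <= t <= 1 -> is_lub (S t) (V t).
  move=> ht; apply: epsilon_spec.
  have [||l Hl] := completeness (S t); last by exists l.
    exists L => r Sr; have := bd _ (ext t 1 r ltac:(lra) Sr); have := vdist_ge0 (F (g t)) (F (g 1)); lra.
  by eexists; apply: ne; lra.
have VV s t : 0 <= s -> s <= t -> t <= 1 -> vdist (F (g s)) (F (g t)) <= V t - V s.
  move=> s0 st t1.
  have : V s <= V t - vdist (F (g s)) (F (g t)); last lra.
  apply: (proj2 (VP s ltac:(lra))) => r Sr.
  by have := proj1 (VP t ltac:(lra)) _ (ext s t r st Sr); lra.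
exists (fun t => V t - V 0); split; [|split; first ring].
  by move=> s t s0 st t1; have := VV s t s0 st t1; lra.
have h0 : 0 <= V 0 by apply: (proj1 (VP 0 ltac:(lra))).
have h1 : V 1 <= L by apply: (proj2 (VP 1 ltac:(lra))) => r; exact: bd.
lra.
Qed.

Lemma path_cont_glue {n} (g : R -> Cn n) a b c : path_cont g a b -> path_cont g b c -> path_cont g a c.
Proof.
move=> H1 H2 t ht e e0.
have [tb|tb] := Rle_lt_dec t b; last first.
  have [d [d0 Hd]] := H2 t ltac:(lra) e e0.
  exists (Rmin d (t - b)); split; first by apply: Rmin_pos; lra.
  move=> s hs h; have h1 := Rlt_le_trans _ _ _ h (Rmin_l _ _); have /Rabs_def2 h2 := Rlt_le_trans _ _ _ h (Rmin_r _ _).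
  by apply: Hd => //; lra.
have [d1 [d10 Hd1]] := H1 t ltac:(lra) e e0.
have [tb'|tb'] := Req_dec t b; last first.
  exists (Rmin d1 (b - t)); split; first by apply: Rmin_pos; lra.
  move=> s hs h; have h1 := Rlt_le_trans _ _ _ h (Rmin_l _ _); have /Rabs_def2 h2 := Rlt_le_trans _ _ _ h (Rmin_r _ _).
  by apply: Hd1 => //; lra.
have [d2 [d20 Hd2]] := H2 t ltac:(lra) e e0.
exists (Rmin d1 d2); split; first exact: Rmin_pos.
move=> s hs h; have h1 := Rlt_le_trans _ _ _ h (Rmin_l _ _); have h2 := Rlt_le_trans _ _ _ h (Rmin_r _ _).
by have [sb|sb] := Rle_lt_dec s b; [apply: Hd1 => //; lra | apply: Hd2 => //; lra].
Qed.

Lemma potential_glue {n m} (F : Cn n -> Cn m) g V a b c :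
  length_potential F g V a b -> length_potential F g V b c -> length_potential F g V a c.
Proof.
move=> H1 H2 s t h1 h2 h3.
have [tb|tb] := Rle_lt_dec t b; first exact: H1.
have [sb|sb] := Rle_lt_dec b s; first by apply: H2.
have := H1 s b h1 ltac:(lra) ltac:(lra); have := H2 b t ltac:(lra) ltac:(lra) h3.
by have := vdist_triangle (F (g s)) (F (g b)) (F (g t)); lra.
Qed.

Section Concatenation.
Context {n m : nat} (D : Cn n -> Prop) (F : Cn n -> Cn m) (z : nat -> Cn n) (y : Cn n)
  (g : nat -> R -> Cn n) (V : nat -> R -> R) (e : R).
Hypothesis path_g : forall j, path_in D (g j) (z j) (z j.+1).
Hypothesis V_pot : forall j, length_potential F (g j) (V j) 0 1.
Hypothesis V0 : forall j, V j 0 = 0.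
Hypothesis V1 : forall j, V j 1 <= e * (/ 2) ^ j.+1.
Hypothesis e0 : 0 < e.
Hypothesis Dy : D y.
Hypothesis zy : vcvg (fun j => F (z j)) (F y).
Hypothesis F_inv : forall e, 0 < e -> exists d, 0 < d /\
     forall w, D w -> vdist (F w) (F y) < d -> vdist w y < e.

Let fl (t : R) : nat := epsilon (inhabits 0%nat) (fun j => INR j <= t < INR j + 1).
Let flP t : 0 <= t -> INR (fl t) <= t < INR (fl t) + 1.
Proof. by move=> t0; have [j hj] := nfloor_ex _ t0; exact: (epsilon_spec _ (fun j : nat => INR j <= t < INR j + 1) (ex_intro _ j hj)). Qed.

Let gam t := g (fl t) (t - INR (fl t)).
Let W t := \sum_(i < fl t) V i 1 + V (fl t) (t - INR (fl t)).

Let fl_piece j t : INR j <= t <= INR j + 1 -> fl t = j \/ (fl t = j.+1 /\ t = INR j + 1).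
Proof.
move=> ht; have t0 : 0 <= t by have := pos_INR j; lra.
have := flP t0; set k := fl t => hk.
have h1 : (k <= j.+1)%coq_nat by apply: INR_le; rewrite S_INR; lra.
have h2 : (j < k.+1)%coq_nat by apply: INR_lt; rewrite S_INR; lra.
have [E|E] : k = j \/ k = j.+1 by lia.
  by left.
by right; split=> //; rewrite E S_INR in hk; lra.
Qed.

Let gam_piece j t : INR j <= t <= INR j + 1 -> gam t = g j (t - INR j).
Proof.
move=> ht; rewrite /gam; case: (fl_piece ht) => [->//|[-> E]].
rewrite E S_INR; have -> : INR j + 1 - (INR j + 1) = 0 by ring.
have -> : INR j + 1 - INR j = 1 by ring.
by have [-> _] := path_g j.+1; have [_ [-> _]] := path_g j.
Qed.

Let W_piece j t : INR j <= t <= INR j + 1 -> W t = \sum_(i < j) V i 1 + V j (t - INR j).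
Proof.
move=> ht; rewrite /W; case: (fl_piece ht) => [->//|[-> E]].
rewrite E S_INR big_ord_recr /=; have -> : INR j + 1 - (INR j + 1) = 0 by ring.
have -> : INR j + 1 - INR j = 1 by ring.
by rewrite V0 Rplus_0_r.
Qed.

Let gam_cont j : path_cont gam 0 (INR j).
Proof.
elim: j => [|j IH].
  move=> t /= ht d d0; exists 1; split; first lra.
  by move=> s hs _; have -> : s = t by [lra]; rewrite vdist_refl.
apply: path_cont_glue IH _ => t; rewrite S_INR => ht d d0.
have [_ [_ [_ ct]]] := path_g j.
have [r [r0 Hr]] := ct (t - INR j) ltac:(lra) d d0; exists r; split=> // s hs h.
rewrite !(@gam_piece j) //; apply: Hr; first lra.
by have -> : s - INR j - (t - INR j) = s - t by ring.
Qed.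

Let gam_pot j : length_potential F gam W 0 (INR j).
Proof.
elim: j => [|j IH].
  move=> s t h1 h2 /= h3; have -> : s = t by lra.
  by rewrite vdist_refl; lra.
apply: potential_glue IH _ => s t; rewrite S_INR => h1 h2 h3.
rewrite !(@gam_piece j) ?(@W_piece j) //; try lra.
by have := @V_pot j (s - INR j) (t - INR j) ltac:(lra) ltac:(lra) ltac:(lra); lra.
Qed.

Let gam_D t : 0 <= t -> D (gam t).
Proof.
move=> t0; have h := flP t0; rewrite (@gam_piece (fl t)); last lra.
by have [_ [_ [H _]]] := path_g (fl t); apply: H; lra.
Qed.

Let W_int j : W (INR j) <= e * (1 - (/ 2) ^ j).
Proof.
elim: j => [|j IH].
  rewrite (@W_piece 0) /=; last lra.
  by rewrite big_ord0 Rminus_diag V0; lra.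
rewrite (@W_piece j) ?S_INR; last lra.
rewrite (@W_piece j) in IH; last by have := pos_INR j; lra.
have -> : INR j + 1 - INR j = 1 by ring.
rewrite Rminus_diag V0 Rplus_0_r in IH.
by have := V1 j; rewrite /= in IH *; lra.
Qed.

Let gam_int j : gam (INR j) = z j.
Proof.
rewrite (@gam_piece j); last by have := pos_INR j; lra.
by rewrite Rminus_diag; have [-> _] := path_g j.
Qed.

Let pow0 j : 0 < (/ 2) ^ j.
Proof. by apply: pow_lt; lra. Qed.

Let gam_tail t : 0 <= t -> vdist (F (gam t)) (F y) <= e - W t.
Proof.
move=> t0; rewrite vdist_sym.
have [N HN] := INR_unbounded t.
apply: (@vcvg_eventually_le _ _ _ _ _ N zy) => j /leP/le_INR Nj.
have := @gam_pot j t (INR j) t0 ltac:(lra) ltac:(lra); rewrite gam_int vdist_sym.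
by have := W_int j; have := pow0 j; nra.
Qed.

Let gam_lim r : 0 < r -> exists N : nat, forall t, INR N <= t -> vdist (gam t) y < r.
Proof.
move=> r0; have [d [d0 Hd]] := F_inv r0.
have [N1 H1] := zy (e := d / 2) ltac:(lra).
have [N2 H2] := @eta_small (fun j => e * (/ 2) ^ j) (fun k => ltac:(cbv beta; have := pow0 k; rewrite /=; nra)) (d / 2) ltac:(lra).
exists (maxn N1 N2) => t ht.
have t0 : 0 <= t by have := pos_INR (maxn N1 N2); lra.
apply: Hd; first exact: gam_D.
have h := flP t0; set j := fl t in h.
have hj : (maxn N1 N2 <= j)%nat.
  have : (maxn N1 N2 < j.+1)%coq_nat by apply: INR_lt; rewrite S_INR; lra.
  by move=> /leP.
move: hj; rewrite geq_max => /andP[/H1 h1 /H2 h2].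
have := @gam_pot j.+1 (INR j) t (pos_INR j) ltac:(lra) ltac:(rewrite S_INR; lra).
rewrite gam_int => h3.
have h4 : W t - W (INR j) <= e * (/ 2) ^ j.+1.
  have := @gam_pot j.+1 t (INR j + 1) t0 ltac:(lra) ltac:(rewrite S_INR; lra).
  rewrite !(@W_piece j); try lra.
  have -> : INR j + 1 - INR j = 1 by ring.
  rewrite Rminus_diag V0; have := V1 j; have := vdist_ge0 (F (gam t)) (F (gam (INR j + 1))); lra.
have := vdist_triangle (F (gam t)) (F (z j)) (F y); rewrite (vdist_sym (F (gam t)) (F (z j))).
by have := pow0 j; rewrite /= in h4; nra.
Qed.

Lemma infinite_concatenation : Fdist_le D F (z 0%nat) y e.
Proof.
pose sc t := t / (1 - t).
have sc0 t : 0 <= t < 1 -> 0 <= sc t by move=> ht; apply: Rdiv_ge0; lra.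
have sc_le s t : 0 <= s -> s <= t -> t < 1 -> sc s <= sc t.
  move=> h1 h2 h3; have E x : x < 1 -> sc x = / (1 - x) - 1 by move=> hx; rewrite /sc; field; lra.
  rewrite !E; try lra.
  by have := Rinv_le_contravar (1 - t) (1 - s) ltac:(lra) ltac:(lra); lra.
pose G t := if Rlt_dec t 1 then gam (sc t) else y.
pose U t := if Rlt_dec t 1 then W (sc t) else e.
have G1 t : t < 1 -> G t = gam (sc t) by rewrite /G; case: Rlt_dec.
have G2 t : 1 <= t -> G t = y by rewrite /G; case: Rlt_dec => //= h1 h2; lra.
have U1 t : t < 1 -> U t = W (sc t) by rewrite /U; case: Rlt_dec.
have U2 t : 1 <= t -> U t = e by rewrite /U; case: Rlt_dec => //= h1 h2; lra.
have s00 : sc 0 = INR 0 by rewrite /sc /=; field.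
exists G; split.
  split; first by rewrite G1 ?s00 ?gam_int //; lra.
  split; first by rewrite G2 //; lra.
  split.
    move=> t ht; have [h|h] := Rlt_le_dec t 1; last by rewrite G2.
    by rewrite G1 //; apply: gam_D; apply: sc0; lra.
  move=> t ht r r0; have [h|h] := Rlt_le_dec t 1; last first.
    have [N HN] := gam_lim r0.
    have N0 := pos_INR N; exists (/ (INR N + 1)); split; first by apply: Rinv_0_lt_compat; lra.
    move=> s hs; rewrite (G2 t h); have [h1|h1] := Rlt_le_dec s 1; last by rewrite (G2 s h1) vdist_refl.
    rewrite (G1 s h1) => /Rabs_def2 [_ h2]; apply: HN.
    have h3 : 1 - s < / (INR N + 1) by lra.
    apply: (Rmult_le_reg_r (1 - s)); first lra.
    have -> : sc s * (1 - s) = s by rewrite /sc; field; lra.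
    have := Rmult_lt_compat_l (INR N + 1) _ _ ltac:(lra) h3; rewrite Rinv_r; lra.
  have [N HN] := INR_unbounded (sc ((1 + t) / 2)).
  have st : sc t <= sc ((1 + t) / 2) by apply: sc_le; lra.
  have [d [d0 Hd]] := @gam_cont N (sc t) ltac:(split; [apply: sc0; lra | lra]) r r0.
  have d4 : 0 < d * ((1 - t) * (1 - t)) / 2.
    by have := Rmult_lt_0_compat _ _ d0 (Rmult_lt_0_compat (1 - t) (1 - t) ltac:(lra) ltac:(lra)); lra.
  exists (Rmin ((1 - t) / 2) (d * ((1 - t) * (1 - t)) / 2)); split; first by apply: Rmin_pos; lra.
  move=> s hs h1; have /Rabs_def2 h2 := Rlt_le_trans _ _ _ h1 (Rmin_l _ _); have h3 := Rlt_le_trans _ _ _ h1 (Rmin_r _ _).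
  rewrite !G1; try lra.
  have ss : sc s <= sc ((1 + t) / 2) by apply: sc_le; lra.
  apply: Hd; first by split; [apply: sc0; lra | lra].
  have -> : sc s - sc t = (s - t) * / ((1 - s) * (1 - t)) by rewrite /sc; field; lra.
  have p0 : 0 < (1 - s) * (1 - t) by apply: Rmult_lt_0_compat; lra.
  rewrite Rabs_mult (Rabs_right (/ _)); last by apply/Rle_ge/Rlt_le/Rinv_0_lt_compat.
  apply: (Rmult_lt_reg_r ((1 - s) * (1 - t))) => //.
  have -> : Rabs (s - t) * / ((1 - s) * (1 - t)) * ((1 - s) * (1 - t)) = Rabs (s - t) by field; lra.
  apply: Rlt_le_trans h3 _.
  have -> : d * ((1 - t) * (1 - t)) / 2 = d * ((1 - t) / 2 * (1 - t)) by field.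
  by apply: Rmult_le_compat_l; [lra | apply: Rmult_le_compat_r; lra].
apply: (@length_le_of_potential _ _ _ _ U); last first.
  rewrite U2 ?U1; try lra; rewrite s00 (@W_piece 0) /=; last lra.
  by rewrite big_ord0 Rminus_diag V0; lra.
move=> s t s0 st t1.
have [ht|ht] := Rlt_le_dec t 1; last first.
  rewrite (G2 t ht) (U2 t ht); have [hs|hs] := Rlt_le_dec s 1; last by rewrite G2 // U2 // vdist_refl; lra.
  by rewrite G1 // U1 //; apply: gam_tail; apply: sc0; lra.
rewrite !G1 ?U1; try lra.
have [N HN] := INR_unbounded (sc t).
apply: (@gam_pot N); [apply: sc0; lra | exact: sc_le | lra].
Qed.

End Concatenation.

(** * Completeness and properness *)

Definition vcat {a b} (u : Cn a) (v : Cn b) : Cn (a + b) :=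
  fun i => match split i with inl j => u j | inr k => v k end.

Lemma vcat_lshift {a b} (u : Cn a) (v : Cn b) i : vcat u v (lshift b i) = u i.
Proof. by rewrite /vcat; case: split_ordP => j /eqP; rewrite ?eq_lshift ?eq_lrshift // => /eqP ->. Qed.

Lemma vcat_rshift {a b} (u : Cn a) (v : Cn b) i : vcat u v (rshift a i) = v i.
Proof. by rewrite /vcat; case: split_ordP => j /eqP; rewrite ?eq_rshift ?eq_rlshift // => /eqP ->. Qed.

Lemma vnorm_vcat {a b} (u : Cn a) (v : Cn b) :
  vnorm (vcat u v) * vnorm (vcat u v) = vnorm u * vnorm u + vnorm v * vnorm v.
Proof.
rewrite !vnorm_sqr big_split_ord /=; congr Rplus; apply: eq_bigr => i _.
  by rewrite vcat_lshift.
by rewrite vcat_rshift.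
Qed.

Lemma vcat_add {a b} (u u' : Cn a) (v v' : Cn b) :
  vadd (vcat u v) (vcat u' v') = vcat (vadd u u') (vadd v v').
Proof. by apply: functional_extensionality => i; rewrite /vcat /vadd; case: split. Qed.
Lemma vcat_sub {a b} (u u' : Cn a) (v v' : Cn b) :
  vsub (vcat u v) (vcat u' v') = vcat (vsub u u') (vsub v v').
Proof. by apply: functional_extensionality => i; rewrite /vcat /vsub; case: split. Qed.
Lemma vcat_scal {a b} r (u : Cn a) (v : Cn b) : vscal r (vcat u v) = vcat (vscal r u) (vscal r v).
Proof. by apply: functional_extensionality => i; rewrite /vcat /vscal; case: split. Qed.

Lemma vnorm_vcat_le {a b} (u : Cn a) (v : Cn b) : vnorm (vcat u v) <= vnorm u + vnorm v.
Proof.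
have h1 := vnorm_ge0 u; have h2 := vnorm_ge0 v; apply: Rsqr_incr_0_var; last lra.
rewrite /Rsqr vnorm_vcat; nra.
Qed.

Lemma vnorm_le_vcat {a b} (u : Cn a) (v : Cn b) : vnorm u <= vnorm (vcat u v).
Proof.
apply: Rsqr_incr_0_var; last exact: vnorm_ge0.
rewrite /Rsqr vnorm_vcat; have := Rle_0_sqr (vnorm v); rewrite /Rsqr; lra.
Qed.

Lemma cderiv_vjoin {n a b} (f : Cn n -> Cn a) (h : Cn n -> Cn b) z L M :
  is_cderiv f z L -> is_cderiv h z M -> is_cderiv (vjoin f h) z (fun v => vcat (L v) (M v)).
Proof.
move=> [[[a1 r1] i1] [_ H1]] [[[a2 r2] i2] [_ H2]].
have rl : rlinear (fun v => vcat (L v) (M v)).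
  by split=> [u v|r u]; rewrite ?a1 ?a2 ?r1 ?r2 ?vcat_add ?vcat_scal.
split; first by split=> // u; rewrite i1 i2 vcat_scal.
split=> // e e0.
have [d1 [d10 h1]] := H1 (e / 2) ltac:(lra); have [d2 [d20 h2]] := H2 (e / 2) ltac:(lra).
exists (Rmin d1 d2); split; first exact: Rmin_pos.
move=> v hv; have := h1 v (Rlt_le_trans _ _ _ hv (Rmin_l _ _)); have := h2 v (Rlt_le_trans _ _ _ hv (Rmin_r _ _)).
rewrite -!/(vcat _ _) !vcat_sub => q1 q2.
by apply: Rle_trans (vnorm_vcat_le _ _) _; lra.
Qed.

Lemma path_cont_sub {n} (g : R -> Cn n) a b a' b' : a <= a' -> b' <= b -> path_cont g a b -> path_cont g a' b'.
Proof.
move=> h1 h2 H t ht e e0; have [d [d0 Hd]] := H t ltac:(lra) e e0.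
by exists d; split=> // s hs; apply: Hd; lra.
Qed.

Section Crossing.
Context {n m : nat} (D : Cn n -> Prop) (rho : Cn n -> R) (F : Cn n -> Cn m) (T ell : nat -> R).
Hypothesis rho_ct : cont_fun_on (closure D) rho.
Hypothesis T_dec : forall k, 0 < T k.+1 <= T k / 2.
Hypothesis cross : forall k gam a b, a <= b -> path_cont gam a b ->
  (forall tau, a <= tau <= b -> sublevel D rho (T k.+1) (gam tau)) ->
  rho (gam a) <= - T k -> rho (gam b) = - T k.+1 ->
  exists2 tau, a <= tau <= b & ell k <= vdist (F (gam tau)) (F (gam b)).
Context (g : R -> Cn n) (V : R -> R).
Hypothesis g_ct : path_cont g 0 1.
Hypothesis g_D : forall t, 0 <= t <= 1 -> D (g t).
Hypothesis V_pot : length_potential F g V 0 1.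

Lemma first_level_hit v b : 0 <= b <= 1 -> rho (g 0) <= v <= rho (g b) ->
  exists t, [/\ 0 <= t <= b, rho (g t) = v & forall s, 0 <= s <= t -> rho (g s) <= v].
Proof.
move=> hb; apply: first_hit; first lra.
move=> t ht e e0.
have [d [d0 Hd]] := rho_ct (subset_closure (@g_D t ltac:(lra))) e0.
have [r [r0 Hr]] := @g_ct t ltac:(lra) d d0.
exists r; split=> // s hs h; apply: Hd; first by apply/subset_closure/g_D; lra.
by apply: Hr => //; lra.
Qed.

Lemma T_le k l : (k <= l)%nat -> T l <= T k.
Proof. by apply: (@eta_le T) => j; have := T_dec j; lra. Qed.

Lemma crossing_length k l b : 0 <= b <= 1 -> rho (g 0) <= - T k ->
  (forall s, 0 <= s <= b -> rho (g s) <= - T (k + l)%nat) -> rho (g b) = - T (k + l)%nat ->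
  \sum_(i < l) ell (k + i)%nat <= V b - V 0.
Proof.
elim: l b => [|l IH] b hb g0 below gb.
  rewrite big_ord0; have := V_pot (s := 0) (t := b) ltac:(lra) ltac:(lra) ltac:(lra).
  have := vdist_ge0 (F (g 0)) (F (g b)); lra.
have h1 := T_le (leq_addr l k); have h2 := T_dec (k + l)%nat.
rewrite addnS in below gb.
have [t [ht gt below_t]] := @first_level_hit (- T (k + l)%nat) b hb ltac:(lra).
have := IH t ltac:(lra) g0 below_t gt.
rewrite big_ord_recr /= => h3.
have Kg r : t <= r <= b -> sublevel D rho (T (k + l).+1) (g r).
  move=> hr; split; first by apply/subset_closure/g_D; lra.
  by apply: below; lra.
have ct : path_cont g t b by apply: path_cont_sub g_ct; lra.
have [tau htau h4] := @cross (k + l)%nat g t b ltac:(lra) ct Kg (Req_le _ _ gt) gb.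
have h5 := V_pot (s := tau) (t := b) ltac:(lra) ltac:(lra) ltac:(lra).
have h6 := V_pot (s := t) (t := tau) ltac:(lra) ltac:(lra) ltac:(lra).
have h7 := vdist_ge0 (F (g t)) (F (g tau)).
apply: Rle_trans (Rplus_le_compat_r _ _ _ h3) _; lra.
Qed.

Lemma short_path_stays k l : rho (g 0) <= - T k -> V 1 - V 0 < \sum_(i < l) ell (k + i)%nat ->
  rho (g 1) <= - T (k + l)%nat.
Proof.
move=> g0 short; apply: Rnot_lt_le => h.
have h1 := T_le (leq_addr l k).
have [t [ht gt below]] := @first_level_hit (- T (k + l)%nat) 1 ltac:(lra) ltac:(lra).
have := @crossing_length k l t ltac:(lra) g0 below gt.
have := V_pot (s := t) (t := 1) ltac:(lra) ltac:(lra) ltac:(lra); have := vdist_ge0 (F (g t)) (F (g 1)).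
move=> h2 h3 h4; apply: (Rlt_irrefl (V 1 - V 0)).
by apply: Rlt_le_trans short _; apply: Rle_trans h4 _; lra.
Qed.

End Crossing.

Lemma complete_of_crossing {n m} (D : Cn n -> Prop) rho (F : Cn n -> Cn m) (T ell : nat -> R) :
  bounded_set D -> cont_fun_on (closure D) rho -> (forall z, closure D z -> (D z <-> rho z < 0)) ->
  (forall k, 0 < T k.+1 <= T k / 2) ->
  (forall k B, exists l, B < \sum_(i < l) ell (k + i)%nat) ->
  (forall k gam a b, a <= b -> path_cont gam a b ->
    (forall tau, a <= tau <= b -> sublevel D rho (T k.+1) (gam tau)) ->
    rho (gam a) <= - T k -> rho (gam b) = - T k.+1 ->
    exists2 tau, a <= tau <= b & ell k <= vdist (F (gam tau)) (F (gam b))) ->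
  holo_embedding_on D F -> complete_on D F.
Proof.
move=> D_bd rho_ct rho_D T_dec ell_div cross [hol [_ [_ emb]]] x Dx cauchy.
have E_bd := closure_bounded D_bd; have E_cl := @closure_closed _ D.
have Tpos k : 0 <= T k.+1 <= T k / 2 by have := T_dec k; lra.
have [N0 H0] := cauchy 1 ltac:(lra).
have rx := proj1 (rho_D _ (subset_closure (Dx N0))) (Dx N0).
have [k0 hk0] := eta_small Tpos (e := - rho (x N0)) ltac:(lra).
have [l hl] := ell_div k0 1.
have stay j : (N0 <= j)%nat -> rho (x j) <= - T (k0 + l)%nat.
  move=> hj; have [g [[g0 [g1 [gD gct]]] len]] := H0 N0 j (leqnn _) hj.
  have [V [pot [V0 V1]]] := potential_of_length_le len.
  rewrite -g1; apply: (short_path_stays rho_ct T_dec cross gct gD pot).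
    by rewrite g0; have := hk0 k0 (leqnn _); lra.
  by apply: Rle_lt_trans hl; lra.
have tp : 0 < T (k0 + l)%nat by have := T_dec (k0 + l)%nat; lra.
have [phi [y [ex [cy Ey]]]] := compact_subseq E_bd E_cl (fun j => subset_closure (Dx (N0 + j)%nat)).
have Dy : D y.
  apply/(rho_D y Ey).
  have lim := lim_cont_fun rho_ct (fun j => subset_closure (Dx (N0 + phi j)%nat)) Ey cy.
  have := is_lim_seq_le _ _ (Rbar.Finite _) (Rbar.Finite _) (fun j => stay (N0 + phi j)%nat (leq_addr _ _)) lim (is_lim_seq_const _).
  by rewrite /=; lra.
have Fct := holomorphic_vcvg hol.
have Fd a b L : Fdist_le D F a b L -> vdist (F a) (F b) <= L.
  move=> [g [[g0 [g1 _]] len]]; have [V [pot [V0 V1]]] := potential_of_length_le len.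
  have := pot 0 1 ltac:(lra) ltac:(lra) ltac:(lra); rewrite g0 g1; lra.
have Fcvg : vcvg (fun j => F (x j)) (F y).
  move=> e e0; have [N1 H1] := cauchy (e / 2) ltac:(lra).
  have [N2 H2] := Fct y Dy _ cy (e / 2) ltac:(lra).
  exists N1 => j hj; pose i := maxn N1 N2.
  have h1 : (N1 <= N0 + phi i)%nat.
    by apply: leq_trans (leq_maxl N1 N2) _; apply: leq_trans (extraction_ge ex _) (leq_addl _ _).
  have := Fd _ _ _ (H1 j _ hj h1); have := H2 i (leq_maxr _ _).
  by have := vdist_triangle (F (x j)) (F (x (N0 + phi i)%nat)) (F y); lra.
exists y; split=> // e e0.
have P (j : nat) : exists N, forall i k, (N <= i)%nat -> (N <= k)%nat -> Fdist_le D F (x i) (x k) (e * (/ 2) ^ j.+1).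
  by apply: cauchy; apply: Rmult_lt_0_compat => //; apply: pow_lt; lra.
have [N NP] := choice_fun P.
exists (N 0%nat) => k hk.
pose M := fix M j := match j with O => k | S i => (M i + N i + N i.+1).+1 end.
have MN j : (N j <= M j)%nat.
  by case: j => [|j] //=; apply: leqW; exact: leq_addl.
have MN' j : (N j <= M j.+1)%nat by rewrite /=; apply: leqW; rewrite addnAC; exact: leq_addl.
have Mj j : (j <= M j)%nat.
  by elim: j => // j IH /=; rewrite ltnS -addnA; apply: leq_trans IH (leq_addr _ _).
have Q j : exists gV : (R -> Cn n) * (R -> R), [/\ path_in D gV.1 (x (M j)) (x (M j.+1)),
    length_potential F gV.1 gV.2 0 1, gV.2 0 = 0 & gV.2 1 <= e * (/ 2) ^ j.+1].
  have [g [pg len]] := NP j (M j) (M j.+1) (MN j) (MN' j).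
  by have [V [pot [V0 V1]]] := potential_of_length_le len; exists (g, V).
have [gV gVP] := choice_fun Q.
apply: (@infinite_concatenation _ _ D F (fun j => x (M j)) y (fun j => (gV j).1) (fun j => (gV j).2) e) => //.
- by move=> j; case: (gVP j).
- by move=> j; case: (gVP j).
- by move=> j; case: (gVP j).
- by move=> j; case: (gVP j).
- move=> r r0; have [N1 H1] := Fcvg r r0; exists N1 => j hj; apply: H1; exact: leq_trans hj (Mj j).
- exact: emb.
Qed.

Theorem theorem1p1 (n : nat) (D : Cn n -> Prop) :
  bounded_set D -> strictly_convex_C2_domain D ->
  exists s : nat, (0 < s)%nat /\
    forall (p : nat), (0 < p)%nat -> forall h : Cn n -> Cn p,
      cont_on (closure D) h ->
      (forall z, closure D z -> unit_ball p (h z)) ->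
      holomorphic_on D h -> immersion_on D h -> injective_on D h ->
      exists f : Cn n -> Cn (2 * s)%nat,
        holomorphic_on D f /\
        (forall z, D z -> unit_ball (2 * s + p)%nat (vjoin f h z)) /\
        holo_embedding_on D (vjoin f h) /\
        proper_into D (unit_ball (2 * s + p)%nat) (vjoin f h) /\
        complete_on D (vjoin f h).
Proof.
move=> D_bd D_conv.
have D_open : open_set D by case: D_conv => -[].
have [rho [nu [Lam [c [Q pk]]]]] := strictly_convex_peak_data D_bd D_conv.
have [_ rho_ct rho_D rho_le _] := pk.
have [s [s0 push]] := push_limit D_bd D_open pk.
exists s; split=> // p p0 h h_ct h_ball h_hol h_imm h_inj.
have E_bd := closure_bounded D_bd; have E_cl := @closure_closed _ D.
pose q z := 1 - vnorm (h z) * vnorm (h z).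
have q_ct : cont_fun_on (closure D) q.
  move=> z Ez e e0; have [d [d0 Hd]] := cont_normsq h_ct Ez e0; exists d; split=> // w Ew hw.
  have -> : q w - q z = - (vnorm (h w) * vnorm (h w) - vnorm (h z) * vnorm (h z)) by rewrite /q; ring.
  by rewrite Rabs_Ropp; exact: Hd.
have q01 z : closure D z -> 0 < q z <= 1.
  move=> Ez; have := h_ball z Ez; rewrite /unit_ball /q; have := vnorm_ge0 (h z); nra.
have [f [T [ell [f_hol f_lt f_bd [T_dec [_ ell_div]] cross]]]] := push q q_ct q01.
exists f; split=> //.
set F := vjoin f h.
have FE z : F z = vcat (f z) (h z) by [].
have Fnorm z : vnorm (F z) * vnorm (F z) = 1 - (q z - vnorm (f z) * vnorm (f z)).
  by rewrite FE vnorm_vcat /q; ring.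
have F_hol : holomorphic_on D F.
  move=> z Dz; have [L HL] := f_hol z Dz; have [M HM] := h_hol z Dz.
  by exists (fun v => vcat (L v) (M v)); exact: cderiv_vjoin.
have F_ball z : D z -> unit_ball (2 * s + p)%nat (F z).
  move=> Dz; rewrite /unit_ball; have := f_lt z Dz; have := Fnorm z; have := vnorm_ge0 (F z); nra.
have Fct := holomorphic_vcvg F_hol.
have inside x z w : (forall k, D (x k)) -> closure D z -> vcvg x z -> vcvg (fun k => F (x k)) w ->
    vnorm w < 1 -> D z.
  move=> Dx Ez cx cF w1; apply/(rho_D z Ez); apply: Rnot_le_lt => hz.
  have rz : rho z = 0 by have := rho_le z Ez; lra.
  have w0 := vnorm_ge0 w.
  have [t [t0 Ht]] := f_bd ((1 - vnorm w) / 2) ltac:(lra).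
  have [d [d0 Hd]] := rho_ct z Ez t t0.
  have [N1 H1] := cx d d0; have [N2 H2] := cF ((1 - vnorm w) / 4) ltac:(lra).
  pose k := maxn N1 N2.
  have /Rabs_def2 h1 := Hd _ (subset_closure (Dx k)) (H1 k (leq_maxl _ _)).
  have := Ht _ (Dx k) ltac:(lra); have := Fnorm (x k).
  have /Rabs_le_between h2 := vnorm_dist (F (x k)) w; have h3 := H2 k (leq_maxr _ _).
  have h4 := vnorm_ge0 (F (x k)); move=> h5 h6.
  clear -h2 h3 h4 h5 h6 w0 w1; nra.
have F_inj : injective_on D F.
  move=> z w Dz Dw E; apply: h_inj => //; apply: functional_extensionality => i.
  by rewrite -(vcat_rshift (f z) (h z)) -(vcat_rshift (f w) (h w)) -!FE E.
have F_emb : holo_embedding_on D F.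
  split=> //; split; last split.
  - move=> z Dz; have [L HL] := f_hol z Dz; have [M [HM inj]] := h_imm z Dz.
    exists (fun v => vcat (L v) (M v)); split; first exact: cderiv_vjoin.
    move=> v Ev; apply: inj; apply: functional_extensionality => i.
    by rewrite -(vcat_rshift (L v) (M v)) Ev.
  - exact: F_inj.
  move=> z Dz e e0; apply: NNPP => H.
  have P (k : nat) : exists w, [/\ D w, vdist (F w) (F z) < / (INR k + 1) & e <= vdist w z].
    apply: NNPP => H'; apply: H; exists (/ (INR k + 1)); split.
      by apply: Rinv_0_lt_compat; have := pos_INR k; lra.
    by move=> w Dw hw; apply: Rnot_le_lt => h'; apply: H'; exists w.
  have [x xP] := choice_fun P.
  have xD k : D (x k) by case: (xP k).
  have [phi [y [ex [cy Ey]]]] := compact_subseq E_bd E_cl (fun k => subset_closure (xD k)).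
  have cF : vcvg (fun k => F (x (phi k))) (F z).
    move=> r r0; have [N HN] := exists_inv_lt r0; exists N => k Nk.
    by have [_ h1 _] := xP (phi k); apply: Rlt_trans h1 (HN _ (leq_trans Nk (extraction_ge ex k))).
  have Dy := inside _ _ _ (fun k => xD (phi k)) Ey cy cF (F_ball z Dz).
  have yz : y = z := F_inj _ _ Dy Dz (cvg_unique (Fct y Dy _ cy) cF).
  have [N HN] := cy e e0; have [_ _ h1] := xP (phi N); have := HN N (leqnn _); rewrite yz; lra.
split=> //; split=> //; split; last first.
  apply: (complete_of_crossing (rho := rho) (T := T) (ell := ell)) => //.
  move=> k gam a b ab ct Kg ra rb; have [tau ht hl] := cross k gam a b ab ct Kg ra rb; exists tau => //.
  by apply: Rle_trans hl _; rewrite /vdist !FE vcat_sub; exact: vnorm_le_vcat.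
move=> K Kc KB x DK.
have [phi [w [ex [Kw cw]]]] := Kc (fun k => F (x k)) (fun k => proj2 (DK k)).
have [psi [z [ex2 [cz Ez]]]] := compact_subseq E_bd E_cl (fun k => subset_closure (proj1 (DK (phi k)))).
have cw2 := cvg_extract ex2 (cw : vcvg (fun k => F (x (phi k))) w).
have Dz := inside _ _ _ (fun k => proj1 (DK (phi (psi k)))) Ez cz cw2 (KB w Kw).
exists (fun k => phi (psi k)), z; split; first exact: extraction_comp.
by split=> //; split=> //; rewrite (cvg_unique (Fct z Dz _ cz) cw2).
Qed.
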